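(* Let $n\ge 5$ be odd and $m\ge 4$ even, and consider the simple random walk on $\Gamma_{n,m}$ endowed with the geometric distance $d=d_{\mathbb{H}^2}$. If \[ \sin(\pi/m)\,\cosh\!\left(\operatorname{arccosh}\!\left(\frac{\cos(\pi/m)}{\sin(\pi/n)}\right)+\operatorname{arccosh}\bigl(\cot(\pi/m)\cot(\pi/n)\bigr)\right) > \cosh(\log n), \] then $h_\mu < l_{d,\mu}\,v_d$.
   Context: $\Delta_{n,m}$ is a regular hyperbolic polygon with $n$ sides and interior angles $\frac{2\pi}{m}$; $\Gamma_{n,m}$ is the group generated by the reflections $r_1,\dots,r_n$ in its sides (presentation $\langle r_i \mid r_i^2=(r_ir_{i+1})^{m/2}=e\rangle$). Geometric distance: fix $x_0\in\mathbb{H}^2$ with trivial stabilizer, $d(g,h)=d_{\mathbb{H}^2}(g.x_0,h.x_0)$. Simple random walk: $X_k=\xi_1\cdots\xi_k$, $X_0=e$, $\xi_i$ i.i.d. uniform on $\{r_1,\dots,r_n\}$, step law $\mu$, $\mu_k$ the law of $X_k$. $v_d=\lim_k\frac{\log|\{g:d(e,g)\le k\}|}{k}$, $h_\mu=\lim_k\frac{-\mathbb{E}[\log\mu_k(X_k)]}{k}$, $l_{d,\mu}=\lim_k\frac{\mathbb{E}[d(e,X_k)]}{k}$. *)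

(* Defs.v *)
From HB Require Import structures.
From mathcomp Require Import all_boot all_order all_algebra.
From mathcomp Require Import all_classical all_reals all_analysis.
From mathcomp Require Import finmap.
Set Implicit Arguments. Unset Strict Implicit. Unset Printing Implicit Defensive.
Import Order.TTheory GRing.Theory Num.Theory.
Local Open Scope ring_scope.
Local Open Scope classical_set_scope.

Section Hyp.
Variable R : realType.

Definition cosh (x : R) : R := (expR x + expR (- x)) / 2.
Definition sinh (x : R) : R := (expR x - expR (- x)) / 2.
Definition arccosh (x : R) : R := ln (x + Num.sqrt (x ^+ 2 - 1)).
Definition cot (x : R) : R := cos x / sin x.

(* Hyperboloid model of H^2 in R^{2,1}: time-like coordinate is index 2.
   Minkowski form B(x,y) = x2 y2 - x0 y0 - x1 y1. *)
Definition J (b : 'I_3) : R := if val b == 2%N then 1 else -1.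
Definition mink (x y : 'cV[R]_3) : R := \sum_(b < 3) J b * x b 0 * y b 0.

Definition inH2 (x : 'cV[R]_3) : Prop := mink x x = 1 /\ 0 < x (inord 2) 0.

Definition hdist (x y : 'cV[R]_3) : R := arccosh (mink x y).

(* The regular hyperbolic polygon Delta_{n,m} centred at o = (0,0,1):
   its inradius rho satisfies cosh rho = cos(pi/m)/sin(pi/n), and side i
   (i < n, consecutive sides adjacent) is the geodesic B(x, s_i) = 0 with
   unit space-like normal
     s_i = (cosh rho cos(2 pi i/n), cosh rho sin(2 pi i/n), sinh rho). *)
Definition inradius (n m : nat) : R := arccosh (cos (pi / m%:R) / sin (pi / n%:R)).

Definition side_normal (n m : nat) (i : 'I_n) : 'cV[R]_3 :=
  let rho := inradius n m in
  let th := 2 * pi * (val i)%:R / n%:R in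
  \col_(a < 3) (if val a == 0%N then cosh rho * cos th
                else if val a == 1%N then cosh rho * sin th
                else sinh rho).

(* reflection in the side i: x |-> x + 2 B(x,s) s   (B(s,s) = -1) *)
Definition refl (n m : nat) (i : 'I_n) : 'M[R]_3 :=
  let s := side_normal m i in
  \matrix_(a < 3, b < 3) ((a == b)%:R + 2 * s a 0 * s b 0 * J b).

Definition word_mat (n m : nat) (w : seq 'I_n) : 'M[R]_3 :=
  foldr (fun i M => refl m i *m M) 1%:M w.

Definition Gamma (n m : nat) : set 'M[R]_3 :=
  [set g | exists w : seq 'I_n, g = word_mat m w].

Definition trivial_stab (n m : nat) (x0 : 'cV[R]_3) : Prop :=
  forall g, Gamma n m g -> g *m x0 = x0 -> g = 1%:M.

Definition gdist (x0 : 'cV[R]_3) (g h : 'M[R]_3) : R := hdist (g *m x0) (h *m x0).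

Definition mu_k (n m k : nat) (g : 'M[R]_3) : R :=
  (#|[set w : k.-tuple 'I_n | word_mat m w == g]|)%:R / (n ^ k)%:R.

Definition entropy_k (n m k : nat) : R :=
  - (\sum_(w : k.-tuple 'I_n) (1 / (n ^ k)%:R) * ln (mu_k n m k (word_mat m w))).

Definition drift_k (n m : nat) (x0 : 'cV[R]_3) (k : nat) : R :=
  \sum_(w : k.-tuple 'I_n) (1 / (n ^ k)%:R) * gdist x0 1%:M (word_mat m w).

Definition ball_card (n m : nat) (x0 : 'cV[R]_3) (k : nat) : nat :=
  #|` fset_set [set g | Gamma n m g /\ gdist x0 1%:M g <= k%:R] |.

End Hyp.

(* Main.v *)
Require Import Defs.
From HB Require Import structures.
From mathcomp Require Import all_boot all_order all_algebra.
From mathcomp Require Import all_classical all_reals all_analysis.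
From mathcomp Require Import finmap ring lra zify.
Import Order.TTheory GRing.Theory Num.Theory.
Import numFieldNormedType.Exports.
Local Open Scope ring_scope.
Local Open Scope classical_set_scope.
Set Implicit Arguments.
Unset Strict Implicit.
Unset Printing Implicit Defensive.

(* Write B for the Minkowski form, o for the centre of the polygon and
   beta g = B(o, g o) = cosh d(o, g o).  By Tits' argument the group acts on
   the orbit of o as a Coxeter group, so the orbit is discrete; packing and
   covering give c e^k <= #(ball of radius k) <= C e^k, hence v = 1 and
   sum_g beta(g)^-(1+p) <= C / p for 0 < p <= 1.

   Let gamma = r_0 r_k be the product of the reflections in a side and in one
   of the two sides at its opposite vertex.  The hypothesis says that these
   sides are at distance > log n, so gamma has translation length > 2 log n,
   while gamma^N is read by the walk with probability n^(-2N).  With frequency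
   at least p ~ n^(-2N) / N the walk reads gamma^N at a place lying on the
   geodesic from o to X_k o, and such places are far apart.  Hence X_k factors
   as a_1 gamma^N a_2 ... gamma^N a_(r+1) with r >= p k on average and
   sum_i log beta(a_i) <= log beta(X_k) - r (N |gamma| - C).  Charging
   (1 + p) log beta(a_i) for every a_i and log (C / p) for every gap defines a
   subprobability on the group, and the Gibbs inequality bounds the entropy by
   k (l - p (N |gamma| - 2 N log n - log N - C)), which beats k l for large N.

   Transience, needed to keep the good places apart, comes from the
   superharmonic function (4/5)^length: at most two reflections shorten a
   given element. *)

(** * Minkowski geometry *)

(** Everything is done with products of values of [B], never with distances. The four-point
    inequality [mink_four] is Gromov hyperbolicity in exponential form; it also holds for null
    vectors, so the ends of an axis are ordinary vectors and no boundary theory is needed. The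
    threshold log n comes from the following balance. The weight beta^-1 has infinite sum over the
    group, so the exponent must exceed 1. With exponent 1 + p the surcharge is p log beta(X_k) over
    the whole path, while the mass C / p of each factor is paid once per gap. Taking p equal to the
    frequency of the gaps makes the surcharge O(1) per gap, and log (C / p) becomes 2 N log n + log
    N + O(1). Each gap saves N |gamma|, so the gain wins for large N as soon as |gamma| > 2 log n.
    The separation that the places need grows linearly with N. The block length [M] and the length
    threshold [A] are therefore linear in N, which adds only log N to log (1 / p). Weights are
    summed over finite lists throughout, so no infinite sum over the group is ever formed. *)

Section MinkowskiForm.
Variable R : realType.
Implicit Types (x y z : 'cV[R]_3) (M : 'M[R]_3).

Definition ix : 'I_3 := inord 0.
Definition iy : 'I_3 := inord 1.
Definition it : 'I_3 := inord 2.

Lemma ixE : val ix = 0%N. Proof. by rewrite /= inordK. Qed.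
Lemma iyE : val iy = 1%N. Proof. by rewrite /= inordK. Qed.
Lemma itE : val it = 2%N. Proof. by rewrite /= inordK. Qed.

Definition vec3 (a b c : R) : 'cV[R]_3 :=
  \col_i (if val i == 0%N then a else if val i == 1%N then b else c).

Lemma vec3x a b c : vec3 a b c ix 0 = a.
Proof. by rewrite mxE ixE. Qed.

Lemma vec3y a b c : vec3 a b c iy 0 = b.
Proof. by rewrite mxE iyE. Qed.

Lemma vec3t a b c : vec3 a b c it 0 = c.
Proof. by rewrite mxE itE. Qed.

Lemma vec3_eta x : x = vec3 (x ix 0) (x iy 0) (x it 0).
Proof.
apply/matrixP => i j; rewrite ord1 mxE.
case: i => [[|[|[|//]]] hi] /=; congr (x _ _); apply/val_inj; by rewrite ?ixE ?iyE ?itE.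
Qed.

Lemma sum3 (F : 'I_3 -> R) : \sum_(i < 3) F i = F ix + F iy + F it.
Proof.
rewrite !big_ord_recr big_ord0 /= add0r; congr (F _ + F _ + F _);
  by apply/val_inj; rewrite ?ixE ?iyE ?itE.
Qed.

Lemma minkE x y :
  mink x y = x it 0 * y it 0 - x ix 0 * y ix 0 - x iy 0 * y iy 0.
Proof. by rewrite /mink sum3 /J ixE iyE itE /=; ring. Qed.

Lemma minkC x y : mink x y = mink y x.
Proof. by rewrite !minkE; ring. Qed.

Lemma minkDl x y z : mink (x + y) z = mink x z + mink y z.
Proof. by rewrite !minkE !mxE; ring. Qed.

Lemma minkDr x y z : mink z (x + y) = mink z x + mink z y.
Proof. by rewrite !minkE !mxE; ring. Qed.

Lemma minkZl c x y : mink (c *: x) y = c * mink x y.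
Proof. by rewrite !minkE !mxE; ring. Qed.

Lemma minkZr c x y : mink x (c *: y) = c * mink x y.
Proof. by rewrite !minkE !mxE; ring. Qed.

Definition causal x := 0 <= mink x x /\ 0 <= x it 0.

Definition org : 'cV[R]_3 := vec3 0 0 1.

Lemma mink_orgl x : mink org x = x it 0.
Proof. by rewrite minkE vec3x vec3y vec3t; ring. Qed.

Lemma mink_orgr x : mink x org = x it 0.
Proof. by rewrite minkC mink_orgl. Qed.

Lemma org_H2 : inH2 org.
Proof. by split; [rewrite mink_orgl vec3t | rewrite -/it vec3t]. Qed.

Lemma H2_causal x : inH2 x -> causal x.
Proof. by case=> h1 h2; split; [rewrite h1 | apply: ltW]. Qed.

Lemma H2_t_ge1 x : inH2 x -> 1 <= x it 0.
Proof.
case; rewrite minkE -/it => h1 h2; rewrite leNgt; apply/negP => h3.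
have hx := sqr_ge0 (x ix 0); have hy := sqr_ge0 (x iy 0).
have hz : x it 0 * x it 0 < 1 by nra.
by nra.
Qed.

(* Real spinors: the null vector of [(p, q)] is the symmetric matrix
   [[p^2, pq], [pq, q^2]], with [z + x] and [z - x] on the diagonal. *)
Definition spin (p q : R) := vec3 ((p ^+ 2 - q ^+ 2) / 2) (p * q) ((p ^+ 2 + q ^+ 2) / 2).

Lemma mink_spin p q r s : mink (spin p q) (spin r s) = (p * s - q * r) ^+ 2 / 2.
Proof. by rewrite minkE !vec3x !vec3y !vec3t; field. Qed.

(** A causal vector is a positive semidefinite symmetric matrix, since [mink x x] is its
    determinant; this is its Cholesky factorisation. When the first diagonal entry vanishes, so does
    the off-diagonal one. *)
Lemma causal_spin x : causal x -> exists p q s, x = spin p q + spin 0 s.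
Proof.
case; rewrite minkE => h1 h2.
have hp : 0 <= x it 0 + x ix 0 by nra.
have hq : 0 <= x it 0 - x ix 0 by nra.
have [p0|p0] := eqVneq (x it 0 + x ix 0) 0.
  exists 0, 0, (Num.sqrt (x it 0 - x ix 0)).
  have y0 : x iy 0 = 0.
    apply/eqP; rewrite -sqrf_eq0; apply/eqP.
    have hx : x ix 0 = - x it 0 by lra.
    by apply/eqP; rewrite eq_le sqr_ge0 andbT; move: h1; rewrite hx; lra.
  rewrite {1}(vec3_eta x) y0; apply/matrixP => i j; rewrite !mxE !sqr_sqrtr //.
  by case: ifP => _; [lra | case: ifP => _; lra].
set P := x it 0 + x ix 0 in hp p0.
have P0 : 0 < P by rewrite lt_def p0.
have sP : Num.sqrt P != 0 by rewrite sqrtr_eq0 -ltNge.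
have hs : 0 <= x it 0 - x ix 0 - x iy 0 ^+ 2 / P.
  by rewrite subr_ge0 ler_pdivrMr // /P; nra.
exists (Num.sqrt P), (x iy 0 / Num.sqrt P), (Num.sqrt (x it 0 - x ix 0 - x iy 0 ^+ 2 / P)).
rewrite {1}(vec3_eta x); apply/matrixP => i j; rewrite !mxE.
rewrite !(sqr_sqrtr hs) !expr_div_n !(sqr_sqrtr hp).
case: ifP => _; [rewrite /P; field | case: ifP => _; [field | rewrite /P; field]] => //.
Qed.

Lemma mink_four_spin (p q : 'I_4 -> R) :
  let v i := spin (p i) (q i) in
  forall i j k l, mink (v i) (v j) * mink (v k) (v l) <=
   2 * (mink (v i) (v k) * mink (v j) (v l) + mink (v i) (v l) * mink (v j) (v k)).
Proof.
move=> v i j k l; rewrite /v !mink_spin -subr_ge0.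
(* Pluecker relation for the 2x2 minors of four spinors *)
set A := p i * q k - q i * p k; set B := p j * q l - q j * p l.
set C := p i * q l - q i * p l; set D := p j * q k - q j * p k.
have -> : 2 * (A ^+ 2 / 2 * (B ^+ 2 / 2) + C ^+ 2 / 2 * (D ^+ 2 / 2)) -
  (p i * q j - q i * p j) ^+ 2 / 2 * ((p k * q l - q k * p l) ^+ 2 / 2) =
  ((A * B + C * D) / 2) ^+ 2 by rewrite /A /B /C /D; field.
exact: sqr_ge0.
Qed.

(** The difference of the two sides is additive in each of the four vectors, and a causal vector is
    a sum of two null ones, so the spinor case suffices. *)
Lemma mink_four x y z w : causal x -> causal y -> causal z -> causal w ->
  mink x y * mink z w <= 2 * (mink x z * mink y w + mink x w * mink y z).
Proof.
have base a1 a2 b1 b2 c1 c2 d1 d2 :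
  mink (spin a1 a2) (spin b1 b2) * mink (spin c1 c2) (spin d1 d2) <=
  2 * (mink (spin a1 a2) (spin c1 c2) * mink (spin b1 b2) (spin d1 d2) +
       mink (spin a1 a2) (spin d1 d2) * mink (spin b1 b2) (spin c1 c2)).
  have := @mink_four_spin (fun i => nth 0 [:: a1; b1; c1; d1] i)
     (fun i => nth 0 [:: a2; b2; c2; d2] i) (inord 0) (inord 1) (inord 2) (inord 3).
  by rewrite /= !inordK.
move=> /causal_spin[p [q [s ->]]] /causal_spin[p' [q' [s' ->]]].
move=> /causal_spin[p2 [q2 [s2 ->]]] /causal_spin[p3 [q3 [s3 ->]]].
set a := spin p q; set a' := spin 0 s; set b := spin p' q'; set b' := spin 0 s'.
set c := spin p2 q2; set c' := spin 0 s2; set d := spin p3 q3; set d' := spin 0 s3.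
pose T (t1 t2 t3 t4 : 'cV[R]_3) := 2 * (mink t1 t3 * mink t2 t4 + mink t1 t4 * mink t2 t3)
  - mink t1 t2 * mink t3 t4.
suff : 0 <= T (a + a') (b + b') (c + c') (d + d') by rewrite /T subr_ge0.
have TDx x1 x2 t2 t3 t4 : T (x1 + x2) t2 t3 t4 = T x1 t2 t3 t4 + T x2 t2 t3 t4.
  by rewrite /T !minkDl; ring.
have TDy t1 y1 y2 t3 t4 : T t1 (y1 + y2) t3 t4 = T t1 y1 t3 t4 + T t1 y2 t3 t4.
  by rewrite /T !minkDl !minkDr; ring.
have TDz t1 t2 z1 z2 t4 : T t1 t2 (z1 + z2) t4 = T t1 t2 z1 t4 + T t1 t2 z2 t4.
  by rewrite /T !minkDl !minkDr; ring.
have TDw t1 t2 t3 w1 w2 : T t1 t2 t3 (w1 + w2) = T t1 t2 t3 w1 + T t1 t2 t3 w2.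
  by rewrite /T !minkDr; ring.
have T0 a1 a2 b1 b2 c1 c2 d1 d2 :
    0 <= T (spin a1 a2) (spin b1 b2) (spin c1 c2) (spin d1 d2).
  by rewrite /T subr_ge0; apply: base.
rewrite TDx !TDy !TDz !TDw; move: T0; rewrite -/a; clearbody T => T0.
by do ![apply: addr_ge0]; apply: T0.
Qed.

Lemma mink_causal_ge0 x y : causal x -> causal y -> 0 <= mink x y.
Proof.
move=> /causal_spin[p [q [s ->]]] /causal_spin[p' [q' [s' ->]]].
rewrite !minkDl !minkDr !mink_spin.
by do ![apply: addr_ge0]; apply: divr_ge0 => //; exact: sqr_ge0.
Qed.

Lemma mink_tri x y u : causal x -> causal y -> inH2 u ->
  mink x y <= 4 * (mink x u * mink u y).
Proof.
move=> hx hy hu; have hc := H2_causal hu.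
have := mink_four hx hy hc hc; rewrite hu.1 (minkC y u); lra.
Qed.

(** Changing the sign of the spatial part of [y] keeps it causal, and the product of [x] with the
    new vector is nonnegative. *)
Lemma mink_le_t x y : causal x -> causal y -> mink x y <= 2 * (x it 0 * y it 0).
Proof.
move=> hx hy; have := mink_causal_ge0 hx (y := vec3 (- y ix 0) (- y iy 0) (y it 0)).
rewrite !minkE !vec3x !vec3y !vec3t => h.
suff : 0 <= x it 0 * y it 0 - x ix 0 * - y ix 0 - x iy 0 * - y iy 0 by lra.
apply: h; case: hy => hy1 hy2; split; last by rewrite vec3t.
by move: hy1; rewrite !minkE !vec3x !vec3y !vec3t; lra.
Qed.

Lemma mink_H2_ge1 x y : inH2 x -> inH2 y -> 1 <= mink x y.
Proof.
move=> hx hy; have h0 := mink_causal_ge0 (H2_causal hx) (H2_causal hy).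
case: hx => hx1 hx2; case: hy => hy1 hy2.
(* reversed Cauchy-Schwarz *)
have : 1 <= mink x y ^+ 2.
  have -> : 1 = mink x x * mink y y by rewrite hx1 hy1 mulr1.
  move: hx1 hy1 hx2 hy2; rewrite !minkE -/it.
  set a := x ix 0; set b := x iy 0; set c := x it 0.
  set a' := y ix 0; set b' := y iy 0; set c' := y it 0 => h1 h2 h3 h4.
  rewrite -subr_ge0.
  have -> : (c * c' - a * a' - b * b') ^+ 2 -
     (c * c - a * a - b * b) * (c' * c' - a' * a' - b' * b') =
     (a * c' - a' * c) ^+ 2 + (b * c' - b' * c) ^+ 2 - (a * b' - a' * b) ^+ 2 by ring.
  (* Multiplied by the square of the time coordinate of [y], the Gram difference becomes a sum of
     squares once B(y, y) = 1 is used. *)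
  have e : c' * c' * ((a * c' - a' * c) ^+ 2 + (b * c' - b' * c) ^+ 2 - (a * b' - a' * b) ^+ 2)
    = (c' * c' - a' * a' - b' * b') * ((a * c' - a' * c) ^+ 2 + (b * c' - b' * c) ^+ 2)
      + ((a * c' - a' * c) * a' + (b * c' - b' * c) * b') ^+ 2 by ring.
  have c'0 : 0 < c' * c' by apply: mulr_gt0.
  rewrite -(pmulr_rge0 _ c'0) e h2 mul1r.
  by do ![apply: addr_ge0]; exact: sqr_ge0.
by move=> h; rewrite leNgt; apply/negP => h2; nra.
Qed.

End MinkowskiForm.

Section HyperbolicFunctions.
Variable R : realType.
Implicit Types x y : R.

Lemma expR_arccosh x : 1 <= x -> expR (arccosh x) = x + Num.sqrt (x ^+ 2 - 1).
Proof.
by move=> x1; rewrite /arccosh lnK // posrE; have := sqrtr_ge0 (x ^+ 2 - 1); lra.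
Qed.

Lemma sqr_sub1_ge0 x : 1 <= x -> 0 <= x ^+ 2 - 1.
Proof. by move=> x1; nra. Qed.

Lemma expRN_arccosh x : 1 <= x -> expR (- arccosh x) = x - Num.sqrt (x ^+ 2 - 1).
Proof.
move=> x1; rewrite expRN expR_arccosh //.
have h : x + Num.sqrt (x ^+ 2 - 1) != 0.
  by rewrite gt_eqF //; have := sqrtr_ge0 (x ^+ 2 - 1); lra.
apply: (mulfI h); rewrite divff //.
have := sqr_sqrtr (sqr_sub1_ge0 x1); lra.
Qed.

Lemma cosh_arccosh x : 1 <= x -> cosh (arccosh x) = x.
Proof. by move=> x1; rewrite /cosh expR_arccosh // expRN_arccosh //; field. Qed.

Lemma sinh_arccosh x : 1 <= x -> sinh (arccosh x) = Num.sqrt (x ^+ 2 - 1).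
Proof. by move=> x1; rewrite /sinh expR_arccosh // expRN_arccosh //; field. Qed.

Lemma coshD x y : cosh (x + y) = cosh x * cosh y + sinh x * sinh y.
Proof. by rewrite /cosh /sinh opprD !expRD; field. Qed.

(** With [arccosh_le] this places [arccosh x] within ln 2 of [ln x], so limits per unit time may be
    computed with logarithms of [B]. *)
Lemma arccosh_ge x : 1 <= x -> ln x <= arccosh x.
Proof.
move=> x1; rewrite /arccosh ler_ln ?posrE //; have := sqrtr_ge0 (x ^+ 2 - 1); lra.
Qed.

Lemma arccosh_le x : 1 <= x -> arccosh x <= ln (2 * x).
Proof.
move=> x1; rewrite /arccosh ler_ln ?posrE //.
- have : Num.sqrt (x ^+ 2 - 1) <= x.
    rewrite -[leRHS]ger0_norm -?sqrtr_sqr ?ler_wsqrtr //; lra.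
  lra.
- by have := sqrtr_ge0 (x ^+ 2 - 1); lra.
- by lra.
Qed.

Lemma cos_sqr_ge_half x : 0 <= x <= pi / 4 -> 1 / 2 <= cos x ^+ 2.
Proof.
move=> hx; have : 0 <= cos (x *+ 2).
  by apply: cos_ge0_pihalf; have := pi_ge0 R; lra.
by rewrite cos_mulr2n; lra.
Qed.

Lemma cos_sqr_gt_half x : 0 <= x < pi / 4 -> 1 / 2 < cos x ^+ 2.
Proof.
move=> hx; have : 0 < cos (x *+ 2).
  by apply: cos_gt0_pihalf; have := pi_ge0 R; lra.
by rewrite cos_mulr2n; lra.
Qed.

Lemma sin_sub_pi x : sin (pi - x) = sin x.
Proof. by rewrite sinB sinpi cospi; ring. Qed.

Lemma sin_ge_unimodal x y : 0 <= x -> x <= y -> y <= pi - x -> sin x <= sin y.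
Proof.
move=> x0 xy yx; have p0 := pi_gt0 R.
have mono (a b : R) : 0 <= a -> a <= b -> b <= pi / 2 -> sin a <= sin b.
  move=> a0; rewrite le_eqVlt => /predU1P[->//|ab] b2; apply: ltW.
  by rewrite ltr_sin // in_itv /=; lra.
have [h|h] := leP y (pi / 2); first exact: mono.
by rewrite -(sin_sub_pi y); apply: mono; lra.
Qed.

End HyperbolicFunctions.

(** * The polygon and its reflection group *)

Section Polygon.
Variables (R : realType) (n m : nat).
Hypotheses (n5 : (5 <= n)%N) (m4 : (4 <= m)%N).
Local Notation s := (@side_normal R n m).

Definition ch : R := cos (pi / m%:R) / sin (pi / n%:R).
Definition sh : R := Num.sqrt (ch ^+ 2 - 1).

Lemma n_ge5 : 5 <= n%:R :> R. Proof. by rewrite (ler_nat _ 5). Qed.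
Lemma m_ge4 : 4 <= m%:R :> R. Proof. by rewrite (ler_nat _ 4). Qed.

Lemma pi_n_bounds : 0 < pi / n%:R :> R /\ pi / n%:R <= pi / 5 :> R.
Proof.
have p := pi_gt0 R; have h := n_ge5; split; first by apply: divr_gt0 => //; lra.
by rewrite ler_wpM2l ?pi_ge0 // lef_pV2 ?posrE //; lra.
Qed.

Lemma pi_m_bounds : 0 < pi / m%:R :> R /\ pi / m%:R <= pi / 4 :> R.
Proof.
have p := pi_gt0 R; have h := m_ge4; split; first by apply: divr_gt0 => //; lra.
by rewrite ler_wpM2l ?pi_ge0 // lef_pV2 ?posrE //; lra.
Qed.

Lemma sin_pi_n_gt0 : 0 < sin (pi / n%:R) :> R.
Proof. by have [h1 h2] := pi_n_bounds; apply: sin_gt0_pi; have := pi_gt0 R; lra. Qed.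

Lemma cos_pi_n_gt0 : 0 < cos (pi / n%:R) :> R.
Proof. by have [h1 h2] := pi_n_bounds; apply: cos_gt0_pihalf; have := pi_gt0 R; lra. Qed.

Lemma sin_pi_m_gt0 : 0 < sin (pi / m%:R) :> R.
Proof. by have [h1 h2] := pi_m_bounds; apply: sin_gt0_pi; have := pi_gt0 R; lra. Qed.

Lemma cos_pi_m_gt0 : 0 < cos (pi / m%:R) :> R.
Proof. by have [h1 h2] := pi_m_bounds; apply: cos_gt0_pihalf; have := pi_gt0 R; lra. Qed.

(** The polygon is hyperbolic: n >= 5 and m >= 4 give sin^2 (pi/n) < 1/2 <= cos^2 (pi/m). *)
Lemma ch_gt1 : 1 < ch.
Proof.
have [h1 h2] := pi_n_bounds; have [h3 h4] := pi_m_bounds.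
rewrite /ch ltr_pdivlMr ?sin_pi_n_gt0 // mul1r -(ltr_pXn2r (n := 2)) ?nnegrE //;
  [|exact/ltW/sin_pi_n_gt0|exact/ltW/cos_pi_m_gt0].
have := @cos_sqr_gt_half R (pi / n%:R); have := @cos_sqr_ge_half R (pi / m%:R).
rewrite sin2cos2; have p := pi_gt0 R; lra.
Qed.

Lemma sh_gt0 : 0 < sh.
Proof. by rewrite sqrtr_gt0; have := ch_gt1; nra. Qed.

Lemma ch_sh : ch ^+ 2 = 1 + sh ^+ 2.
Proof. by rewrite sqr_sqrtr; [ring | apply: sqr_sub1_ge0; exact/ltW/ch_gt1]. Qed.

Definition th (i : nat) : R := 2 * pi * i%:R / n%:R.

Lemma sideE i : s i = vec3 (ch * cos (th i)) (ch * sin (th i)) sh.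
Proof.
rewrite /side_normal /inradius -/ch cosh_arccosh ?sinh_arccosh ?(ltW ch_gt1) //.
Qed.

Lemma mink_org_side i : mink (org R) (s i) = sh.
Proof. by rewrite mink_orgl sideE vec3t. Qed.

Lemma mink_side i j :
  mink (s i) (s j) = 2 * ch ^+ 2 * sin (pi * `|i%:R - j%:R| / n%:R) ^+ 2 - 1.
Proof.
have e : sin (pi * `|i%:R - j%:R| / n%:R) ^+ 2 = sin ((th i - th j) / 2) ^+ 2.
  have n0 : n%:R != 0 :> R by rewrite gt_eqF //; have := n_ge5; lra.
  have -> : (th i - th j) / 2 = pi * (i%:R - j%:R) / n%:R by rewrite /th; field.
  have [h|h] := ger0P (i%:R - j%:R : R) => //.
  by rewrite mulrN mulNr sinN sqrrN.
have -> : mink (s i) (s j) = sh ^+ 2 - ch ^+ 2 * cos (th i - th j).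
  by rewrite !sideE minkE !vec3x !vec3y !vec3t cosB; ring.
have -> : th i - th j = ((th i - th j) / 2) *+ 2 by rewrite mulr2n; field.
rewrite cos_mulr2n cos2sin2 e; have := ch_sh; set S := sin _.
by move=> h; rewrite h; ring.
Qed.

Lemma mink_side_self i : mink (s i) (s i) = -1.
Proof. by rewrite mink_side subrr normr0 mulr0 mul0r sin0; ring. Qed.

Definition gap (i j : nat) : nat := ((i - j) + (j - i))%N.

Lemma gapE i j : `|i%:R - j%:R| = (gap i j)%:R :> R.
Proof.
rewrite /gap; case: (leqP j i) => h.
  rewrite (eqP (_ : (j - i == 0)%N)) ?addn0; last by rewrite subn_eq0.
  by rewrite natrB // ger0_norm // subr_ge0 ler_nat.
rewrite (eqP (_ : (i - j == 0)%N)) ?add0n; last by rewrite subn_eq0 ltnW.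
by rewrite distrC natrB ?(ltnW h) // ger0_norm // subr_ge0 ler_nat ltnW.
Qed.

Definition adj (i j : 'I_n) := (gap i j == 1)%N || (gap i j == n.-1).

Lemma adjC i j : adj i j = adj j i.
Proof. by rewrite /adj /gap addnC. Qed.

Lemma mink_adj i j : adj i j -> mink (s i) (s j) = cos (2 * pi / m%:R).
Proof.
have n0 : n%:R != 0 :> R by rewrite gt_eqF //; have := n_ge5; lra.
have m0 : m%:R != 0 :> R by rewrite gt_eqF //; have := m_ge4; lra.
move=> h; rewrite mink_side gapE.
have -> : sin (pi * (gap i j)%:R / n%:R) = sin (pi / n%:R) :> R.
  case/orP: h => /eqP ->; first by rewrite mulr1.
  rewrite -(sin_sub_pi (pi / n%:R)); congr sin.
  rewrite -subn1 natrB; last by move: n5; case: (n).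
  by field.
have -> : 2 * pi / m%:R = (pi / m%:R) *+ 2 :> R by rewrite mulr2n; field.
rewrite cos_mulr2n; have sn : sin (pi / n%:R) != 0 :> R by rewrite gt_eqF ?sin_pi_n_gt0.
by rewrite /ch; field.
Qed.

(** Non-adjacent sides lie on lines that do not cross. The sine is smallest at gap 2 (or n - 2),
    where [ch ^+ 2] times its square is at least 4 cos^2 (pi/m) cos^2 (pi/n) >= 1. *)
Lemma mink_nonadj i j : i != j -> ~~ adj i j -> 1 <= mink (s i) (s j).
Proof.
have n0 : 0 < n%:R :> R by have := n_ge5; lra.
move=> ij; rewrite /adj negb_or => /andP[g1 gn].
have g0 : (gap i j != 0)%N.
  apply: contraNneq ij => /eqP; rewrite /gap addn_eq0 !subn_eq0 => h.
  by apply/eqP/val_inj/eqP; rewrite eqn_leq.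
have [in_ jn] := (ltn_ord i, ltn_ord j).
have [g2 gn2] : (2 <= gap i j)%N /\ (gap i j + 2 <= n)%N.
  by move: g0 g1 gn in_ jn n5; rewrite /gap; lia.
rewrite mink_side gapE.
have hs : sin (2 * (pi / n%:R)) <= sin (pi * (gap i j)%:R / n%:R) :> R.
  have p0 := pi_gt0 R; apply: sin_ge_unimodal.
  - by rewrite mulr_ge0 // ltW //; have [] := pi_n_bounds.
  - rewrite mulrA ler_pM2r ?invr_gt0 // mulrC ler_pM2l // ler_nat //.
  - rewrite -subr_ge0; have -> : pi - 2 * (pi / n%:R) - pi * (gap i j)%:R / n%:R =
      pi * (n%:R - (gap i j + 2)%:R) / n%:R :> R by rewrite natrD; field; lra.
    by apply: divr_ge0; [apply: mulr_ge0; rewrite ?subr_ge0 ?ler_nat // ltW | exact: ltW].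
have [h1 h2] := pi_n_bounds; have [h3 h4] := pi_m_bounds; have p0 := pi_gt0 R.
have cn : 1 / 2 <= cos (pi / n%:R) ^+ 2 :> R by apply: cos_sqr_ge_half; lra.
have cm : 1 / 2 <= cos (pi / m%:R) ^+ 2 :> R by apply: cos_sqr_ge_half; lra.
have sn := sin_pi_n_gt0; have cn0 := cos_pi_n_gt0.
have hs2 : (2 * sin (pi / n%:R) * cos (pi / n%:R)) ^+ 2 <= sin (pi * (gap i j)%:R / n%:R) ^+ 2 :> R.
  rewrite ler_sqr ?nnegrE.
  - apply: le_trans hs; rewrite [2 * (_ / _)]mulrC mulr_natr sin_mulr2n mulr2n.
    rewrite le_eqVlt; apply/orP; left; apply/eqP; ring.
  - by rewrite !mulr_ge0 // ltW.
  - apply: le_trans hs; apply: sin_ge0_pi; lra.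
suff : 1 <= ch ^+ 2 * sin (pi * (gap i j)%:R / n%:R) ^+ 2 by lra.
apply: le_trans (ler_wpM2l (sqr_ge0 _) hs2).
have -> : ch ^+ 2 * (2 * sin (pi / n%:R) * cos (pi / n%:R)) ^+ 2 =
  4 * (cos (pi / m%:R) ^+ 2 * cos (pi / n%:R) ^+ 2) by rewrite /ch; field; rewrite gt_eqF.
by nra.
Qed.

(** The symmetry axis through the midpoint of side [z] is perpendicular to it, reaches the opposite
    vertex after inradius plus circumradius, and meets side [k] there at angle pi/m. For two lines
    in this position the cosh of their distance is sin (pi/m) times the cosh of that length. *)
Lemma far_side_mink (k : 'I_n) (z : 'I_n) : odd n -> val z = 0%N -> val k = n./2 ->
  sin (pi / m%:R) * cosh (arccosh ch + arccosh (cot (pi / m%:R) * cot (pi / n%:R)))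
  = mink (s z) (s k).
Proof.
have n0 : n%:R != 0 :> R by rewrite gt_eqF //; have := n_ge5; lra.
move=> on z0 kn; have sm := sin_pi_m_gt0; have sn := sin_pi_n_gt0.
have cm := cos_pi_m_gt0; have cn := cos_pi_n_gt0.
have c1 := ch_gt1.
set q := cot _ * cot _.
have snz : sin (pi / n%:R) != 0 :> R by rewrite gt_eqF.
have smz : sin (pi / m%:R) != 0 :> R by rewrite gt_eqF.
(* Sine rule in the right triangle formed by centre, foot and vertex: sinh (inradius) = sin (pi/m)
   sinh (circumradius). *)
have e : q ^+ 2 - 1 = (ch ^+ 2 - 1) / sin (pi / m%:R) ^+ 2.
  have h1 := cos2Dsin2 (pi / m%:R : R); have h2 := cos2Dsin2 (pi / n%:R : R).
  rewrite /q /cot /ch; move: snz smz h1 h2.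
  set a := cos (pi / m%:R); set b := sin (pi / m%:R).
  set c := cos (pi / n%:R); set d := sin (pi / n%:R) => snz smz h1 h2.
  apply/eqP; rewrite -subr_eq0; apply/eqP.
  rewrite (_ : _ - _ = (a ^+ 2 * c ^+ 2 - b ^+ 2 * d ^+ 2 - a ^+ 2 + d ^+ 2) / (b ^+ 2 * d ^+ 2)); last first.
    by field; rewrite snz smz.
  have -> : c ^+ 2 = 1 - d ^+ 2 by lra.
  have -> : a ^+ 2 = 1 - b ^+ 2 by lra.
  by rewrite (_ : _ - _ + _ = 0) ?mul0r //; ring.
have q1 : 1 <= q.
  have q0 : 0 <= q by rewrite /q /cot !mulr_ge0 ?invr_ge0 // ltW.
  suff : 0 <= q ^+ 2 - 1 by move=> h; nra.
  by rewrite e divr_ge0 ?sqr_ge0 ?sqr_sub1_ge0 ?ltW.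
rewrite coshD !cosh_arccosh ?sinh_arccosh ?(ltW c1) // e.
rewrite sqrtrM ?sqr_sub1_ge0 ?ltW // -/sh.
have -> : Num.sqrt (sin (pi / m%:R) ^+ 2)^-1 = (sin (pi / m%:R))^-1 :> R.
  by rewrite -exprVn sqrtr_sqr ger0_norm // invr_ge0 ltW.
rewrite mink_side z0 sub0r normrN normr_nat kn.
have -> : pi * (n./2)%:R / n%:R = pi / 2 - (pi / n%:R) / 2 :> R.
  have hn : n%:R = 1 + (n./2)%:R * 2 :> R.
    by rewrite -[in LHS](odd_double_half n) on natrD -muln2 natrM.
  by move: n0; rewrite hn => n0; field.
have -> x : sin (pi / 2 - x) = cos x :> R by rewrite sinB sin_pihalf cos_pihalf; ring.
have h : cos (pi / n%:R) = 2 * cos (pi / n%:R / 2) ^+ 2 - 1 :> R.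
  by rewrite {1}(_ : pi / n%:R = pi / n%:R / 2 *+ 2) ?cos_mulr2n ?mulr2n; [ring | field].
have -> : cos (pi / n%:R / 2) ^+ 2 = (1 + cos (pi / n%:R)) / 2 :> R by rewrite h; field.
have -> : sin (pi / m%:R) * (ch * q + sh * (sh / sin (pi / m%:R))) =
   cos (pi / n%:R) * ch ^+ 2 + sh ^+ 2.
  by rewrite /q /cot /ch; field; rewrite ?snz ?smz.
by have := ch_sh; lra.
Qed.

End Polygon.

Section ReflectionGroup.
Variables (R : realType) (n m : nat).
Hypotheses (n5 : (5 <= n)%N) (m4 : (4 <= m)%N).
Local Notation s := (@side_normal R n m).
Local Notation r := (@refl R n m).
Local Notation wm := (@word_mat R n m).
Local Notation Gam := (@Gamma R n m).
Local Notation o := (org R).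

Lemma mx_col_ext (A B : 'M[R]_3) : (forall x : 'cV[R]_3, A *m x = B *m x) -> A = B.
Proof.
by move=> h; apply/trmx_inj/row_matrixP => j; rewrite -!tr_col !colE h.
Qed.

Lemma reflE i (y : 'cV[R]_3) : r i *m y = y + (2 * mink y (s i)) *: s i.
Proof.
apply/matrixP => a b; rewrite ord1 mxE [RHS]mxE.
under eq_bigr do rewrite mxE mulrDl.
rewrite big_split /=; congr (_ + _).
  rewrite (bigD1 a) //= eqxx mul1r big1 ?addr0 // => k ka.
  by rewrite eq_sym (negbTE ka) mul0r.
rewrite [RHS]mxE /mink mulr_sumr mulr_suml; apply: eq_bigr => k _; ring.
Qed.

Lemma refl_mink_sym i (x y : 'cV[R]_3) : mink (r i *m x) y = mink x (r i *m y).
Proof. by rewrite !reflE minkDl minkDr minkZl minkZr (minkC (s i) y); ring. Qed.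

Lemma reflK i : r i *m r i = 1%:M.
Proof.
apply: mx_col_ext => x; rewrite mul1mx -mulmxA !reflE minkDl minkZl mink_side_self //.
rewrite -addrA -scalerDl; set c := (X in X *: _).
rewrite (_ : c = 0) ?scale0r ?addr0 // /c; ring.
Qed.

Lemma reflKm i (A : 'M[R]_3) : r i *m (r i *m A) = A.
Proof. by rewrite mulmxA reflK mul1mx. Qed.

Lemma reflKv i (x : 'cV[R]_3) : r i *m (r i *m x) = x.
Proof. by rewrite mulmxA reflK mul1mx. Qed.

Lemma refl_isom i (x y : 'cV[R]_3) : mink (r i *m x) (r i *m y) = mink x y.
Proof. by rewrite refl_mink_sym reflKv. Qed.

(** Pairing with [o] detects the sheet, and B(o, r x) = B(r o, x), so only the image of [o] has to
    be computed. *)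
Lemma refl_H2 i (x : 'cV[R]_3) : inH2 x -> inH2 (r i *m x).
Proof.
have h0 : inH2 (r i *m o).
  split; first by rewrite refl_isom; have [] := org_H2 R.
  by rewrite -/it -mink_orgl reflE minkDr minkZr !mink_org_side // -/it mink_orgl vec3t;
    have := sh_gt0 R n5 m4; nra.
move=> hx; split; first by rewrite refl_isom; case: hx.
by rewrite -/it -mink_orgl -refl_mink_sym; have := mink_H2_ge1 h0 hx; lra.
Qed.

Lemma wm_cons i w : wm (i :: w) = r i *m wm w. Proof. by []. Qed.

Lemma wm_cat u v : wm (u ++ v) = wm u *m wm v.
Proof. by elim: u => [|i u IH]; rewrite ?mul1mx //= IH mulmxA. Qed.

Lemma wm_revK w : wm (rev w) *m wm w = 1%:M.
Proof.
elim: w => [|i w IH]; first by rewrite mul1mx.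
by rewrite rev_cons -cats1 wm_cat /= mulmx1 -mulmxA reflKm.
Qed.

Lemma Gam_wm w : Gam (wm w). Proof. by exists w. Qed.

Lemma Gam1 : Gam 1%:M. Proof. by exists [::]. Qed.

Lemma GamM g h : Gam g -> Gam h -> Gam (g *m h).
Proof. by move=> [u ->] [v ->]; rewrite -wm_cat; apply: Gam_wm. Qed.

Lemma Gam_r i : Gam (r i). Proof. by exists [:: i]; rewrite /= mulmx1. Qed.

Lemma Gam_unit g : Gam g -> g \in unitmx.
Proof. by move=> [w ->]; have /mulmx1_unit [] := wm_revK w. Qed.

Lemma invmx_wm w : invmx (wm w) = wm (rev w).
Proof. by rewrite -[LHS]mul1mx -(wm_revK w) mulmxK // Gam_unit //; apply: Gam_wm. Qed.

Lemma GamV g : Gam g -> Gam (invmx g).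
Proof. by move=> [w ->]; rewrite invmx_wm; apply: Gam_wm. Qed.

Lemma Gam_isom g (x y : 'cV[R]_3) : Gam g -> mink (g *m x) (g *m y) = mink x y.
Proof.
move=> [w ->]; elim: w => [|i w IH] /=; first by rewrite !mul1mx.
by rewrite -!mulmxA refl_isom.
Qed.

Lemma Gam_H2 g (x : 'cV[R]_3) : Gam g -> inH2 x -> inH2 (g *m x).
Proof.
move=> [w ->] hx; elim: w => [|i w IH] /=; first by rewrite mul1mx.
by rewrite -mulmxA; apply: refl_H2.
Qed.

Lemma Gam_mink_adj g (x y : 'cV[R]_3) : Gam g -> mink (g *m x) y = mink x (invmx g *m y).
Proof.
by move=> hg; rewrite -(Gam_isom x _ hg) mulmxA mulmxV ?Gam_unit // mul1mx.
Qed.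

Lemma Gam_orbit_H2 g : Gam g -> inH2 (g *m o).
Proof. by move=> hg; apply: Gam_H2 => //; exact: org_H2. Qed.

(** Boolean so that [ex_minn] applies. The resulting [len] is taken in the matrix group, without any
    presentation, and has the default value 0 outside the group. *)
Definition haslen (g : 'M[R]_3) : pred nat := fun k => `[< exists2 w, size w = k & g = wm w >].

Definition len (g : 'M[R]_3) : nat :=
  match pselect (exists k, haslen g k) with
  | left e => ex_minn e
  | right _ => 0%N
  end.

Lemma len_wm w : (len (wm w) <= size w)%N.
Proof.
rewrite /len; case: pselect => [e|//].
by case: ex_minnP => k _; apply; apply/asboolP; exists w.
Qed.

Lemma len_word g : Gam g -> exists2 w, size w = len g & g = wm w.
Proof.
move=> [w gw]; rewrite /len; case: pselect => [e|[]].
  by case: ex_minnP => k /asboolP.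
by exists (size w); apply/asboolP; exists w.
Qed.

Lemma len1 : len 1%:M = 0%N.
Proof. by apply/eqP; rewrite -leqn0; apply: (len_wm [::]). Qed.

Lemma len_eq0 g : Gam g -> len g = 0%N -> g = 1%:M.
Proof. by move=> /len_word[w sw gw] h; move: sw; rewrite h gw => /size0nil ->. Qed.

Lemma lenM g h : Gam g -> Gam h -> (len (g *m h) <= len g + len h)%N.
Proof.
move=> /len_word[u su gu] /len_word[v sv hv]; rewrite -su -sv -size_cat.
by rewrite gu hv -wm_cat len_wm.
Qed.

Lemma len_r i g : Gam g -> (len (r i *m g) <= (len g).+1)%N.
Proof.
by move=> /len_word[u su gu]; rewrite -su {1}gu -wm_cons; apply: (len_wm (i :: u)).
Qed.

Lemma len_r' i g : Gam g -> (len g <= (len (r i *m g)).+1)%N.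
Proof.
move=> hg; rewrite -{1}(reflKm i g); apply: len_r; exact: GamM (Gam_r i) hg.
Qed.

Lemma lenV g : Gam g -> len (invmx g) = len g.
Proof.
have h g' : Gam g' -> (len (invmx g') <= len g')%N.
  by move=> /len_word[u su gu]; rewrite -su gu invmx_wm -size_rev len_wm.
move=> hg; apply/eqP; rewrite eqn_leq h //= -{1}(invmxK g) h //; exact: GamV.
Qed.

Fixpoint alt (i j : 'I_n) k : 'M[R]_3 :=
  if k is k'.+1 then r i *m alt j i k' else 1%:M.

Lemma Gam_alt i j k : Gam (alt i j k).
Proof. by elim: k i j => [|k IH] i j; [exact: Gam1 | apply: GamM; [exact: Gam_r|exact: IH]]. Qed.

Lemma len_alt i j k : (len (alt i j k) <= k)%N.
Proof.
elim: k i j => [|k IH] i j; first by rewrite len1.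
by apply: leq_trans (len_r _ (Gam_alt _ _ _)) _; rewrite ltnS.
Qed.

(* Chebyshev polynomials of the second kind, shifted: [U_k (cos t) = sin (k t) / sin t]. *)
Fixpoint cheb (c : R) (k : nat) : R :=
  if k is k'.+1 then (if k' is k''.+1 then 2 * c * cheb c k' - cheb c k'' else 1) else 0.

Lemma chebSS c k : cheb c k.+2 = 2 * c * cheb c k.+1 - cheb c k. Proof. by []. Qed.

Lemma cheb_cos t k : cheb (cos t) k * sin t = sin (t *+ k).
Proof.
elim/ltn_ind: k => -[|[|k]] IH; first by rewrite mulr0n sin0 mul0r.
  by rewrite mul1r mulr1n.
rewrite chebSS mulrBl -!mulrA !IH // !(mulrS t) !sinD !cosD.
set S := sin (t *+ k); set C := cos (t *+ k).
have h := cos2Dsin2 t; transitivity (cos t * sin t * 2 * C + S * (2 * cos t ^+ 2 - 1)); first by ring.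
have -> : 2 * cos t ^+ 2 - 1 = cos t ^+ 2 - sin t ^+ 2 by lra.
by ring.
Qed.

(** The case of lines that do not cross: here [cheb] is sinh (k t) / sinh t with c = cosh t, or k
    itself when c = 1. *)
Lemma cheb_ge c k : 1 <= c -> 0 < cheb c k.+1 /\ cheb c k <= cheb c k.+1.
Proof.
move=> c1; elim: k => [|k [IH1 IH2]]; first by split => /=; lra.
by rewrite chebSS; split; nra.
Qed.

(** Pairing with one normal after reflecting in the other adds 2 c times the other pairing, which is
    the recurrence of [cheb]. The parity of [k] tells which letter is innermost; the pairing with
    that letter's normal carries the larger index. *)
Lemma alt_mink i j k (x : 'cV[R]_3) :
  let c := mink (s i) (s j) in let p := mink x (s i) in let q := mink x (s j) in
  mink (alt i j k *m x) (s j) =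
  if odd k then cheb c k * q + cheb c k.+1 * p else cheb c k * p + cheb c k.+1 * q.
Proof.
have side_step a b (y : 'cV[R]_3) :
    mink (r a *m y) (s b) = mink y (s b) + 2 * mink (s a) (s b) * mink y (s a).
  by rewrite reflE minkDl minkZl; ring.
have side_self a (y : 'cV[R]_3) : mink (r a *m y) (s a) = - mink y (s a).
  by rewrite side_step mink_side_self //; ring.
elim/ltn_ind: k i j => -[|[|k]] IH i j c p q.
- by rewrite /= mul1mx -/q; ring.
- by rewrite /= mulmx1 side_step -/p -/q -/c; ring.
rewrite [alt _ _ _]/= -mulmxA side_step -/(alt j i k.+1).
rewrite (IH k.+1) // [alt j i k.+1]/= -[_ *m _ *m x]mulmxA side_self (IH k) //.
rewrite (minkC (s j)) -/c -/p -/q !chebSS /= negbK.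
by case: (odd k) => /=; ring.
Qed.

Lemma alt_mink_self i j k (x : 'cV[R]_3) :
  mink (alt i j k.+1 *m x) (s i) = - mink (alt j i k *m x) (s i).
Proof. by rewrite /= -mulmxA reflE minkDl minkZl mink_side_self //; ring. Qed.

Lemma alt_mink_gt0 i j k (x : 'cV[R]_3) :
  0 < mink x (s i) -> 0 < mink x (s j) ->
  0 <= cheb (mink (s i) (s j)) k -> 0 <= cheb (mink (s i) (s j)) k.+1 ->
  (0 < cheb (mink (s i) (s j)) k) || (0 < cheb (mink (s i) (s j)) k.+1) ->
  0 < mink (alt i j k *m x) (s j).
Proof.
move=> hi hj h1 h2 h; rewrite alt_mink; case: (odd k); case/orP: h => h3;
by [apply: ltr_pwDl; [exact: mulr_gt0 | apply: mulr_ge0 => //; exact: ltW]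
   |apply: ltr_wpDl; [apply: mulr_ge0 => //; exact: ltW| exact: mulr_gt0]].
Qed.

Lemma alt_span i j k (x : 'cV[R]_3) :
  exists a b : R, alt i j k *m x = x + a *: s i + b *: s j.
Proof.
elim: k i j => [|k IH] i j; first by exists 0, 0; rewrite mul1mx !scale0r !addr0.
rewrite /= -mulmxA; have [a [b ->]] := IH j i.
rewrite reflE; set c := 2 * _; exists (b + c), a.
by rewrite scalerDl -!addrA; congr (_ + _); rewrite addrC -addrA.
Qed.

Local Notation q := (m./2).
Hypothesis m_even : ~~ odd m.

Let theta : R := 2 * pi / m%:R.

Lemma theta_q : theta *+ q = pi.
Proof.
have m0 : m%:R != 0 :> R by rewrite gt_eqF //; have := m_ge4 R m4; lra.
rewrite /theta -mulr_natr.
have -> : m%:R = 2 * q%:R :> R.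
  by rewrite -natrM mul2n -[in LHS](odd_double_half m) (negbTE m_even).
field; rewrite pnatr_eq0; move: m4; case: (m) => [|[|k]] //.
Qed.

Lemma q_ge2 : (2 <= q)%N. Proof. by have := half_leq m4. Qed.

Lemma theta_gt0 : 0 < theta.
Proof. by rewrite /theta !mulr_gt0 ?pi_gt0 // invr_gt0; have := m_ge4 R m4; lra. Qed.

Lemma theta_lt_pi k : (k < q)%N -> theta *+ k < pi.
Proof. by move=> kq; rewrite -theta_q ltr_pMn2l // theta_gt0. Qed.

Lemma sin_theta_gt0 : 0 < sin theta.
Proof.
by apply: sin_gt0_pi; rewrite theta_gt0 /= (theta_lt_pi (k := 1)) // q_ge2.
Qed.

Lemma cheb_adj_gt0 k : (0 < k < q)%N -> 0 < cheb (cos theta) k.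
Proof.
move=> /andP[k0 kq]; rewrite -(pmulr_lgt0 _ sin_theta_gt0) cheb_cos.
by apply: sin_gt0_pi; rewrite theta_lt_pi // pmulrn_lgt0 // theta_gt0.
Qed.

Lemma cheb_adj_q : cheb (cos theta) q = 0.
Proof.
apply/eqP; rewrite -(mulIr_eq0 _ (mulIf (lt0r_neq0 sin_theta_gt0))) cheb_cos.
by rewrite theta_q sinpi.
Qed.

Lemma cheb_adj_q1 : cheb (cos theta) q.-1 = 1.
Proof.
apply: (mulIf (lt0r_neq0 sin_theta_gt0)); rewrite cheb_cos mul1r.
rewrite -subn1 mulrnBr ?(leq_trans _ q_ge2) // theta_q sinB sinpi cospi; ring.
Qed.

(** Both sides move [x] inside the plane spanned by [s i] and [s j] ([alt_span]), whose Gram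
    determinant is sin^2 theta, not zero. It is enough to compare the pairings with the two normals,
    and [cheb] takes the values 1, 0, -1 at q - 1, q, q + 1. *)
Lemma alt_braid i j : adj i j -> alt i j q = alt j i q.
Proof.
move=> ij; apply: mx_col_ext => x.
have c1 : mink (s i) (s j) = cos theta by rewrite (mink_adj R n5 m4 ij).
have c2 : mink (s j) (s i) = cos theta by rewrite minkC.
have key a b : mink (s a) (s b) = cos theta ->
    mink (alt a b q *m x) (s b) = mink (alt b a q *m x) (s b).
  move=> cab; have cba : mink (s b) (s a) = cos theta by rewrite minkC.
  have := q_ge2; case E : q => [|k] // _.
  rewrite alt_mink_self !alt_mink cab /=.
  have hk : cheb (cos theta) k = 1 by rewrite -cheb_adj_q1 E.
  have hk1 : cheb (cos theta) k.+1 = 0 by rewrite -E cheb_adj_q.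
  have hk2 : cheb (cos theta) k.+2 = -1 by rewrite chebSS hk hk1; ring.
  rewrite -/(cheb (cos theta) k.+1) -/(cheb (cos theta) k.+2).
  by rewrite hk2 hk1 hk; case: (odd k) => /=; ring.
have e1 := key _ _ c1; have e2 := key _ _ c2.
have [a [b ab]] := alt_span i j q x; have [b' [a' ab']] := alt_span j i q x.
move: e1 e2; rewrite {}ab {}ab' !minkDl !minkZl !mink_side_self // c1 c2 => e1 e2.
have h := cos2Dsin2 theta; have hs := sin_theta_gt0.
have ha : (a - a') * sin theta ^+ 2 = 0.
  by rewrite sin2cos2; set c := cos theta in e1 e2 *; nra.
have {}ha : a = a'.
  by apply/eqP; rewrite -subr_eq0; move/eqP: ha; rewrite mulf_eq0 sqrf_eq0 (gt_eqF hs) orbF.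
have hb : b = b' by move: e1 e2; rewrite ha; lra.
by rewrite ha hb -!addrA; congr (_ + _); rewrite addrC.
Qed.

End ReflectionGroup.

(** * Tits' theorem: signs of walls and word length *)

Section Tits.
Variables (R : realType) (n m : nat).
Hypotheses (n5 : (5 <= n)%N) (m4 : (4 <= m)%N) (m_even : ~~ odd m).
Local Notation s := (@side_normal R n m).
Local Notation r := (@refl R n m).
Local Notation wm := (@word_mat R n m).
Local Notation Gam := (@Gamma R n m).
Local Notation o := (org R).
Local Notation len := (@len R n m).
Local Notation alt := (@alt R n m).
Local Notation q := (m./2).

(** Range in which alternating words are reduced: up to q when the sides meet (finite dihedral
    group), unlimited otherwise. *)
Definition dih_ok (i j : 'I_n) k := adj i j ==> (k <= q)%N.

Lemma dih_okC i j k : dih_ok i j k = dih_ok j i k.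
Proof. by rewrite /dih_ok adjC. Qed.

(** The word can still be prolonged by [r j] on the left, so it has not crossed wall [j]: the two
    Chebyshev coefficients are nonnegative and not both zero. *)
Lemma dih_pos i j k (x : 'cV[R]_3) : i != j -> dih_ok i j k.+1 ->
  0 < mink x (s i) -> 0 < mink x (s j) -> 0 < mink (alt i j k *m x) (s j).
Proof.
move=> ij ok hi hj; have [a|na] := boolP (adj i j).
  move: ok; rewrite /dih_ok a /= => kq.
  have c : mink (s i) (s j) = cos (2 * pi / m%:R) by rewrite mink_adj.
  have U k' : (0 < k' < q)%N -> 0 < cheb (cos (2 * pi / m%:R)) k' :> R.
    by apply: cheb_adj_gt0.
  apply: alt_mink_gt0 => //; rewrite c.
  - by case: k kq => [|k] kq //; apply/ltW/U; rewrite kq.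
  - have [->|kq'] := eqVneq k.+1 q; first by rewrite cheb_adj_q.
    by apply/ltW/U; move/eqP: kq'; move: kq; lia.
  - case: k kq => [|k] kq; first by rewrite /= ltr01 orbT.
    by rewrite U // kq.
have c := mink_nonadj R n5 m4 ij na.
have [h1 h2] := cheb_ge k c.
apply: alt_mink_gt0 => //; rewrite ?(ltW h1) ?h1 ?orbT //.
by case: k {ok h1 h2} => [|k] //; apply/ltW; have [] := cheb_ge k c.
Qed.

Lemma dih_boundary i j k : ~~ dih_ok i j k.+1 -> dih_ok i j k -> k = q /\ adj i j.
Proof.
rewrite /dih_ok; case: (adj i j) => //= h1 h2; split => //.
by apply/eqP; rewrite eqn_leq h2 leqNgt.
Qed.

(* Statements (P_n) and (Q_n) in Tits' theorem (Bourbaki, Lie V.4.4), with the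
   chamber replaced by its centre and length taken in the matrix group. *)
Definition tits_P (g : 'M[R]_3) := forall i,
  0 < mink (g *m o) (s i) \/
  (mink (g *m o) (s i) < 0 /\ (len (r i *m g) < len g)%N).

Definition tits_Q (g : 'M[R]_3) := forall i j, i != j -> exists k y (b : bool),
  [/\ g = (if b then alt i j k else alt j i k) *m y, Gam y, dih_ok i j k,
      len g = (k + len y)%N & 0 < mink (y *m o) (s i) /\ 0 < mink (y *m o) (s j)].

Lemma tits_Q_swap g i j : (exists k y (b : bool),
  [/\ g = (if b then alt i j k else alt j i k) *m y, Gam y, dih_ok i j k,
      len g = (k + len y)%N & 0 < mink (y *m o) (s i) /\ 0 < mink (y *m o) (s j)]) ->
  exists k y (b : bool),
  [/\ g = (if b then alt j i k else alt i j k) *m y, Gam y, dih_ok j i k,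
      len g = (k + len y)%N & 0 < mink (y *m o) (s j) /\ 0 < mink (y *m o) (s i)].
Proof.
move=> [k [y [b [-> h1 h2 h3 [h4 h5]]]]]; exists k, y, (~~ b); split => //.
- by case: b {h3}.
- by rewrite dih_okC.
Qed.

Lemma len_alt_mul i j k y : Gam y -> (len (alt i j k *m y) <= k + len y)%N.
Proof.
move=> hy; apply: leq_trans (lenM (Gam_alt _ _ _ _ _) hy) _.
by rewrite leq_add2r len_alt.
Qed.

(** Joint induction on [len g]. For P, strip the first letter [r j] of a shortest word and apply Q
    to the rest for the pair i, j: then g is an alternating word times an element on the positive
    side of both walls, and [dih_pos] gives the sign. For Q, if one of the two walls is negative,
    strip that reflection and apply Q to the shorter element. *)
Lemma tits_PQ g : Gam g -> tits_P g /\ tits_Q g.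
Proof.
move: {2}(len g) (erefl (len g)) => N; elim/ltn_ind: N g => N IH g gN hg.
have P : tits_P g.
  move=> i; case: N IH gN => [|N] IH gN.
    left; rewrite (len_eq0 hg gN) mul1mx mink_org_side //; exact: sh_gt0.
  have [w sw gw] := len_word hg.
  case: w sw gw => [|j w]; rewrite gN //= => -[sw] gw.
  set g' := wm w in gw; have hg' : Gam g' by exact: Gam_wm.
  have lg' : len g' = N.
    apply/eqP; rewrite eqn_leq -{1}sw len_wm /=.
    by have := len_r j hg'; rewrite -gw gN ltnS.
  have [P' Q'] := IH N (ltnSn N) g' lg' hg'.
  have gg' : r j *m g = g' by rewrite gw reflKm.
  have [->|ij] := eqVneq i j.
    case: (P' j) => [h|[_ h]].
      right; rewrite gg' lg'; split => //.
      by rewrite gw -mulmxA reflE minkDl minkZl mink_side_self //; lra.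
    by exfalso; move: h; rewrite -gw gN lg' => h; lia.
  have [k [y [b [eg' hy ok lk [yi yj]]]]] := Q' _ _ ij.
  (* If [r j] could be absorbed into the dihedral part without lengthening it, [g] would be no
     longer than [g']. *)
  have short u k' : r j *m (if b then alt i j k else alt j i k) = u ->
      (len (u *m y) <= k' + len y)%N -> (k' <= k)%N -> False.
    move=> e; rewrite -e -mulmxA -eg' -gw gN => h1 h2; lia.
  case: k => [|k] in eg' ok lk short *; last case: b => [|] in eg' short *; last first.
  - (* [alt j i k.+1] starts with [r j], which would cancel *)
    exfalso; apply: (short (alt i j k) k) => //; first by rewrite /= reflKm.
    exact: len_alt_mul.
  - have ga2 : g = alt j i k.+2 *m y by rewrite gw eg' mulmxA.
    (* Three cases. Below the maximal length wall [i] is still positive. At the maximal length the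
       braid relation brings [r i] to the front, so the wall is negative and [r i] shortens. Beyond
       it, the braid relation makes [r j] cancel. *)
    have [ok'|nok] := boolP (dih_ok i j k.+3).
      left; rewrite ga2 -mulmxA.
      by apply: dih_pos; rewrite // 1?eq_sym // dih_okC.
    have [ok'|nok'] := boolP (dih_ok i j k.+2).
      have [kq aij] := dih_boundary nok ok'.
      have ga : g = r i *m (alt j i k.+1 *m y).
        by rewrite ga2 kq -alt_braid // -kq -mulmxA.
      right; split.
        rewrite ga -mulmxA reflE minkDl minkZl mink_side_self // -mulmxA.
        suff : 0 < mink (alt j i k.+1 *m (y *m o)) (s i) by lra.
        by apply: dih_pos; rewrite // 1?eq_sym // dih_okC.
      rewrite ga reflKm // ltnS; apply: leq_trans (len_alt_mul _ _ _ hy) _.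
      by rewrite -lk lg'.
    have [kq aij] := dih_boundary nok' ok.
    exfalso; apply: (short (alt i j k) k) => //; last exact: len_alt_mul.
    by rewrite kq alt_braid // -kq /= reflKm.
  - have eg2 : g' = y by rewrite eg'; case: (b); rewrite mul1mx.
    have [ok'|nok] := boolP (dih_ok i j 2).
      left; rewrite gw eg2 -mulmxA.
      have -> : r j *m (y *m o) = alt j i 1 *m (y *m o) by rewrite /= mulmx1.
      by apply: dih_pos; rewrite // 1?eq_sym // dih_okC.
    by move: nok; rewrite /dih_ok q_ge2 // implybT.
split => // i j ij.
have main i' j' : i' != j' -> mink (g *m o) (s i') < 0 -> (len (r i' *m g) < len g)%N ->
  exists k y (b : bool), [/\ g = (if b then alt i' j' k else alt j' i' k) *m y, Gam y,
    dih_ok i' j' k, len g = (k + len y)%N &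
    0 < mink (y *m o) (s i') /\ 0 < mink (y *m o) (s j')].
  move=> ij' neg hl; set g' := r i' *m g in hl.
  have hg' : Gam g' by apply: GamM hg; exact: Gam_r.
  have lg : len g = (len g').+1.
    by apply/eqP; rewrite eqn_leq hl andbT; apply: len_r'.
  have [_ Q'] := IH (len g') (leq_trans hl (eq_leq gN)) g' erefl hg'.
  have [k [y [b [eg' hy ok lk [yi yj]]]]] := Q' _ _ ij'.
  have eg : g = r i' *m g' by rewrite reflKm.
  have short u k' : r i' *m (if b then alt i' j' k else alt j' i' k) = u ->
      (len (u *m y) <= k' + len y)%N -> (k' <= k)%N -> False.
    move=> e; rewrite -e -mulmxA -eg' -eg lg lk; lia.
  have [ok'|nok] := boolP (dih_ok i' j' k.+1).
    case: b => [|] in eg' short *; last first.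
      by exists k.+1, y, true; split => //; rewrite ?lg ?lk // eg eg' mulmxA.
    case: k => [|k] in eg' ok ok' lk short *.
      by exists 1%N, y, true; split => //; rewrite ?lg ?lk // eg eg' mulmxA.
    exfalso; apply: (short (alt j' i' k) k) => //; first by rewrite /= reflKm.
    exact: len_alt_mul.
  have [kq aij] := dih_boundary nok ok.
  have k2 : (0 < k)%N by rewrite kq (leq_trans _ (q_ge2 m4)).
  exfalso; apply: (short (alt j' i' k.-1) k.-1) => //; last 2 first.
  - exact: len_alt_mul.
  - exact: leq_pred.
  have -> : (if b then alt i' j' k else alt j' i' k) = alt i' j' k.
    by case: (b) => //; rewrite kq alt_braid // adjC.
  by case: (k) k2 => // k' _; rewrite /= reflKm.
case: (P i) => [hi|[hi li]]; last exact: main.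
case: (P j) => [hj|[hj lj]]; last by apply: tits_Q_swap; apply: main; rewrite // eq_sym.
exists 0%N, g, true; split => //; first by rewrite mul1mx.
by rewrite /dih_ok implybT.
Qed.

Lemma len_side i g : Gam g ->
  (0 < mink (g *m o) (s i) /\ len (r i *m g) = (len g).+1) \/
  (mink (g *m o) (s i) < 0 /\ len g = (len (r i *m g)).+1).
Proof.
move=> hg; have [P _] := tits_PQ hg; case: (P i) => [h|[h l]].
  left; split => //; have hrg : Gam (r i *m g) by apply: GamM hg; exact: Gam_r.
  have [P' _] := tits_PQ hrg; case: (P' i) => [h'|[_ l]].
    by exfalso; move: h'; rewrite -mulmxA reflE minkDl minkZl mink_side_self //; lra.
  by apply/eqP; rewrite eqn_leq len_r //=; move: l; rewrite reflKm.
right; split => //; apply/eqP; rewrite eqn_leq l andbT; exact: len_r'.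
Qed.

(** The first letter of a shortest word is a descent, and [len_side] turns descents into negative
    walls. It follows that distinct elements move [o] to distinct, separated points. *)
Lemma nontrivial_side g : Gam g -> g <> 1%:M -> exists i, mink (g *m o) (s i) < 0.
Proof.
move=> hg g1; have [w sw gw] := len_word hg.
case: w sw gw => [|i w] sw gw; first by case: g1.
exists i; case: (len_side i hg) => [[_ h]|[]] //; exfalso.
have e : r i *m g = wm w by rewrite gw wm_cons reflKm.
move: h; rewrite e -sw /= => h.
by have := @len_wm R n m w; rewrite h ltnNge => /negP; apply; rewrite leqW.
Qed.

(** For non-adjacent i and j the vector [s i + s j] is causal, so [x] cannot be negative on both.
    Negative sides are thus pairwise adjacent, and a cycle of length at least 5 contains no
    triangle. *)
Lemma descent_le2 (x : 'cV[R]_3) : inH2 x ->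
  (#|[pred i : 'I_n | (mink x (s i) < 0)%R]| <= 2)%N.
Proof.
move=> hx; rewrite leqNgt; apply/negP => /card_gt2P [a [b [c [[]]]]].
rewrite !inE => ha hb hc [ab bc ca].
have adjn i j : mink x (s i) < 0 -> mink x (s j) < 0 -> i != j -> adj i j.
  move=> hi hj ij; apply/negPn/negP => na; have h := mink_nonadj R n5 m4 ij na.
  have hc' : causal (s i + s j).
    split; first by rewrite !minkDl !minkDr !mink_side_self // (minkC (s j)); lra.
    by rewrite -mink_orgl minkDr !mink_org_side // addr_ge0 // ltW // sh_gt0.
  by have := mink_causal_ge0 (H2_causal hx) hc'; rewrite minkDr; lra.
have := adjn _ _ ha hb ab; have := adjn _ _ hb hc bc; have := adjn _ _ hc ha ca.
have nab : val a <> val b by move=> /val_inj e; move: ab; rewrite e eqxx.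
have nbc : val b <> val c by move=> /val_inj e; move: bc; rewrite e eqxx.
have nca : val c <> val a by move=> /val_inj e; move: ca; rewrite e eqxx.
move: (ltn_ord a) (ltn_ord b) (ltn_ord c) nab nbc nca; rewrite /adj /gap /=.
move: (nat_of_ord a) (nat_of_ord b) (nat_of_ord c) => a' b' c'.
have := n5; lia.
Qed.

End Tits.

(** * Orbit growth *)

Section Packing.
Variable R : realType.
Implicit Types x y : 'cV[R]_3.

(* Upper half-plane coordinates of a point of the hyperboloid:
   height [1 / hu x] and abscissa [hX x]. *)
Definition hu x : R := x it 0 - x ix 0.
Definition hX x : R := x iy 0 / hu x.

Lemma hu_mul x : inH2 x -> (x it 0 + x ix 0) * hu x = 1 + x iy 0 ^+ 2.
Proof. by case; rewrite minkE /hu => h _; lra. Qed.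

Lemma hu_gt0 x : inH2 x -> 0 < hu x.
Proof.
move=> hx; have h := hu_mul hx; case: (hx) => _; rewrite -/it => t0.
have h2 := sqr_ge0 (x iy 0); rewrite ltNge; apply/negP => u0.
have : x it 0 + x ix 0 <= 0 by nra.
by rewrite /hu in u0; lra.
Qed.

Lemma hu_t x : inH2 x -> 2 * x it 0 = hu x + (hu x)^-1 + hu x * hX x ^+ 2.
Proof.
move=> hx; have u0 : hu x != 0 by rewrite gt_eqF ?hu_gt0.
rewrite /hX expr_div_n; apply: (mulIf u0).
have -> : (hu x + (hu x)^-1 + hu x * (x iy 0 ^+ 2 / hu x ^+ 2)) * hu x =
  hu x * hu x + (1 + x iy 0 ^+ 2) by field.
by rewrite -hu_mul // /hu; ring.
Qed.

Lemma hu_mink x y : inH2 x -> inH2 y ->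
  2 * mink x y = 2 + (hu x - hu y) ^+ 2 / (hu x * hu y) + hu x * hu y * (hX x - hX y) ^+ 2.
Proof.
move=> hx hy; have u0 : hu x != 0 by rewrite gt_eqF ?hu_gt0.
have v0 : hu y != 0 by rewrite gt_eqF ?hu_gt0.
have e1 : x it 0 + x ix 0 = (1 + x iy 0 ^+ 2) / hu x by rewrite -hu_mul // mulfK.
have e2 : y it 0 + y ix 0 = (1 + y iy 0 ^+ 2) / hu y by rewrite -hu_mul // mulfK.
have -> : 2 * mink x y = (x it 0 + x ix 0) * hu y + (y it 0 + y ix 0) * hu x
   - 2 * x iy 0 * y iy 0 by rewrite minkE /hu; ring.
by rewrite e1 e2 /hX; field; rewrite u0 v0.
Qed.

Lemma sum_geo_le (q : R) J : 0 <= q < 1 -> \sum_(j < J) q ^+ j <= (1 - q)^-1.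
Proof.
move=> hq; have q1 : 0 < 1 - q by lra.
have e : (1 - q) * \sum_(j < J) q ^+ j = 1 - q ^+ J.
  elim: J => [|J IH]; first by rewrite big_ord0 expr0; ring.
  by rewrite big_ord_recr /= mulrDr IH exprSr; ring.
rewrite -(ler_pM2l q1) e divff ?gt_eqF //.
by rewrite lerBlDr lerDl exprn_ge0 //; lra.
Qed.

(** The half-plane is cut into cells of hyperbolic size about [e], each too small for two
    [c0]-separated points. The cells met by the ball form logarithmically many levels, whose sizes
    decrease geometrically from O(T). *)
Lemma packing (c0 : R) : 1 < c0 -> exists2 C : R, 0 < C &
  forall (A : eqType) (f : A -> 'cV[R]_3) (T : R) (F : seq A), 1 <= T -> uniq F ->
  (forall a, a \in F -> inH2 (f a) /\ f a it 0 <= T) ->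
  (forall a b, a \in F -> b \in F -> a != b -> c0 <= mink (f a) (f b)) ->
  (size F)%:R <= C * T.
Proof.
move=> c1; pose e : R := Num.sqrt (c0 - 1).
have e0 : 0 < e by rewrite sqrtr_gt0; lra.
have e2 : e ^+ 2 = c0 - 1 by rewrite sqr_sqrtr; lra.
pose a : R := ln (1 + e).
have a0 : 0 < a by rewrite ln_gt0 //; lra.
pose sg : R := expR (- a / 2).
have sg0 : 0 < sg by exact: expR_gt0.
have sg1 : sg < 1 by rewrite -[ltRHS]expR0 ltr_expR; lra.
have sgX j : sg ^+ j = expR (- a * j%:R / 2).
  by rewrite /sg -expRM_natr; congr expR; lra.
pose C1 : R := 2 * expR (a / 2) / e.
have C10 : 0 < C1 by rewrite /C1 divr_gt0 // mulr_gt0 // expR_gt0.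
have D1 : 0 < 2 * C1 / (1 - sg).
  by apply: divr_gt0; [apply: mulr_gt0 | rewrite subr_gt0].
have D2 : 0 < 4 / a by apply: divr_gt0.
exists (2 * C1 / (1 - sg) + (4 / a + 1)); first by lra.
move=> A f T F T1 uF inF sepF.
(* Level [j] contains the points with [hu] between [U j / (1 + e)] and [U j], counted downwards from
   the largest value 2 T. *)
pose lev x := Num.truncn (ln (2 * T / hu x) / a).
pose U (j : nat) : R := 2 * T * expR (- a * j%:R).
pose K (j : nat) : R := C1 * T * sg ^+ j.
(* On a level the abscissa is cut into pieces of length [e / U], proportional to the height; the
   shift by [K] makes the argument of [truncn] nonnegative. *)
pose cell x := Num.truncn (hX x * U (lev x) / e + K (lev x)).
pose J := (Num.truncn (ln (4 * T ^+ 2) / a)).+1.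
have T0 : 0 <= T by lra.
have K0 j : 0 <= K j.
  by apply: mulr_ge0; [apply: mulr_ge0 => //; exact: ltW | apply/exprn_ge0/ltW].
have U0 j : 0 < U j by rewrite /U !mulr_gt0 ?expR_gt0 //; lra.
have levP x : inH2 x -> x it 0 <= T ->
    [/\ (lev x < J)%N, hu x <= U (lev x) & U (lev x) < (1 + e) * hu x].
  move=> hx xT; have u0 := hu_gt0 hx; have ut := hu_t hx.
  have uX : 0 <= hu x * hX x ^+ 2 by rewrite mulr_ge0 ?sqr_ge0 // ltW.
  have ui : 0 < (hu x)^-1 by rewrite invr_gt0.
  have u2T : hu x <= 2 * T by lra.
  have ui2T : (hu x)^-1 <= 2 * T by lra.
  have l0 : 0 <= ln (2 * T / hu x) / a.
    by rewrite divr_ge0 ?(ltW a0) // ln_ge0 // ler_pdivlMr // mul1r.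
  have /andP[h1 h2] := truncn_itv l0; rewrite -/(lev x) in h1 h2.
  have pos : 0 < 2 * T / hu x by rewrite divr_gt0 //; lra.
  split.
  - rewrite /J ltnS; apply: le_truncn; rewrite ler_pM2r ?invr_gt0 // ler_ln ?posrE //.
      have -> : 4 * T ^+ 2 = 2 * T * (2 * T) by ring.
      by rewrite ler_pM2l //; lra.
    by rewrite mulr_gt0 // exprn_gt0 //; lra.
  - have : (lev x)%:R * a <= ln (2 * T / hu x) by rewrite -ler_pdivlMr.
    rewrite -ler_expR lnK ?posrE // ler_pdivlMr // => h.
    by rewrite /U mulNr expRN -[leRHS]/(_ * _^-1) ler_pdivlMr ?expR_gt0 // mulrC (mulrC a).
  - have : ln (2 * T / hu x) < (lev x).+1%:R * a by rewrite -ltr_pdivrMr.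
    have e' : expR ((lev x).+1%:R * a) = expR ((lev x)%:R * a) * (1 + e).
      have -> : (lev x).+1%:R = (lev x)%:R + 1 :> R by rewrite natr1.
      by rewrite mulrDl mul1r expRD [in expR a]/a lnK // posrE; lra.
    rewrite -ltr_expR lnK ?posrE // ltr_pdivrMr // e'.
    move=> h; rewrite /U mulNr expRN -[ltLHS]/(_ * _^-1) ltr_pdivrMr ?expR_gt0 //.
    by rewrite (mulrC a); lra.
have KP x : inH2 x -> x it 0 <= T -> `|hX x * U (lev x) / e| <= K (lev x).
  move=> hx xT; have [_ h1 h2] := levP _ hx xT.
  have u0 := hu_gt0 hx; have ut := hu_t hx.
  have ui : 0 < (hu x)^-1 by rewrite invr_gt0.
  have uX : hu x * hX x ^+ 2 <= 2 * T by lra.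
  rewrite -(ler_pXn2r (n := 2)) ?nnegrE // -normrX ger0_norm ?sqr_ge0 //.
  have -> : (hX x * U (lev x) / e) ^+ 2 = (hX x ^+ 2 * U (lev x)) * U (lev x) / e ^+ 2.
    by field; rewrite gt_eqF.
  have -> : K (lev x) ^+ 2 = (2 * T * (1 + e)) * U (lev x) / e ^+ 2.
    rewrite /K /C1 /U sgX !exprMn -!expRM_natr.
    have -> : 1 + e = expR (a / 2 * 2%:R) by rewrite divfK // lnK // posrE; lra.
    have -> : expR (- a * (lev x)%:R / 2 * 2%:R) = expR (- a * (lev x)%:R) :> R.
      by rewrite divfK.
    by field; rewrite gt_eqF.
  rewrite ler_pM2r ?invr_gt0 ?exprn_gt0 // ler_pM2r //.
  apply: (@le_trans _ _ (hX x ^+ 2 * ((1 + e) * hu x))).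
    by rewrite ler_wpM2l ?sqr_ge0 // ltW.
  have -> : hX x ^+ 2 * ((1 + e) * hu x) = (hu x * hX x ^+ 2) * (1 + e) by ring.
  by rewrite ler_pM2r //; lra.
pose nc (j : nat) := (Num.truncn (2 * K j)).+1.
pose L := [seq (j, i) | j <- iota 0 J, i <- iota 0 (nc j)].
(* In a common cell both correction terms of [hu_mink] are at most e^2, one of them strictly, so 2 B
   < 2 + 2 e^2 = 2 c0. *)
have inj : uniq [seq (lev (f b), cell (f b)) | b <- F].
  rewrite map_inj_in_uniq // => b b' hb hb' [el ec].
  apply/eqP/negPn/negP => nbb; have := sepF _ _ hb hb' nbb; apply/negP; rewrite -ltNge.
  have [hx xT] := inF _ hb; have [hy yT] := inF _ hb'.
  have [_ h1 h2] := levP _ hx xT; have [_ h3 h4] := levP _ hy yT.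
  have k1 := KP _ hx xT; have k2 := KP _ hy yT.
  move: ec; rewrite /cell -el in h3 h4 k2 *.
  set V := U _ in h1 h2 h3 h4 k1 k2 *; set k := K _ in k1 k2 *.
  move: k1 k2; rewrite !ler_norml => /andP[k1 k1'] /andP[k2 k2'] ec.
  have u0 := hu_gt0 hx; have v0 := hu_gt0 hy.
  have /truncn_itv /andP[p1 p2] : 0 <= hX (f b) * V / e + k by lra.
  have /truncn_itv /andP[p3 p4] : 0 <= hX (f b') * V / e + k by lra.
  rewrite -ec in p3 p4; rewrite -[X in _ < X]natr1 in p2 p4.
  have V0 : 0 < V by exact: U0.
  have dX : ((hX (f b) - hX (f b')) * V / e) ^+ 2 < 1.
    have -> : (hX (f b) - hX (f b')) * V / e = hX (f b) * V / e - hX (f b') * V / e by ring.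
    by nra.
  have {}dX : V ^+ 2 * (hX (f b) - hX (f b')) ^+ 2 < e ^+ 2.
    have e20 : 0 < e ^+ 2 by rewrite exprn_gt0.
    rewrite -(ltr_pM2r e20) mul1r in dX; apply: le_lt_trans dX.
    by rewrite le_eqVlt; apply/orP; left; apply/eqP; field; rewrite gt_eqF.
  have t1 : hu (f b) * hu (f b') * (hX (f b) - hX (f b')) ^+ 2 < e ^+ 2.
    apply: le_lt_trans dX; rewrite ler_wpM2r ?sqr_ge0 // expr2 ler_pM // ltW //.
  have t2 : (hu (f b) - hu (f b')) ^+ 2 / (hu (f b) * hu (f b')) <= e ^+ 2.
    rewrite ler_pdivrMr ?mulr_gt0 //.
    have hh1 : hu (f b) - hu (f b') <= e * hu (f b') by lra.
    have hh2 : hu (f b') - hu (f b) <= e * hu (f b) by lra.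
    have aux (p q : R) : 0 < p -> p <= q -> q - p <= e * p -> (p - q) ^+ 2 <= e ^+ 2 * (p * q).
      move=> p0 pq qp; apply: (@le_trans _ _ ((e * p) ^+ 2)).
        by rewrite -sqrrN opprB ler_sqr ?nnegrE ?subr_ge0 // mulr_ge0 // ltW.
      by rewrite exprMn ler_wpM2l ?sqr_ge0 // expr2 ler_wpM2l // ltW.
    have [hle|hlt] := leP (hu (f b)) (hu (f b')); first exact: aux.
    by rewrite -sqrrN opprB (mulrC (hu (f b))); apply: aux => //; exact: ltW.
  by have := hu_mink hx hy; lra.
have sub : {subset [seq (lev (f b), cell (f b)) | b <- F] <= L}.
  move=> _ /mapP[b hb ->]; have [hx xT] := inF _ hb.
  have [l1 _ _] := levP _ hx xT; have := KP _ hx xT; rewrite ler_norml => /andP[k1 k2].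
  apply/allpairsPdep; exists (lev (f b)), (cell (f b)); split => //.
    by rewrite mem_iota add0n.
  rewrite mem_iota /= add0n /nc ltnS; apply: le_truncn; lra.
have sz := uniq_leq_size inj sub; rewrite size_map in sz.
have szL : size L = (\sum_(j < J) nc j)%N.
  rewrite /L size_allpairs_dep sumnE big_map -(big_mkord xpredT) /index_iota subn0.
  by apply: eq_bigr => j _; rewrite size_iota.
rewrite szL -(ler_nat R) natr_sum in sz; apply: le_trans sz _.
have nK j : (nc j)%:R <= 2 * K j + 1.
  have := K0 j.
  rewrite /nc; set N := Num.truncn _; have -> : N.+1%:R = N%:R + 1 :> R by rewrite natr1.
  by rewrite lerD2r truncn_le; lra.
apply: (@le_trans _ _ (\sum_(j < J) (2 * K j + 1))); first exact: ler_sum.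
rewrite big_split /= -mulr_sumr -mulr_sumr sumr_const card_ord.
have hS : \sum_(j < J) sg ^+ j <= (1 - sg)^-1 by apply: sum_geo_le; rewrite ltW.
have hJ : J%:R <= (4 / a + 1) * T.
  have l0 : 0 <= ln (4 * T ^+ 2) by rewrite ln_ge0 //; nra.
  have lT : ln (4 * T ^+ 2) <= 4 * T.
    have -> : 4 * T ^+ 2 = (2 * T) ^+ 2 by ring.
    have T2 : 0 < 2 * T by lra.
    have : ln (2 * T) <= 2 * T.
      by rewrite -ler_expR lnK ?posrE //; have := expR_ge1Dx (2 * T); lra.
    by rewrite lnXn // mulr2n; lra.
  have : (Num.truncn (ln (4 * T ^+ 2) / a))%:R <= ln (4 * T ^+ 2) / a.
    by rewrite truncn_le divr_ge0 // ltW.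
  have : ln (4 * T ^+ 2) / a <= 4 / a * T.
    by rewrite mulrAC ler_pM2r ?invr_gt0.
  have -> : J%:R = (Num.truncn (ln (4 * T ^+ 2) / a))%:R + 1 :> R by rewrite natr1.
  by lra.
have : 2 * (C1 * T * \sum_(j < J) sg ^+ j) <= 2 * C1 / (1 - sg) * T.
  have -> : 2 * C1 / (1 - sg) * T = 2 * (C1 * T * (1 - sg)^-1) by ring.
  by rewrite ler_pM2l // ler_wpM2l // mulr_ge0 // ?ltW //; lra.
by lra.
Qed.

End Packing.

(** * Counting orbit points in balls *)

Section OrbitGrowth.
Variables (R : realType) (n m : nat).
Hypotheses (n5 : (5 <= n)%N) (m4 : (4 <= m)%N) (m_even : ~~ odd m).
Local Notation s := (@side_normal R n m).
Local Notation r := (@refl R n m).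
Local Notation wm := (@word_mat R n m).
Local Notation Gam := (@Gamma R n m).
Local Notation o := (org R).
Local Notation len := (@len R n m).
Local Notation ch := (@ch R n m).
Local Notation sh := (@sh R n m).

(* [bt g] is the hyperbolic cosine of the distance from [o] to [g o]. *)
Definition bt (g : 'M[R]_3) : R := mink o (g *m o).

Lemma btE g : bt g = (g *m o) it 0. Proof. exact: mink_orgl. Qed.

Lemma bt_ge1 g : Gam g -> 1 <= bt g.
Proof. by move=> hg; rewrite btE; apply/H2_t_ge1/(Gam_orbit_H2 n5 m4 hg). Qed.

Lemma bt_gt0 g : Gam g -> 0 < bt g.
Proof. by move/bt_ge1; apply: lt_le_trans. Qed.

Lemma btV g : Gam g -> bt (invmx g) = bt g.
Proof.
by move=> hg; rewrite /bt -(Gam_mink_adj n5 m4 _ _ hg) minkC.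
Qed.

Lemma btM g h : Gam g -> Gam h -> bt (g *m h) <= 2 * (bt g * bt h).
Proof.
move=> hg hh; rewrite {1}/bt -mulmxA minkC (Gam_mink_adj n5 m4 _ _ hg) minkC.
have hV := GamV n5 m4 hg; rewrite -(btV hg) !btE.
by apply: mink_le_t; apply: H2_causal; [exact: (Gam_orbit_H2 n5 m4 hV) | exact: (Gam_orbit_H2 n5 m4 hh)].
Qed.

Lemma bt_orbit g h : Gam g -> Gam h -> mink (g *m o) (h *m o) = bt (invmx g *m h).
Proof. by move=> hg hh; rewrite (Gam_mink_adj n5 m4 _ _ hg) mulmxA. Qed.

(** Cauchy-Schwarz on the spatial coordinates; [ch] is the cosh of the inradius, the distance from
    [o] to the line of the side. *)
Lemma side_height x i : inH2 x -> mink x (s i) < 0 -> ch <= x it 0.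
Proof.
move=> hx; case: (hx) => h1 h2; rewrite -/it in h2; move: h1; rewrite sideE // !minkE !vec3x !vec3y !vec3t.
have hcs := cos2Dsin2 (th R n i); have c1 := ch_gt1 R n5 m4; have hs := sh_gt0 R n5 m4.
have hc := ch_sh R n5 m4; move: hcs h2.
set C := cos _; set S := sin _; set a := x ix 0; set b := x iy 0; set z := x it 0 => hcs h2 h1 h.
rewrite leNgt; apply/negP => hz.
have cs : (C * a + S * b) ^+ 2 <= a ^+ 2 + b ^+ 2.
  have -> : a ^+ 2 + b ^+ 2 = (C * a + S * b) ^+ 2 + (C * b - S * a) ^+ 2.
    by transitivity ((C ^+ 2 + S ^+ 2) * (a ^+ 2 + b ^+ 2)); [rewrite hcs; ring | ring].
  by rewrite lerDl sqr_ge0.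
have h3 : z * sh < ch * (C * a + S * b) by lra.
have h4 : (z * sh) ^+ 2 < (ch * (C * a + S * b)) ^+ 2.
  by rewrite ltr_pXn2r ?nnegrE //; apply: ltW; [exact: mulr_gt0| apply: lt_trans h3; exact: mulr_gt0].
have h5 : (ch * (C * a + S * b)) ^+ 2 <= ch ^+ 2 * (z ^+ 2 - 1).
  by rewrite exprMn ler_wpM2l ?sqr_ge0 //; apply: le_trans cs _; lra.
have h6 : z ^+ 2 < ch ^+ 2 by rewrite ltr_pXn2r ?nnegrE //; lra.
have h7 : (z * sh) ^+ 2 = z ^+ 2 * (ch ^+ 2 - 1) by rewrite hc; ring.
lra.
Qed.

Lemma orbit_sep g h : Gam g -> Gam h -> g != h -> ch <= mink (g *m o) (h *m o).
Proof.
move=> hg hh gh; rewrite bt_orbit // btE.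
have hV : Gam (invmx g *m h) by apply: GamM => //; exact: GamV.
have ne : invmx g *m h <> 1%:M.
  move=> e; move/eqP: gh; apply.
  by rewrite -[LHS]mulmx1 -e mulmxA (mulmxV (Gam_unit n5 m4 hg)) mul1mx.
have [i hi] := nontrivial_side n5 m4 m_even hV ne.
exact: side_height (Gam_orbit_H2 n5 m4 hV) hi.
Qed.

Lemma orbit_count : exists2 C : R, 0 < C &
  forall (T : R) (F : seq 'M[R]_3), 1 <= T -> uniq F ->
  (forall g, g \in F -> Gam g /\ bt g <= T) -> (size F)%:R <= C * T.
Proof.
have [C C0 hC] := packing (ch_gt1 R n5 m4).
exists C => // T F T1 uF hF; apply: (hC _ (fun g => g *m o)) => //.
- by move=> g /hF[hg gT]; split; [exact: (Gam_orbit_H2 n5 m4 hg) | rewrite -btE].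
- by move=> g h /hF[hg _] /hF[hh _] gh; apply: orbit_sep.
Qed.

(** By [orbit_count] the sizes of duplicate-free lists in the ball are bounded; a list of maximal
    size must contain every element. *)
Lemma ball_list (T : R) : exists F : seq 'M[R]_3, uniq F /\
  forall g, g \in F <-> (Gam g /\ bt g <= T).
Proof.
have [C C0 hC] := orbit_count.
pose P (k : nat) := `[< exists F : seq 'M[R]_3, [/\ size F = k, uniq F &
  forall g, g \in F -> Gam g /\ bt g <= T] >].
have P0 : exists k, P k by exists 0%N; apply/asboolP; exists [::].
have Pub k : P k -> (k <= Num.truncn (C * Num.max 1 T)%R)%N.
  move=> /asboolP[F [<- uF hF]]; rewrite truncn_ge_nat; last first.
    by rewrite mulr_ge0 ?(ltW C0) // le_max ler01.
  by apply: hC => // [|g /hF[h1 h2]]; rewrite ?le_max ?lexx // h2 orbT.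
case: (ex_maxnP P0 Pub) => k /asboolP[F [Fk uF hF]] kmax; exists F; split => // g.
split; first exact: hF; move=> [hg gT]; apply/negPn/negP => gF.
suff : (k.+1 <= k)%N by rewrite ltnn.
apply: kmax; apply/asboolP; exists (g :: F); split; rewrite /= ?Fk ?gF //.
by move=> h; rewrite inE => /predU1P[->|/hF].
Qed.

(** Slice by the integer part j of ln beta: a slice has at most C e^(j+1) elements, each of weight
    at most e^(-(1+p) j). The geometric series of ratio e^(-p) is at most 2 / p because p <= 1. *)
Lemma orbit_mass : exists2 C : R, 0 < C & forall (p : R) (F : seq 'M[R]_3),
  0 < p <= 1 -> uniq F -> (forall g, g \in F -> Gam g) ->
  \sum_(g <- F) expR (- (1 + p) * ln (bt g)) <= C / p.
Proof.
have [C C0 hC] := orbit_count; have e0 := expR_gt0 (1 : R).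
exists (2 * (C * expR 1)); first by rewrite mulr_gt0 // mulr_gt0.
move=> p F /andP[p0 p1] uF hF.
pose lev g := Num.truncn (ln (bt g)).
pose J := (\max_(g <- F) lev g).+1.
have levP g : g \in F -> (lev g)%:R <= ln (bt g) < (lev g).+1%:R.
  by move=> gF; apply: truncn_itv; rewrite ln_ge0 // bt_ge1 //; exact: hF.
rewrite (_ : \sum_(g <- F) _ = \sum_(j < J) \sum_(g <- F | lev g == j) expR (- (1 + p) * ln (bt g))); last first.
  rewrite (exchange_big_dep xpredT) //=; apply: eq_big_seq => g gF.
  have lJ : (lev g < J)%N by rewrite ltnS; apply: leq_bigmax_seq.
  by rewrite (big_pred1 (Ordinal lJ)) // => j; rewrite -val_eqE /= eq_sym.
have q01 : 0 <= expR (- p) < 1 by rewrite expR_ge0 /= -[ltRHS]expR0 ltr_expR; lra.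
apply: (@le_trans _ _ (\sum_(j < J) (C * expR 1) * expR (- p) ^+ j)).
  apply: ler_sum => j _.
  apply: (@le_trans _ _ (\sum_(g <- F | lev g == j) expR (- (1 + p) * j%:R))).
    rewrite big_seq_cond [leRHS]big_seq_cond; apply: ler_sum => g /andP[gF /eqP lg].
    have /andP[h _] := levP g gF; rewrite -lg ler_expR.
    by rewrite !mulNr lerN2 ler_pM2l //; lra.
  rewrite big_const_seq iter_addr_0 -size_filter -[leLHS]mulr_natl.
  have hs : (size [seq g <- F | lev g == j])%:R <= C * expR (1 + j%:R).
    apply: hC; [by rewrite -[leLHS]expR0 ler_expR addr_ge0|exact: filter_uniq|].
    move=> g; rewrite mem_filter => /andP[/eqP lg gF]; split; first exact: hF.
    have /andP[_ h] := levP g gF; rewrite -ler_ln ?posrE ?expR_gt0 //.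
      by rewrite expRK addrC natr1 -lg ltW.
    by apply: bt_gt0; exact: hF.
  apply: le_trans (ler_wpM2r (expR_ge0 _) hs) _.
  rewrite -expRM_natr -!mulrA ler_pM2l // -!expRD ler_expR; lra.
rewrite -mulr_sumr; have -> : 2 * (C * expR 1) / p = C * expR 1 * (2 / p) by ring.
apply: ler_wpM2l; first by rewrite mulr_ge0 // ltW.
apply: le_trans (sum_geo_le _ q01) _.
have q1 : expR (- p) <= (1 + p)^-1.
  by rewrite expRN lef_pV2 ?posrE ?expR_gt0 ?expR_ge1Dx //; lra.
have q2 : p / 2 <= 1 - expR (- p).
  have : (1 + p)^-1 <= 1 - p / 2.
    by rewrite invf_ple ?posrE; [|lra|lra]; rewrite -[leLHS]mul1r ler_pdivrMr; nra.
  by lra.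
rewrite -[leRHS]invf_div lef_pV2 ?posrE //; first by lra.
by rewrite divr_gt0.
Qed.

Lemma cos_nearest (x : R) : `|x| <= pi / n%:R -> cos (pi / n%:R) <= cos x.
Proof.
have [h1 h2] := pi_n_bounds R n5; have p0 := pi_gt0 R.
have -> : cos x = cos `|x| by have [h|h] := ger0P x; rewrite ?cosN.
rewrite le_eqVlt => /predU1P[->//|h]; apply: ltW.
by rewrite ltr_cos // in_itv /=; [have := normr_ge0 x; lra | lra].
Qed.

(** Write (a, b) as an angle and round it to the nearest multiple of 2 pi / n; the error is at most
    pi / n. *)
Lemma nearest_side (a b : R) : a ^+ 2 + b ^+ 2 = 1 ->
  exists i : 'I_n, cos (pi / n%:R) <= a * cos (th R n i) + b * sin (th R n i).
Proof.
move=> ab; have p0 := pi_gt0 R; have n0 := n_ge5 R n5.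
have nz : n%:R != 0 :> R by rewrite gt_eqF //; lra.
have [phi [ph0 ph2 ca sb]] : exists phi : R,
    [/\ 0 <= phi, phi <= 2 * pi, cos phi = a & sin phi = b].
  have a1 : -1 <= a <= 1 by have := sqr_ge0 b; nra.
  have ac : cos (acos a) = a by rewrite acosK // in_itv.
  have sn : sin (acos a) = `|b|.
    by rewrite sin_acos // (_ : 1 - a ^+ 2 = b ^+ 2) ?sqrtr_sqr //; lra.
  have c0 := acos_ge0 a1; have c1 := acos_lepi a1.
  move: sn; have [hb|hb] := ger0P b => sn.
    by exists (acos a); split => //; lra.
  exists (2 * pi - acos a); split; [lra|lra| |].
    have -> : 2 * pi - acos a = - acos a + pi *+ 2 by rewrite mulr2n; ring.
    by rewrite cosD2pi cosN.
  have -> : 2 * pi - acos a = - acos a + pi *+ 2 by rewrite mulr2n; ring.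
  by rewrite sinD2pi sinN sn opprK.
pose z : R := phi * n%:R / (2 * pi).
have z0 : 0 <= z by rewrite /z divr_ge0 ?mulr_ge0 //; lra.
have zn : z <= n%:R by rewrite /z ler_pdivrMr ?mulr_gt0 // mulrC ler_pM2l //; lra.
have piz : pi != 0 :> R by rewrite gt_eqF.
have phz : phi = z * (2 * pi / n%:R) by rewrite /z; move: (pi : R) piz => P hP; field; rewrite nz hP.
have /truncn_itv : 0 <= z + 1 / 2 by lra.
set k := Num.truncn _ => /andP[k1 k2].
have k2' : z + 1 / 2 < k%:R + 1 by rewrite natr1.
have kn : (k <= n)%N by rewrite -ltnS -(ltr_nat R) -natr1; lra.
have hcos : cos (pi / n%:R) <= cos (phi - th R n k).
  apply: cos_nearest; have -> : phi - th R n k = (z - k%:R) * 2 * (pi / n%:R).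
    by rewrite phz /th; field.
  have [h1 _] := pi_n_bounds R n5.
  rewrite normrM (gtr0_norm h1) -[leRHS]mul1r ler_pM2r // ler_norml; lra.
have e j : a * cos (th R n j) + b * sin (th R n j) = cos (phi - th R n j).
  by rewrite cosB ca sb.
(* Rounding may give k = n, which is side 0 after a full turn. *)
have [kn'|kn'] := ltnP k n; first by exists (Ordinal kn'); rewrite e.
have n00 : (0 < n)%N by rewrite (leq_trans _ n5).
exists (Ordinal n00); rewrite e.
suff -> : phi - th R n (Ordinal n00) = phi - th R n k + pi *+ 2 by rewrite cosD2pi.
have -> : k = n by apply/eqP; rewrite eqn_leq kn.
by rewrite /th /= mulr2n; field.
Qed.

(** Reflect in the side nearest to the direction of [x]. This lowers the height by a definite factor
    because cos (pi/n) [ch] > [sh]: the difference of squares is sin^2 (pi/m), which expresses that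
    the vertices of the polygon are finite points. *)
Lemma descent : exists T0 a : R, [/\ 1 <= T0, 0 < a &
  forall x, inH2 x -> T0 < x it 0 -> exists i,
    (r i *m x) it 0 <= x it 0 * expR (- a)].
Proof.
have c1 := ch_gt1 R n5 m4; have hs := sh_gt0 R n5 m4; have hc := ch_sh R n5 m4.
have cn := cos_pi_n_gt0 R n5; have sn := sin_pi_n_gt0 R n5; have cm := cos_pi_m_gt0 R m4.
set A := cos (pi / n%:R) * ch.
have A0 : 0 < A by rewrite mulr_gt0 //; lra.
have As : sh < A.
  rewrite -(ltr_pXn2r (n := 2)) ?nnegrE ?ltW //.
  have e : ch * sin (pi / n%:R) = cos (pi / m%:R) by rewrite /ch mulfVK // gt_eqF.
  have -> : A ^+ 2 = ch ^+ 2 - cos (pi / m%:R) ^+ 2 by rewrite -e /A exprMn cos2sin2; ring.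
  have : sin (pi / m%:R) ^+ 2 = 1 - cos (pi / m%:R) ^+ 2 :> R by exact: sin2cos2.
  by have := sin_pi_m_gt0 R m4; nra.
pose d := (A - sh) / 2.
have d0 : 0 < d by rewrite /d divr_gt0 // subr_gt0.
have dE : A = sh + 2 * d by rewrite /d; field.
clearbody d; have den : 0 < A ^+ 2 - (sh + d) ^+ 2 by rewrite dE; nra.
(* [d] is half the margin of [A] over [sh]. Beyond this height the spatial norm is so close to the
   time coordinate that the margin [d] survives. *)
exists (1 + A ^+ 2 / (A ^+ 2 - (sh + d) ^+ 2)), (2 * d * sh); split.
- by rewrite lerDl divr_ge0 // ?ltW // exprn_gt0.
- by rewrite !mulr_gt0.
move=> x hx hT; have t1 := H2_t_ge1 hx.
have Tb : A ^+ 2 <= (A ^+ 2 - (sh + d) ^+ 2) * x it 0 ^+ 2.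
  have : A ^+ 2 / (A ^+ 2 - (sh + d) ^+ 2) <= x it 0 ^+ 2 by nra.
  by rewrite ler_pdivrMr // mulrC.
pose rr : R := Num.sqrt (x it 0 ^+ 2 - 1).
have rr2 : rr ^+ 2 = x it 0 ^+ 2 - 1 by rewrite sqr_sqrtr //; nra.
have rr2' : x ix 0 ^+ 2 + x iy 0 ^+ 2 = rr ^+ 2.
  by rewrite rr2; case: hx; rewrite minkE; lra.
have rr0 : 0 < rr.
  rewrite sqrtr_gt0; have : 0 < A ^+ 2 / (A ^+ 2 - (sh + d) ^+ 2) by rewrite divr_gt0 ?exprn_gt0.
  nra.
have rrz : rr != 0 by rewrite gt_eqF.
have [i hi] : exists i : 'I_n, cos (pi / n%:R) <=
    x ix 0 / rr * cos (th R n i) + x iy 0 / rr * sin (th R n i).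
  by apply: nearest_side; rewrite !expr_div_n -mulrDl rr2' divff // expf_neq0.
exists i.
have hi' : cos (pi / n%:R) * rr <= x ix 0 * cos (th R n i) + x iy 0 * sin (th R n i).
  rewrite -ler_pdivlMr //; apply: le_trans hi _.
  by rewrite le_eqVlt; apply/orP; left; apply/eqP; field.
have Ar : (sh + d) * x it 0 <= A * rr.
  have q1 : 0 <= (sh + d) * x it 0 by apply: mulr_ge0; lra.
  have q2 : 0 <= A * rr by apply: mulr_ge0; apply: ltW.
  by rewrite -(ler_pXn2r (n := 2)) ?nnegrE // [(A * rr) ^+ 2]exprMn exprMn rr2; lra.
have hm : mink x (s i) <= - d * x it 0.
  rewrite sideE // minkE !vec3x !vec3y !vec3t.
  have : ch * (cos (pi / n%:R) * rr) <= ch * (x ix 0 * cos (th R n i) + x iy 0 * sin (th R n i)).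
    by rewrite ler_pM2l //; lra.
  by move: Ar; rewrite /A; lra.
have -> : (r i *m x) it 0 = x it 0 + 2 * mink x (s i) * sh.
  by rewrite -!mink_orgl reflE minkDr minkZr mink_org_side.
have : x it 0 * (1 - 2 * d * sh) <= x it 0 * expR (- (2 * d * sh)).
  by rewrite ler_wpM2l //; [lra | have := expR_ge1Dx (- (2 * d * sh)); lra].
apply: le_trans; have : mink x (s i) * sh <= - d * x it 0 * sh by rewrite ler_pM2r.
by lra.
Qed.

Lemma descent_word : exists T0 a : R, [/\ 1 <= T0, 0 < a &
  forall x, inH2 x -> exists w, (wm w *m x) it 0 <= T0 /\
    (size w)%:R <= ln (x it 0) / a + 1].
Proof.
have [T0 [a [T1 a0 hT]]] := descent; exists T0, a; split => // x hx.
have l0 : 0 <= ln (x it 0) / a by rewrite divr_ge0 ?(ltW a0) // ln_ge0 // H2_t_ge1.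
suff : forall N x, inH2 x -> ln (x it 0) <= N%:R * a ->
    exists w, (wm w *m x) it 0 <= T0 /\ (size w <= N)%N.
  move=> /(_ (Num.truncn (ln (x it 0) / a)).+1 x hx) [|w [h1 h2]].
    by rewrite -ler_pdivrMr // ltW //; have /andP[] := truncn_itv l0.
  exists w; split => //; move: h2; rewrite -(ler_nat R) => /le_trans; apply.
  by rewrite -natr1 lerD2r truncn_le.
elim=> [|N IH] {l0}y hy hN.
  exists [::]; rewrite /= mul1mx; split => //; apply: le_trans T1.
  have t1 := H2_t_ge1 hy.
  rewrite -ler_ln ?posrE //; first by rewrite ln1; lra.
  by lra.
have [h|h] := leP (y it 0) T0; first by exists [::]; rewrite /= mul1mx.
have [i hi] := hT y hy h; have hry := refl_H2 n5 m4 i hy.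
have [w [h1 h2]] : exists w, (wm w *m (r i *m y)) it 0 <= T0 /\ (size w <= N)%N.
  apply: IH => //; have t1 := H2_t_ge1 hry; have t2 := H2_t_ge1 hy.
  have : ln ((r i *m y) it 0) <= ln (y it 0 * expR (- a)).
    by rewrite ler_ln ?posrE ?mulr_gt0 ?expR_gt0 //; lra.
  rewrite lnM ?posrE ?expR_gt0 ?expRK //; last by lra.
  by move: hN; rewrite -natr1 mulrDl; lra.
exists (rcons w i); rewrite size_rcons ltnS h2; split => //.
by rewrite -cats1 wm_cat /= mulmx1 -mulmxA.
Qed.

(** Descent brings [g o] into a fixed ball in O(1 + ln beta) letters, and only finitely many
    elements remain there. This later converts a large word length into a large distance. *)
Lemma len_le_log : exists A : R, 0 < A /\
  forall g, Gam g -> (len g)%:R <= A * (1 + ln (bt g)).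
Proof.
have [T0 [a [T1 a0 hw]]] := descent_word; have [F [uF hF]] := ball_list T0.
pose N := \max_(g <- F) len g.
have ai : 0 < a^-1 by rewrite invr_gt0.
have NR : 0 <= N%:R :> R by exact: ler0n.
exists (a^-1 + 1 + N%:R); split; first by lra.
move=> g hg; have [w [h1 h2]] := hw _ (Gam_orbit_H2 n5 m4 hg).
have hwg : Gam (wm w *m g) by apply: GamM => //; exact: Gam_wm.
have lN : (len (wm w *m g) <= N)%N.
  apply: (@leq_bigmax_seq _ F xpredT len) => //; apply/hF; split => //.
  by rewrite btE -mulmxA.
have e : g = wm (rev w) *m (wm w *m g) by rewrite mulmxA (wm_revK R n5 m4) mul1mx.
have : (len g <= size w + N)%N.
  rewrite {1}e; apply: leq_trans (lenM (Gam_wm _ _ _) hwg) _.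
  by apply: leq_add => //; rewrite -[size w]size_rev len_wm.
rewrite -(ler_nat R) natrD => h; apply: le_trans h _.
rewrite -btE in h2; have l0 : 0 <= ln (bt g) by rewrite ln_ge0 // bt_ge1.
have : 0 <= ln (bt g) * (1 + N%:R) by rewrite mulr_ge0 //; lra.
lra.
Qed.

(** Take about T equally spaced points on a horocycle at height 1 / u. Each has an orbit point
    nearby by [descent_word], and the spacing forces these orbit points to be distinct. *)
Lemma orbit_count_lower : exists c T1 : R, [/\ 0 < c, 1 <= T1 &
  forall T, T1 <= T -> exists F : seq 'M[R]_3, [/\ uniq F,
    (forall g, g \in F -> Gam g /\ bt g <= T) & c * T <= (size F)%:R]].
Proof.
have [T0 [a [T1 a0 hw]]] := descent_word.
have T00 : 0 < T0 by lra.
exists ((18 * T0 ^+ 2)^-1), (6 * T0); split.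
- by rewrite invr_gt0 mulr_gt0 // exprn_gt0.
- by lra.
(* With this [u] the horocycle points have time coordinate at most 3 u / 2, so their neighbours have
   beta at most 4 (3 u / 2) T0 = T. The spacing [k] makes [B] between two of them exceed the 4 T0^2
   that a shared neighbour would allow. *)
move=> T hT; pose u := T / (6 * T0); pose k := 3 * T0.
have u1 : 1 <= u by rewrite ler_pdivlMr ?mul1r //; lra.
have k0 : 0 < k by rewrite mulr_gt0.
pose M := Num.truncn (u / k).
have /truncn_itv /andP[M1 M2] : 0 <= u / k by rewrite divr_ge0 ?ltW //; lra.
rewrite -/M in M1 M2.
pose X (i : nat) : R := i%:R * k / u.
pose y (i : nat) := vec3 (((1 + (u * X i) ^+ 2) / u - u) / 2) (u * X i)
   (((1 + (u * X i) ^+ 2) / u + u) / 2).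
have uz : u != 0 by rewrite gt_eqF //; lra.
have yH i : inH2 (y i).
  split; first by rewrite minkE !vec3x !vec3y !vec3t; field.
  rewrite -/it vec3t; apply: divr_gt0 => //; apply: addr_gt0; last exact: lt_le_trans u1.
  apply: divr_gt0; last exact: lt_le_trans u1.
  by apply: ltr_wpDr => //; exact: sqr_ge0.
have huy i : hu (y i) = u by rewrite /hu vec3x vec3t; field.
have hXy i : hX (y i) = X i by rewrite /hX huy vec3y mulrC mulKf.
have hyt i : (i <= M)%N -> (y i) it 0 <= 3 / 2 * u.
  move=> iM; have := hu_t (yH i); rewrite huy hXy.
  have u0 : 0 < u by apply: lt_le_trans u1.
  have X0 : 0 <= X i.
    by apply: divr_ge0; [apply: mulr_ge0; [exact: ler0n | exact: ltW] | exact: ltW].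
  have X1 : X i <= 1.
    rewrite ler_pdivrMr ?mul1r; last by lra.
    rewrite -ler_pdivlMr //; apply: le_trans M1; by rewrite ler_nat.
  have : u^-1 <= 1 by rewrite invf_le1 //; lra.
  have : X i ^+ 2 <= 1 by nra.
  nra.
have sep i j : (i < j)%N -> 4 * T0 ^+ 2 < mink (y i) (y j).
  move=> ij; have := hu_mink (yH i) (yH j); rewrite !huy !hXy subrr expr0n mul0r addr0.
  have -> : u * u * (X i - X j) ^+ 2 = k ^+ 2 * (j%:R - i%:R) ^+ 2.
    by rewrite /X; field.
  have : 1 <= (j%:R - i%:R) ^+ 2 :> R.
    by rewrite -natrB ?(ltnW ij) // -natrX ler1n expn_gt0 subn_gt0 ij.
  move=> h1 h2; have : k ^+ 2 <= k ^+ 2 * (j%:R - i%:R) ^+ 2 :> R.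
    by rewrite ler_peMr ?sqr_ge0.
  have : k ^+ 2 = 9 * T0 ^+ 2 by rewrite /k; ring.
  by nra.
have /choice [w hwi] : forall i, exists w, (wm w *m y i) it 0 <= T0.
  by move=> i; have [w [h _]] := hw _ (yH i); exists w.
pose g i := wm (rev (w i)).
have hg i : Gam (g i) by exact: Gam_wm.
have near_ i : mink (g i *m o) (y i) <= T0.
  rewrite (Gam_mink_adj n5 m4 _ _ (hg i)) /g (invmx_wm R n5 m4) revK minkC.
  by rewrite mink_orgr.
have inj i j : g i = g j -> (i < j)%N -> False.
  move=> e ij; have := sep _ _ ij; apply/negP; rewrite -leNgt.
  have hc l := H2_causal (yH l).
  apply: le_trans (mink_tri (hc i) (hc j) (Gam_orbit_H2 n5 m4 (hg i))) _.
  rewrite ler_pM2l // expr2; apply: ler_pM.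
  - exact: mink_causal_ge0 (hc i) (H2_causal (Gam_orbit_H2 n5 m4 (hg i))).
  - exact: mink_causal_ge0 (H2_causal (Gam_orbit_H2 n5 m4 (hg i))) (hc j).
  - by rewrite minkC.
  - by rewrite e.
exists [seq g i | i <- iota 0 M.+1]; split.
- rewrite map_inj_uniq ?iota_uniq // => i j e.
  by case: (ltngtP i j) => // h; exfalso; [apply: (inj i j) | apply: (inj j i)].
- move=> g' /mapP[i]; rewrite mem_iota add0n ltnS => /= iM ->; split => //.
  have h := mink_tri (H2_causal (org_H2 R)) (H2_causal (Gam_orbit_H2 n5 m4 (hg i))) (yH i).
  apply: le_trans h _; rewrite mink_orgl minkC.
  have e : T = 4 * (3 / 2 * u * T0) by rewrite /u; field; rewrite gt_eqF.
  rewrite [leRHS]e ler_pM2l //; apply: ler_pM => //.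
  - by have [_ /ltW] := yH i.
  - exact: mink_causal_ge0 (H2_causal (Gam_orbit_H2 n5 m4 (hg i))) (H2_causal (yH i)).
  - exact: hyt.
rewrite size_map size_iota; apply: ltW; apply: le_lt_trans M2.
by rewrite /u /k le_eqVlt; apply/orP; left; apply/eqP; field; rewrite gt_eqF.
Qed.

End OrbitGrowth.

(** * Subadditive limits, entropy and drift *)

Section SequenceLimits.
Variable R : realType.
Implicit Types (u v : nat -> R) (l : R).

Lemma cvg_eps u l : (forall e, 0 < e -> exists K : nat, forall k, (K <= k)%N -> `|l - u k| <= e) ->
  u @ \oo --> l.
Proof.
move=> h; apply/cvgrPdist_le => e e0; have [K hK] := h e e0.
by exists K => // k /= /hK.
Qed.

Lemma cvg_epsE u l : u @ \oo --> l ->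
  forall e, 0 < e -> exists K : nat, forall k, (K <= k)%N -> `|l - u k| <= e.
Proof.
move=> /cvgrPdist_le h e e0; have [K _ hK] := h e e0.
by exists K => k /hK.
Qed.

Lemma small_frac (C e : R) : 0 < e -> exists K : nat, forall k, (K <= k)%N -> C / k%:R <= e.
Proof.
move=> e0; exists (Num.truncn (`|C| / e)).+1 => k hk.
have k0 : 0 < k%:R :> R by rewrite ltr0n (leq_trans _ hk).
rewrite ler_pdivrMr //; apply: le_trans (ler_norm C) _.
rewrite -ler_pdivrMl // mulrC; apply: ltW; apply: lt_le_trans (truncnS_gt _) _.
by rewrite ler_nat.
Qed.

Lemma cvg_perturb u v l (C : R) : u @ \oo --> l ->
  (forall k, (0 < k)%N -> `|u k - v k| <= C / k%:R) -> v @ \oo --> l.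
Proof.
move=> /cvg_epsE hu huv; apply: cvg_eps => e e0.
have e20 : 0 < e / 2 by rewrite divr_gt0.
have [K1 h1] := hu _ e20; have [K2 h2] := small_frac C e20.
exists (maxn 1 (maxn K1 K2)) => k; rewrite !geq_max => /and3P[k0 k1 k2].
have -> : l - v k = (l - u k) + (u k - v k) by ring.
apply: le_trans (ler_normD _ _) _.
have := h1 k k1; have := h2 k k2; have := huv k k0; lra.
Qed.

Lemma cvg_le_limits u v l l' (d C : R) : u @ \oo --> l -> v @ \oo --> l' ->
  (forall k, (0 < k)%N -> u k <= v k - d + C / k%:R) -> l <= l' - d.
Proof.
move=> /cvg_epsE hu /cvg_epsE hv huv; apply/ler_addgt0Pr => e e0.
have e30 : 0 < e / 3 by rewrite divr_gt0.
have [K1 h1] := hu _ e30; have [K2 h2] := hv _ e30; have [K3 h3] := small_frac C e30.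
pose k := maxn 1 (maxn K1 (maxn K2 K3)).
have : (k <= k)%N by []; rewrite {1}/k !geq_max => /and4P[k0 k1 k2 k3].
have := h1 k k1; have := h2 k k2; have := huv k k0; have := h3 k k3.
rewrite !ler_norml; lra.
Qed.

Lemma fekete u : (forall k, 0 <= u k) -> (forall i j, u (i + j)%N <= u i + u j) ->
  exists l, (fun k => u k / k%:R) @ \oo --> l.
Proof.
move=> u0 usub; pose A := [set x | exists2 k, (0 < k)%N & x = u k / k%:R].
have A0 : has_inf A.
  split; first by exists (u 1%N / 1%:R), 1%N.
  by exists 0 => _ [k k0 ->]; rewrite divr_ge0.
exists (inf A); apply: cvg_eps => e e0.
have e20 : 0 < e / 2 by rewrite divr_gt0.
have [_ [p p0 ->] hp] := @inf_adherent _ A (e / 2) e20 A0.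
pose M : R := \sum_(r < p) u r.
have uM r : (r < p)%N -> u r <= M.
  by move=> rp; rewrite /M (bigD1 (Ordinal rp)) //= lerDl sumr_ge0.
have umul q r : u (q * p + r)%N <= q%:R * u p + u r.
  elim: q => [|q IH]; first by rewrite mul0n add0n mul0r add0r.
  rewrite mulSn -addnA; apply: le_trans (usub _ _) _.
  by rewrite -natr1 mulrDl mul1r; lra.
have [K hK] := small_frac M e20.
exists (maxn 1 K) => k; rewrite geq_max => /andP[k0 kK].
have kR : 0 < k%:R :> R by rewrite ltr0n.
have pR : 0 < p%:R :> R by rewrite ltr0n.
have lo : inf A <= u k / k%:R by apply: ge_inf; [case: A0 | exists k].
have hi : u k / k%:R <= u p / p%:R + M / k%:R.
  rewrite {1}(divn_eq k p); apply: le_trans (_ : (((k %/ p)%:R * u p + u (k %% p)%N) / k%:R) <= _).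
    by rewrite ler_pM2r ?invr_gt0.
  rewrite mulrDl; apply: lerD; last by rewrite ler_pM2r ?invr_gt0 // uM // ltn_pmod.
  rewrite ler_pdivrMr // mulrAC ler_pdivlMr //.
  have -> : (k %/ p)%:R * u p * p%:R = u p * (k %/ p * p)%:R by rewrite natrM; ring.
  by rewrite ler_wpM2l // ler_nat leq_trunc_div.
have := hK k kK; rewrite ler_norml; lra.
Qed.

End SequenceLimits.

(** * Averages over random words *)

Section WordExpectation.
Variables (R : realType) (n : nat).
Hypothesis n0 : (0 < n)%N.

(* Expectation of [F] over a uniform random word of length [k]. *)
Fixpoint EE (k : nat) (F : seq 'I_n -> R) : R :=
  if k is k'.+1 then n%:R^-1 * \sum_(i < n) EE k' (fun w => F (i :: w)) else F [::].

Lemma nR_gt0 : 0 < n%:R :> R. Proof. by rewrite ltr0n. Qed.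

Lemma EE_le k F G : (forall w, size w = k -> F w <= G w) -> EE k F <= EE k G.
Proof.
elim: k F G => [|k IH] F G h /=; first exact: h.
rewrite ler_pM2l ?invr_gt0 ?nR_gt0 //; apply: ler_sum => i _; apply: IH => w sw.
by apply: h; rewrite /= sw.
Qed.

Lemma EE_ext k F G : (forall w, size w = k -> F w = G w) -> EE k F = EE k G.
Proof.
by move=> h; apply/eqP; rewrite eq_le !EE_le // => w sw; rewrite h.
Qed.

Lemma EE_const k c : EE k (fun=> c) = c.
Proof.
elim: k => [|k IH] //=; under eq_bigr do rewrite IH.
by rewrite sumr_const card_ord -[c *+ n]mulr_natl mulrA mulVf ?mul1r // gt_eqF ?nR_gt0.
Qed.

Lemma EE_ge0 k F : (forall w, size w = k -> 0 <= F w) -> 0 <= EE k F.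
Proof. by move=> h; rewrite -[leLHS](EE_const k 0); apply: EE_le. Qed.

Lemma EE_D k F G : EE k (fun w => F w + G w) = EE k F + EE k G.
Proof.
elim: k F G => [|k IH] F G //=; under eq_bigr do rewrite IH.
by rewrite big_split /= mulrDr.
Qed.

Lemma EE_Z k c F : EE k (fun w => c * F w) = c * EE k F.
Proof.
elim: k F => [|k IH] F //=; under eq_bigr do rewrite IH.
by rewrite -mulr_sumr mulrCA.
Qed.

Lemma EE_Zr k c F : EE k (fun w => F w * c) = EE k F * c.
Proof. by rewrite mulrC -EE_Z; apply: EE_ext => w _; rewrite mulrC. Qed.

Lemma EE_B k F G : EE k (fun w => F w - G w) = EE k F - EE k G.
Proof.
rewrite EE_D; congr (_ + _); rewrite -mulN1r -EE_Z.
by apply: EE_ext => w _; rewrite mulN1r.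
Qed.

Lemma EE_sum (J : Type) (r : seq J) (P : pred J) k (F : J -> seq 'I_n -> R) :
  EE k (fun w => \sum_(j <- r | P j) F j w) = \sum_(j <- r | P j) EE k (F j).
Proof.
elim: r => [|j r IH].
  by rewrite big_nil -[RHS](EE_const k); apply: EE_ext => w _; rewrite big_nil.
rewrite big_cons -IH; case: ifP => Pj; last first.
  by apply: EE_ext => w _; rewrite big_cons Pj.
by rewrite -EE_D; apply: EE_ext => w _; rewrite big_cons Pj.
Qed.

(** The first letter, outermost in [EE], is averaged innermost: for a fixed tail it acts by left
    multiplication with one reflection, as [phi_step] and [EE_push] require. *)
Lemma EE_S k F : EE k.+1 F = EE k (fun w => n%:R^-1 * \sum_(i < n) F (i :: w)).
Proof. by rewrite EE_Z EE_sum. Qed.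

Lemma EE_cat a b F : EE (a + b) F = EE a (fun u => EE b (fun v => F (u ++ v))).
Proof.
elim: a F => [|a IH] F //; rewrite addSn /=; congr (_ * _).
by apply: eq_bigr => i _; rewrite IH.
Qed.

(** Reversal inverts the group element, so the past of the walk seen from its present position has
    the law of a walk. *)
Lemma EE_rev k F : EE k (fun w => F (rev w)) = EE k F.
Proof.
elim: k F => [|k IH] F //; rewrite -{2}addn1 EE_cat [LHS]/=.
rewrite -[X in _ * X]EE_sum -EE_Z -IH; apply: EE_ext => w _ /=.
by congr (_ * _); apply: eq_bigr => i _; rewrite rev_cons revK cats1.
Qed.

Lemma EE_take j k F : (j <= k)%N -> EE k (fun w => F (take j w)) = EE j F.
Proof.
move=> jk; rewrite -{1}(subnKC jk) EE_cat; apply: EE_ext => u su.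
rewrite -[RHS](EE_const (k - j)); apply: EE_ext => v _.
by rewrite -su take_size_cat.
Qed.

Lemma EE_tuple k (F : seq 'I_n -> R) : \sum_(w : k.-tuple 'I_n) (1 / (n ^ k)%:R) * F w = EE k F.
Proof.
rewrite -mulr_sumr; elim: k F => [|k IH] F.
  rewrite expn0 divr1 mul1r /= (bigD1 [tuple]) //= big1 ?addr0 // => t.
  by rewrite tuple0.
have -> : \sum_(w : k.+1.-tuple 'I_n) F w = \sum_(i < n) \sum_(w : k.-tuple 'I_n) F (i :: w).
  rewrite pair_bigA /=.
  rewrite (reindex (fun p : 'I_n * k.-tuple 'I_n => [tuple of p.1 :: p.2])) //=.
  exists (fun t => (thead t, [tuple of behead t])) => [[i t] _|t _] /=.
    by rewrite theadE; congr pair; apply/val_inj.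
  by rewrite -tuple_eta.
rewrite mulr_sumr /= mulr_sumr; apply: eq_bigr => i _.
by rewrite -IH mulrA; congr (_ * _); rewrite expnS natrM !div1r invfM.
Qed.

End WordExpectation.

(** * Transience, entropy and drift of the walk *)

Section RandomWalk.
Variables (R : realType) (n m : nat).
Hypotheses (n5 : (5 <= n)%N) (m4 : (4 <= m)%N) (m_even : ~~ odd m).
Local Notation s := (@side_normal R n m).
Local Notation r := (@refl R n m).
Local Notation wm := (@word_mat R n m).
Local Notation Gam := (@Gamma R n m).
Local Notation o := (org R).
Local Notation len := (@len R n m).
Local Notation EE := (@EE R n).

Lemma n_gt0 : (0 < n)%N. Proof. exact: leq_trans n5. Qed.
Let n0 := n_gt0.

(** At most two of the n >= 5 letters shorten [g]. They contribute 5/4 instead of 4/5, an excess of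
    9/20, so the average factor is at most 4/5 + (2/5)(9/20) = 49/50. *)
Lemma phi_step g : Gam g ->
  n%:R^-1 * \sum_(i < n) (4 / 5) ^+ len (r i *m g) <= 49 / 50 * (4 / 5) ^+ len g :> R.
Proof.
have aux (X : R) : X <= 4 / 5 * (4 / 5 * X) + 9 / 20 * (4 / 5 * X) by lra.
move=> hg; have nn := n_ge5 R n5; set phi := (4 / 5) ^+ len g : R.
have p0 : 0 < phi by rewrite exprn_gt0.
pose D := [pred i : 'I_n | mink (g *m o) (s i) < 0].
have step i : (4 / 5) ^+ len (r i *m g) <= 4 / 5 * phi + (if D i then 9 / 20 * phi else 0) :> R.
  case: (len_side n5 m4 m_even i hg) => [[h ->]|[h lg]]; rewrite /D /=.
    by rewrite (lt_gtF h) addr0 exprS.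
  have e : phi = 4 / 5 * (4 / 5) ^+ len (r i *m g) by rewrite /phi lg exprS.
  by rewrite h e.
clearbody phi; have : \sum_(i < n) (4 / 5) ^+ len (r i *m g) <= n%:R * (4 / 5 * phi) + 9 / 10 * phi.
  apply: le_trans (ler_sum _ (fun i _ => step i)) _.
  rewrite big_split /= sumr_const card_ord -[_ *+ n]mulr_natl lerD2l -big_mkcond /=.
  rewrite sumr_const -[leLHS]mulr_natl.
  have : (#|D|)%:R <= 2 :> R.
    by rewrite (ler_nat _ _ 2); apply: descent_le2 => //; exact: (Gam_orbit_H2 n5 m4 hg).
  by nra.
rewrite -(@ler_pM2l _ n%:R^-1) ?invr_gt0 ?ltr0n ?n_gt0 // => /le_trans; apply.
have nz : n%:R != 0 :> R by rewrite gt_eqF // ltr0n n_gt0.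
have -> : n%:R^-1 * (n%:R * (4 / 5 * phi) + 9 / 10 * phi) = 4 / 5 * phi + n%:R^-1 * (9 / 10 * phi).
  by field.
have : n%:R^-1 <= 5^-1 :> R by rewrite lef_pV2 ?posrE //; lra.
by nra.
Qed.

Lemma EE_phi k : EE k (fun w => (4 / 5) ^+ len (wm w)) <= (49 / 50) ^+ k.
Proof.
elim: k => [|k IH]; first by rewrite /= len1.
rewrite EE_S //; apply: (@le_trans _ _ (EE k (fun w => 49 / 50 * (4 / 5) ^+ len (wm w)))).
  by apply: EE_le => // w _; apply: phi_step; exact: Gam_wm.
by rewrite EE_Z // exprS ler_pM2l.
Qed.

(** Markov's inequality for (4/5)^len. *)
Lemma escape k a : EE k (fun w => (len (wm w) <= a)%N%:R) <= (5 / 4) ^+ a * (49 / 50) ^+ k.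
Proof.
have h : 0 <= (5 / 4) ^+ a :> R by rewrite exprn_ge0.
apply: le_trans (ler_wpM2l h (EE_phi k)); rewrite -EE_Z //; apply: EE_le => // w _.
case: leqP => [la|_]; last by rewrite mulr_ge0 // exprn_ge0.
rewrite -(subnKC la) exprD mulrAC -exprMn.
rewrite (_ : 5 / 4 * (4 / 5) = 1 :> R) ?expr1n ?mul1r; last by field.
by apply: exprn_ege1; lra.
Qed.

Lemma EE_word (w0 : seq 'I_n) : EE (size w0) (fun w => (w == w0)%:R) = n%:R^-1 ^+ size w0.
Proof.
elim: w0 => [|i w0 IH] //; rewrite [LHS]/= exprS; congr (_ * _).
rewrite (bigD1 i) //= big1 ?addr0 => [|j ji].
  by rewrite -IH; apply: EE_ext => // w _; rewrite eqseq_cons eqxx.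
rewrite -[RHS](EE_const n0 (size w0)); apply: EE_ext => // w _.
by rewrite eqseq_cons (negbTE ji).
Qed.

Definition pr k (g : 'M[R]_3) : R := EE k (fun w => (wm w == g)%:R).

Lemma mu_kE k g : mu_k n m k g = pr k g.
Proof.
rewrite /pr -EE_tuple -mulr_sumr mul1r mulrC /mu_k; congr (_ * _).
rewrite -sum1_card natr_sum big_mkcond /=; apply: eq_bigr => w _.
rewrite (_ : (w \in _) = (wm w == g)); last by apply/idP/idP => [/asboolP//|h]; apply/asboolP.
by case: ifP.
Qed.

Lemma entropy_kE k : entropy_k R n m k = - EE k (fun w => ln (pr k (wm w))).
Proof.
by rewrite /entropy_k -EE_tuple; congr (- _); apply: eq_bigr => w _; rewrite mu_kE.
Qed.

Lemma drift_kE x0 k : drift_k n m x0 k = EE k (fun w => gdist x0 1%:M (wm w)).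
Proof. by rewrite /drift_k -EE_tuple. Qed.

Lemma prM a b g h : pr a g * pr b h <= pr (a + b) (g *m h).
Proof.
rewrite /pr EE_cat -EE_Zr //; apply: EE_le => // u _.
rewrite -EE_Z //; apply: EE_le => // v _.
case: eqP => [<-|]; last by rewrite mul0r.
by case: eqP => [<-|]; rewrite ?mulr0 // mul1r wm_cat eqxx.
Qed.

Lemma pr_gt0 w : 0 < pr (size w) (wm w).
Proof.
apply: (@lt_le_trans _ _ (EE (size w) (fun v => (v == w)%:R))).
  by rewrite EE_word exprn_gt0 // invr_gt0 ltr0n.
by apply: EE_le => // v _; case: (v =P w) => [->|]; rewrite ?eqxx.
Qed.

Lemma pr_le1 k g : pr k g <= 1.
Proof. by rewrite -[leRHS](EE_const n0 k); apply: EE_le => // w _; case: eqP. Qed.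

Lemma entropy_ge0 k : 0 <= entropy_k R n m k.
Proof.
rewrite entropy_kE oppr_ge0 -[leRHS](EE_const n0 k); apply: EE_le => // w sw.
by apply: ln_le0; exact: pr_le1.
Qed.

Lemma entropy_subadd i j : entropy_k R n m (i + j) <= entropy_k R n m i + entropy_k R n m j.
Proof.
rewrite !entropy_kE -opprD lerN2 EE_cat.
rewrite -[X in _ + X](EE_const n0 i) -EE_D //; apply: EE_le => // u su.
rewrite -[X in X + _](EE_const n0 j) -EE_D //; apply: EE_le => // v sv.
have pu : 0 < pr i (wm u) by rewrite -su pr_gt0.
have pv : 0 < pr j (wm v) by rewrite -sv pr_gt0.
rewrite -lnM ?posrE // wm_cat ler_ln ?posrE ?mulr_gt0 //.
  exact: prM.
by rewrite -su -sv -size_cat -wm_cat pr_gt0.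
Qed.

Definition words k : seq 'M[R]_3 := undup [seq wm (tval w) | w <- enum {: k.-tuple 'I_n}].

Lemma words_mem w : wm w \in words (size w).
Proof.
rewrite mem_undup; apply/mapP; exists (in_tuple w) => //; exact: mem_enum.
Qed.

Lemma EE_words k (Phi : 'M[R]_3 -> R) :
  EE k (fun w => Phi (wm w)) = \sum_(g <- words k) pr k g * Phi g.
Proof.
under [RHS]eq_bigr do rewrite /pr -EE_Zr //.
rewrite -EE_sum //; apply: EE_ext => // w sw.
rewrite (bigD1_seq (wm w)) ?undup_uniq //= -?sw ?words_mem //.
rewrite eqxx mul1r big1 ?addr0 // => g gw.
by rewrite eq_sym (negbTE gw) mul0r.
Qed.

(** Relative entropy with respect to Q / M is nonnegative, by ln y <= y - 1. The total mass of [Q]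
    is controlled on finite lists only. *)
Lemma gibbs k (Q : 'M[R]_3 -> R) (M : R) : 0 < M ->
  (forall F, uniq F -> (forall g, g \in F -> Gam g) -> \sum_(g <- F) Q g <= M) ->
  (forall w, size w = k -> 0 < Q (wm w)) ->
  entropy_k R n m k <= ln M - EE k (fun w => ln (Q (wm w))).
Proof.
move=> M0 hM hQ; rewrite entropy_kE -subr_ge0.
have -> : ln M - EE k (fun w => ln (Q (wm w))) - - EE k (fun w => ln (pr k (wm w))) =
    EE k (fun w => ln M - ln (Q (wm w)) + ln (pr k (wm w))).
  by rewrite EE_D // EE_B // EE_const //; ring.
have h1 : EE k (fun w => 1 - Q (wm w) / (M * pr k (wm w))) <=
    EE k (fun w => ln M - ln (Q (wm w)) + ln (pr k (wm w))).
  apply: EE_le => // w sw; have q0 := hQ w sw.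
  have p0 : 0 < pr k (wm w) by rewrite -sw pr_gt0.
  have y0 : 0 < Q (wm w) / (M * pr k (wm w)) by rewrite divr_gt0 // mulr_gt0.
  have : ln (Q (wm w) / (M * pr k (wm w))) <= Q (wm w) / (M * pr k (wm w)) - 1.
    rewrite -ler_expR lnK ?posrE //.
    by have := expR_ge1Dx (Q (wm w) / (M * pr k (wm w)) - 1); lra.
  by rewrite ln_div ?posrE ?mulr_gt0 // lnM ?posrE //; lra.
apply: le_trans h1; rewrite EE_B // EE_const // subr_ge0.
rewrite (EE_words k (fun g => Q g / (M * pr k g))).
rewrite (_ : \sum_(g <- _) _ = \sum_(g <- words k) Q g / M); last first.
  apply: eq_big_seq => g; rewrite mem_undup => /mapP[w _ ->].
  have p0 : 0 < pr k (wm w) by rewrite -{1}(size_tuple w) pr_gt0.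
  by field; rewrite !gt_eqF.
rewrite -mulr_suml ler_pdivrMr // mul1r; apply: hM; first exact: undup_uniq.
by move=> g; rewrite mem_undup => /mapP[w _ ->]; exact: Gam_wm.
Qed.

Local Notation bt := (@bt R).

(** The factor 2 makes it exactly subadditive, matching the 2 in [btM]. *)
Definition drift0 k : R := EE k (fun w => ln (2 * bt (wm w))).

Lemma bt_wm_ge1 w : 1 <= bt (wm w).
Proof. by apply: (bt_ge1 n5 m4); exact: Gam_wm. Qed.

Lemma drift0_ge0 k : 0 <= drift0 k.
Proof. by apply: EE_ge0 => // w _; apply: ln_ge0; have := bt_wm_ge1 w; lra. Qed.

Lemma drift0_subadd i j : drift0 (i + j) <= drift0 i + drift0 j.
Proof.
rewrite /drift0 EE_cat -[X in _ + X](EE_const n0 i) -EE_D //; apply: EE_le => // u _.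
rewrite -[X in X + _](EE_const n0 j) -EE_D //; apply: EE_le => // v _.
have hu := bt_wm_ge1 u; have hv := bt_wm_ge1 v; have huv := bt_wm_ge1 (u ++ v).
rewrite -lnM ?posrE; [|lra|lra]; rewrite ler_ln ?posrE; [|lra|].
  rewrite wm_cat.
  have := btM n5 m4 (Gam_wm R m u) (Gam_wm R m v); lra.
by rewrite mulr_gt0 //; lra.
Qed.

Lemma drift0_linear k : drift0 k <= k%:R * drift0 1 + drift0 0.
Proof.
elim: k => [|k IH]; first by rewrite mul0r add0r.
by rewrite -addn1; apply: le_trans (drift0_subadd _ _) _; rewrite natrD mulrDl mul1r; lra.
Qed.

Section BasePoint.
Variable x0 : 'cV[R]_3.
Hypothesis hx0 : inH2 x0.

(** Each comparison uses [mink_tri] twice, and each use costs 4 B(x0, o); hence the constant 16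
    B(x0, o)^2. *)
Lemma base_change : exists C : R, 1 <= C /\ forall g, Gam g ->
  [/\ 1 <= mink x0 (g *m x0), mink x0 (g *m x0) <= C * bt g & bt g <= C * mink x0 (g *m x0)].
Proof.
have t1 := H2_t_ge1 hx0; exists (16 * x0 it 0 ^+ 2); split; first by nra.
move=> g hg; have hgx : inH2 (g *m x0) by apply: (Gam_H2 n5 m4 hg).
have hgo := Gam_orbit_H2 n5 m4 hg; have ho := org_H2 R.
have c := H2_causal; have m1 := mink_H2_ge1 hx0 hgx.
have e1 : mink (g *m o) (g *m x0) = x0 it 0 by rewrite (Gam_isom n5 m4 _ _ hg) mink_orgl.
split => //.
- have h1 := mink_tri (c _ _ hx0) (c _ _ hgx) ho.
  have h2 := mink_tri (c _ _ ho) (c _ _ hgx) hgo.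
  rewrite e1 -/(bt g) in h2; rewrite mink_orgr in h1.
  have : x0 it 0 * mink o (g *m x0) <= x0 it 0 * (4 * (bt g * x0 it 0)) by rewrite ler_pM2l //; lra.
  by lra.
- have h1 := mink_tri (c _ _ ho) (c _ _ hgo) hx0.
  have h2 := mink_tri (c _ _ hx0) (c _ _ hgo) hgx.
  rewrite (minkC (g *m x0)) e1 in h2; rewrite -/(bt g) mink_orgl in h1.
  have : x0 it 0 * mink x0 (g *m o) <= x0 it 0 * (4 * (mink x0 (g *m x0) * x0 it 0)) by rewrite ler_pM2l //; lra.
  by lra.
Qed.

Lemma gdist_bt : exists C : R, 1 <= C /\ forall g, Gam g ->
  `|ln (2 * bt g) - gdist x0 1%:M g| <= ln (2 * C).
Proof.
have [C [C1 hC]] := base_change; exists C; split => // g hg.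
have [m1 m2 m3] := hC g hg; have b1 := bt_ge1 n5 m4 hg.
rewrite /gdist /hdist mul1mx; have := arccosh_ge m1; have := arccosh_le m1.
have h1 : ln (2 * mink x0 (g *m x0)) <= ln (2 * C) + ln (2 * bt g).
  rewrite -lnM ?posrE ?ler_ln ?posrE; nra.
have h2 : ln (2 * bt g) <= ln (2 * C) + ln (mink x0 (g *m x0)).
  rewrite -lnM ?posrE ?ler_ln ?posrE; nra.
rewrite ler_norml; lra.
Qed.

Lemma drift_limit (l : R) : (fun k => drift0 k / k%:R) @ \oo --> l ->
  (fun k => drift_k n m x0 k / k%:R) @ \oo --> l.
Proof.
have [C [C1 hC]] := gdist_bt => hl; apply: (cvg_perturb (C := ln (2 * C))) hl _ => k k0.
have kR : 0 < k%:R :> R by rewrite ltr0n.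
have ki : 0 < k%:R^-1 :> R by rewrite invr_gt0.
rewrite -mulrBl normrM (gtr0_norm ki) ler_pM2r //.
rewrite drift_kE /drift0 -EE_B // ler_norml.
have hw w : `|ln (2 * bt (wm w)) - gdist x0 1%:M (wm w)| <= ln (2 * C).
  by apply: hC; exact: Gam_wm.
by rewrite -[X in - X <= _](EE_const n0 k) -[X in _ && (_ <= X)](EE_const n0 k)
  -[X in X <= _ ]mulN1r -EE_Z // !EE_le // => w _; have := hw w; rewrite ler_norml; lra.
Qed.

Lemma ball_limit : (fun k => ln ((ball_card n m x0 k)%:R : R) / k%:R) @ \oo --> (1 : R).
Proof.
have [C [C1 hC]] := base_change.
have [A A0 hA] := orbit_count R n5 m4 m_even.
have [c [T1 [c0 T11 hc]]] := orbit_count_lower R n5 m4.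
have inB k g : Gam g -> bt g <= expR k%:R / (2 * C) -> gdist x0 1%:M g <= k%:R.
  move=> hg; rewrite ler_pdivlMr; last by lra.
  move=> h; have [m1 m2 m3] := hC g hg; rewrite /gdist /hdist mul1mx.
  apply: le_trans (arccosh_le m1) _; rewrite -ler_expR lnK ?posrE; nra.
have Bin k g : Gam g -> gdist x0 1%:M g <= k%:R -> bt g <= C * expR k%:R.
  move=> hg h; have [m1 m2 m3] := hC g hg; apply: le_trans m3 _.
  rewrite ler_pM2l; last by lra.
  rewrite -[leLHS]lnK ?posrE ?ler_expR; last by lra.
  by apply: le_trans h; rewrite /gdist /hdist mul1mx; exact: arccosh_ge.
(* [fset_set] of an infinite set is empty, so [ball_card] has to be tied to an explicit finite list
   first. *)
have ballE k : exists F : seq 'M[R]_3, [/\ uniq F, ball_card n m x0 k = size F &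
    forall g, g \in F <-> Gam g /\ gdist x0 1%:M g <= k%:R].
  have [F [uF hF]] := ball_list n5 m4 m_even (C * expR k%:R).
  pose F' := [seq g <- F | gdist x0 1%:M g <= k%:R].
  have memF' g : g \in F' <-> Gam g /\ gdist x0 1%:M g <= k%:R.
    rewrite mem_filter; split => [/andP[h /hF[]]//|[h1 h2]].
    by rewrite h2; apply/hF; split => //; exact: Bin.
  have uF' : uniq F' by exact: filter_uniq.
  exists F'; split => //; rewrite /ball_card.
  rewrite (_ : [set g | Gamma n m g /\ _] = [set` [fset g in F']%fset]).
    by rewrite set_fsetK card_fseq undup_id.
  by apply/seteqP; split => g /=; rewrite in_fset /=; move/memF'.
have T0 k : (ball_card n m x0 k)%:R <= A * (C * expR k%:R).
  have [F [uF -> hF]] := ballE k; apply: hA => //.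
    have : 1 <= expR k%:R :> R by rewrite -[leLHS]expR0 ler_expR.
    by nra.
  by move=> g /hF[hg h]; split => //; exact: Bin.
have e0 k : 0 < expR k :> R by exact: expR_gt0.
(* For small [k] the orbit count says nothing and only the identity is known to lie in the ball; a
   constant at most 1 covers this case as well. *)
pose c' := Num.min c 1.
have c'0 : 0 < c' by rewrite lt_min c0 ltr01.
have D0 : 0 < 2 * C * T1 by apply: mulr_gt0; lra.
have L0 k : c' * (expR k%:R / (2 * C * T1)) <= (ball_card n m x0 k)%:R.
  have [F' [uF' -> hF']] := ballE k.
  have [h|h] := leP T1 (expR k%:R / (2 * C)).
    have [F [uF hF sF]] := hc _ h; apply: (@le_trans _ _ (c * (expR k%:R / (2 * C)))).
      apply: ler_pM; rewrite ?divr_ge0 ?expR_ge0 ?(ltW c'0) ?(ltW D0) //.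
        by rewrite ge_min lexx.
      rewrite ler_pM2l // lef_pV2 ?posrE //; [|lra].
      by rewrite ler_peMr //; lra.
    apply: le_trans sF _; rewrite ler_nat; apply: uniq_leq_size => // g /hF[hg hb].
    by apply/hF'; split => //; exact: inB.
  apply: (@le_trans _ _ (1 * 1)).
    apply: ler_pM; rewrite ?divr_ge0 ?expR_ge0 ?(ltW c'0) ?(ltW D0) //.
      by rewrite ge_min lexx orbT.
    rewrite invfM mulrA ler_pdivrMr ?mul1r; [exact: ltW | lra].
  rewrite mulr1 ler1n; apply: (@leq_trans (size [:: 1%:M : 'M[R]_3])) => //.
  apply: uniq_leq_size => // g; rewrite inE => /eqP ->; apply/hF'; split; first exact: Gam1.
  rewrite /gdist /hdist !mul1mx; case: hx0 => -> _.
  by rewrite /arccosh expr1n subrr sqrtr0 addr0 ln1.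
apply: (cvg_perturb (u := fun=> 1) (C := `|ln (A * C)| + `|ln (c' / (2 * C * T1))|)).
  exact: cvg_cst.
move=> k k0; have kR : 0 < k%:R :> R by rewrite ltr0n.
have kz : k%:R != 0 :> R by rewrite gt_eqF.
have b0 : 0 < (ball_card n m x0 k)%:R :> R.
  by apply: lt_le_trans (L0 k); apply: mulr_gt0 => //; apply: divr_gt0.
have h1 : ln (ball_card n m x0 k)%:R <= ln (A * C) + k%:R.
  have AC : 0 < A * C by apply: mulr_gt0 => //; lra.
  rewrite -[X in _ <= _ + X]expRK -lnM ?posrE ?e0 // ler_ln ?posrE //; last exact: mulr_gt0.
  by rewrite -mulrA.
have h2 : ln (c' / (2 * C * T1)) + k%:R <= ln (ball_card n m x0 k)%:R.
  have AC : 0 < c' / (2 * C * T1) by apply: divr_gt0.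
  rewrite -[X in _ + X <= _]expRK -lnM ?posrE ?e0 // ler_ln ?posrE //; first by rewrite mulrAC -mulrA.
  exact: mulr_gt0.
have ki : 0 < k%:R^-1 :> R by rewrite invr_gt0.
rewrite -{1}(divff kz) -mulrBl normrM (gtr0_norm ki) ler_pM2r // ler_norml.
have := ler_norm (ln (A * C)); have := ler_norm (- ln (c' / (2 * C * T1))).
have := normr_ge0 (ln (A * C)); have := normr_ge0 (ln (c' / (2 * C * T1))).
rewrite normrN; lra.
Qed.

End BasePoint.

End RandomWalk.

(** * The axis of a product of two reflections *)

Section Axis.
Variables (R : realType) (n m : nat).
Hypotheses (n5 : (5 <= n)%N) (m4 : (4 <= m)%N) (m_even : ~~ odd m).
Local Notation s := (@side_normal R n m).
Local Notation r := (@refl R n m).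
Local Notation wm := (@word_mat R n m).
Local Notation Gam := (@Gamma R n m).
Local Notation o := (org R).
Local Notation len := (@len R n m).
Local Notation EE := (@EE R n).
Local Notation bt := (@bt R).

Variables (z k : 'I_n).
Let kap : R := mink (s z) (s k).
Hypothesis kap1 : 1 < kap.

(** The exponential of the distance between the two sides; its square [lam] is the exponential of
    the translation length of r_z r_k. *)
Definition emu : R := kap + Num.sqrt (kap ^+ 2 - 1).
Local Notation mu := emu.
Definition lam : R := mu ^+ 2.

Lemma mu_root : mu ^+ 2 = 2 * kap * mu - 1.
Proof. by have := sqr_sqrtr (sqr_sub1_ge0 (ltW kap1)); rewrite /mu; lra. Qed.

Lemma mu_gt1 : 1 < mu.
Proof. by have := sqrtr_ge0 (kap ^+ 2 - 1); have := kap1; rewrite /mu; lra. Qed.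

Lemma mu_gt0 : 0 < mu. Proof. exact: lt_trans mu_gt1. Qed.

Lemma mu_inv : mu^-1 = 2 * kap - mu.
Proof.
have m0 : mu != 0 by rewrite gt_eqF // mu_gt0.
by apply: (mulIf m0); rewrite mulVf //; have := mu_root; lra.
Qed.

Lemma muV_root : mu^-1 ^+ 2 = 2 * kap * mu^-1 - 1.
Proof. by rewrite mu_inv; have := mu_root; lra. Qed.

Lemma lam_gt1 : 1 < lam.
Proof. by rewrite /lam expr_gt1 ?mu_gt1 // ltW // mu_gt0. Qed.

Lemma lam_gt0 : 0 < lam. Proof. exact: lt_trans lam_gt1. Qed.

(** For the roots x of x^2 - 2 kap x + 1 these are null eigenvectors of r_z r_k, the ends of the
    common perpendicular: x = mu^-1 is the attracting end with eigenvalue [lam], x = mu the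
    repelling one. *)
Definition axis_end (x : R) : 'cV[R]_3 := s z + x *: s k.

Lemma axis_step (x : R) : x != 0 -> x ^+ 2 = 2 * kap * x - 1 ->
  r z *m (r k *m axis_end x) = x ^- 2 *: axis_end x.
Proof.
move=> x0 hx; have hxi : x^-1 = 2 * kap - x by apply: (mulIf x0); rewrite mulVf //; lra.
have e1 : r k *m axis_end x = axis_end x^-1.
  rewrite reflE /axis_end minkDl minkZl mink_side_self // -/kap -addrA -scalerDl.
  by congr (_ + _ *: _); rewrite hxi; ring.
rewrite e1 reflE /axis_end minkDl minkZl mink_side_self // (minkC (s k)) -/kap.
have -> : 2 * (-1 + x^-1 * kap) = x ^- 2 - 1.
  have -> : x ^- 2 = 2 * kap * x^-1 - 1.
    by rewrite -exprVn hxi; move: hx; lra.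
  by ring.
by move: (s z) (s k) => u v; apply/matrixP => a b; rewrite !mxE; field.
Qed.

Definition seg (N : nat) : seq 'I_n := iter N (fun w => z :: k :: w) [::].

Lemma size_seg N : size (seg N) = (2 * N)%N.
Proof. by elim: N => [|N IH] //=; rewrite IH mulnS. Qed.

Definition gam N := wm (seg N).

Lemma Gam_gam N : Gam (gam N). Proof. exact: Gam_wm. Qed.

Lemma gamS N : gam N.+1 = r z *m (r k *m gam N). Proof. by []. Qed.

Lemma gam_axis N (x : R) : x != 0 -> x ^+ 2 = 2 * kap * x - 1 ->
  gam N *m axis_end x = (x ^- 2) ^+ N *: axis_end x.
Proof.
move=> x0 hx; elim: N => [|N IH]; first by rewrite mul1mx expr0 scale1r.
rewrite gamS -!mulmxA IH -!scalemxAr axis_step // scalerA -exprSr //.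
Qed.

Local Notation ep := (axis_end mu^-1).
Local Notation em := (axis_end mu).

Lemma muV_neq0 : mu^-1 != 0. Proof. by rewrite invr_eq0 gt_eqF // mu_gt0. Qed.
Lemma mu_neq0 : mu != 0. Proof. by rewrite gt_eqF // mu_gt0. Qed.

Lemma gam_ep N : gam N *m ep = lam ^+ N *: ep.
Proof. by rewrite (gam_axis N muV_neq0 muV_root) -exprVn invrK. Qed.

Lemma gam_em N : gam N *m em = lam ^- N *: em.
Proof. by rewrite (gam_axis N mu_neq0 mu_root) exprVn. Qed.

Lemma axis_end_null (x : R) : x ^+ 2 = 2 * kap * x - 1 -> mink (axis_end x) (axis_end x) = 0.
Proof.
move=> hx; rewrite /axis_end !minkDl !minkDr !minkZl !minkZr !mink_side_self //.
by rewrite (minkC (s k)) -/kap; lra.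
Qed.

Lemma axis_end_t (x : R) : 0 < x -> 0 < axis_end x it 0.
Proof.
move=> x0; rewrite -mink_orgl /axis_end minkDr minkZr !mink_org_side //.
by have := sh_gt0 R n5 m4; nra.
Qed.

Lemma axis_end_causal (x : R) : 0 < x -> x ^+ 2 = 2 * kap * x - 1 -> causal (axis_end x).
Proof. by move=> x0 hx; split; [rewrite axis_end_null | rewrite ltW // axis_end_t]. Qed.

Lemma ep_causal : causal ep.
Proof. by apply: axis_end_causal; rewrite ?invr_gt0 ?mu_gt0 ?muV_root. Qed.

Lemma em_causal : causal em.
Proof. by apply: axis_end_causal; rewrite ?mu_gt0 ?mu_root. Qed.

Lemma mink_ep_em : mink ep em = 2 * (kap ^+ 2 - 1).
Proof.
rewrite /axis_end !minkDl !minkDr !minkZl !minkZr !mink_side_self // (minkC (s k)) -/kap.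
rewrite mu_inv; have := mu_root; lra.
Qed.

Lemma mink_ep_em_gt0 : 0 < mink ep em.
Proof. by rewrite mink_ep_em; have := kap1; nra. Qed.

Lemma mink_gam_em N (x : 'cV[R]_3) : mink (gam N *m x) em = lam ^+ N * mink x em.
Proof.
have lN : lam ^+ N != 0 by rewrite expf_neq0 // gt_eqF // lam_gt0.
rewrite -[in RHS](Gam_isom n5 m4 x em (Gam_gam N)) gam_em minkZr mulrA divff //.
by rewrite mul1r.
Qed.

Lemma mink_gam_ep N (x : 'cV[R]_3) : mink (gam N *m x) ep = lam ^- N * mink x ep.
Proof.
have lN : lam ^+ N != 0 by rewrite expf_neq0 // gt_eqF // lam_gt0.
rewrite -[in RHS](Gam_isom n5 m4 x ep (Gam_gam N)) gam_ep minkZr mulrA mulVf //.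
by rewrite mul1r.
Qed.

Lemma lamX_ge1 N : 1 <= lam ^+ N.
Proof. by apply: exprn_ege1; rewrite ltW // lam_gt1. Qed.

(** [mink_four] for [o], its image and the two ends, which [gam N] scales by lam^N and lam^-N. *)
Lemma gam_upper : exists Cg : R, 1 <= Cg /\ forall N, bt (gam N) <= Cg * lam ^+ N.
Proof.
have E0 := mink_ep_em_gt0; set E := mink ep em in E0 *.
have tp : 0 < ep it 0 by apply: axis_end_t; rewrite invr_gt0 mu_gt0.
have tm : 0 < em it 0 by apply: axis_end_t; rewrite mu_gt0.
have P0 : 0 < 4 * (ep it 0 * em it 0) / E by apply: divr_gt0 => //; rewrite !mulr_gt0.
exists (1 + 4 * (ep it 0 * em it 0) / E); split; first by lra.
move=> N; have := mink_four (H2_causal (org_H2 R))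
  (H2_causal (Gam_orbit_H2 n5 m4 (Gam_gam N))) ep_causal em_causal.
rewrite -/E -/(bt (gam N)) mink_gam_em mink_gam_ep !mink_orgl.
have l1 := lamX_ge1 N; move: (bt (gam N)) (lam ^+ N) l1 => B X X1 h.
have Xi : X^-1 <= X by apply: (le_trans _ X1); rewrite invf_le1 //; lra.
have P1 : 0 < ep it 0 * em it 0 by exact: mulr_gt0.
have h2 : X^-1 * (ep it 0 * em it 0) <= X * (ep it 0 * em it 0) by rewrite ler_pM2r.
have h3 : B <= 4 * (ep it 0 * em it 0) / E * X by rewrite mulrAC ler_pdivlMr //; lra.
by lra.
Qed.

(* Four-point inequality for [y], [gam N x] and the two ends of the axis. *)
Lemma gam_lower (c : R) : 0 < c -> exists (c1 : R) (N0 : nat), 0 < c1 /\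
  forall N (x y : 'cV[R]_3), (N0 <= N)%N -> inH2 x -> inH2 y ->
  c * y it 0 <= mink y ep -> c * x it 0 <= mink x em ->
  c1 * lam ^+ N * (y it 0 * x it 0) <= mink y (gam N *m x).
Proof.
move=> c0; have E0 := mink_ep_em_gt0; set E := mink ep em in E0 *.
have tp : 0 < ep it 0 by apply: axis_end_t; rewrite invr_gt0 mu_gt0.
have tm : 0 < em it 0 by apply: axis_end_t; rewrite mu_gt0.
have P1 : 0 < ep it 0 * em it 0 by exact: mulr_gt0.
have l1 := lam_gt1.
(* By Bernoulli's inequality, from this rank on the term carrying lam^-N is at most half of the main
   term of the four-point inequality. *)
pose N0 := (Num.truncn (16 * (ep it 0 * em it 0) / c ^+ 2 / (lam - 1))).+1.
exists (c ^+ 2 / (4 * E)), N0; split; first by apply: divr_gt0; [exact: exprn_gt0 | exact: mulr_gt0].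
move=> N x y hN hx hy hyp hxm.
have big : 16 * (ep it 0 * em it 0) <= c ^+ 2 * lam ^+ N.
  rewrite [leRHS]mulrC -ler_pdivrMr ?exprn_gt0 //.
  have bern : 1 + N%:R * (lam - 1) <= lam ^+ N.
    elim: (N) => [|k' IH]; first by rewrite mul0r addr0 expr0.
    rewrite exprS -natr1; have : 0 <= k'%:R * (lam - 1) * (lam - 1).
      by rewrite !mulr_ge0 ?subr_ge0 ?(ltW l1).
    by have := lam_gt0; nra.
  apply: le_trans bern.
  have : 16 * (ep it 0 * em it 0) / c ^+ 2 / (lam - 1) < N%:R.
    by apply: lt_le_trans (truncnS_gt _) _; rewrite ler_nat.
  by rewrite ltr_pdivrMr ?subr_gt0 //; lra.
have gx : inH2 (gam N *m x) := Gam_H2 n5 m4 (Gam_gam N) hx.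
have := mink_four ep_causal (H2_causal hy) (H2_causal gx) em_causal.
rewrite -/E (minkC ep) (minkC ep) mink_gam_em mink_gam_ep.
have a1 := mink_le_t (H2_causal hx) ep_causal.
have a2 := mink_le_t (H2_causal hy) em_causal.
have b1 := mink_causal_ge0 (H2_causal hx) ep_causal.
have b2 := mink_causal_ge0 (H2_causal hy) em_causal.
have x1 := H2_t_ge1 hx; have y1 := H2_t_ge1 hy; have X1 := lamX_ge1 N.
move: (lam ^+ N) X1 big => X X1 big h.
have Xi : X^-1 <= 1 by rewrite invf_le1 //; lra.
have Xi0 : 0 <= X^-1 by rewrite invr_ge0; lra.
have d1 : X * (c ^+ 2 * (y it 0 * x it 0)) <= X * (mink y ep * mink x em).
  rewrite ler_pM2l; last by lra.
  have -> : c ^+ 2 * (y it 0 * x it 0) = (c * y it 0) * (c * x it 0) by ring.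
  by apply: ler_pM => //; apply: mulr_ge0; lra.
have d2 : X^-1 * (mink x ep * mink y em) <= 4 * (ep it 0 * em it 0) * (y it 0 * x it 0).
  apply: (@le_trans _ _ (1 * ((2 * (x it 0 * ep it 0)) * (2 * (y it 0 * em it 0))))).
    by apply: ler_pM => //; [exact: mulr_ge0 | exact: ler_pM].
  by rewrite mul1r le_eqVlt; apply/orP; left; apply/eqP; ring.
have d3 : 16 * (ep it 0 * em it 0) * (y it 0 * x it 0) <= c ^+ 2 * X * (y it 0 * x it 0).
  by rewrite ler_pM2r // mulr_gt0 //; lra.
have -> : c ^+ 2 / (4 * E) * X * (y it 0 * x it 0) = (c ^+ 2 * X * (y it 0 * x it 0)) / (4 * E).
  by ring.
by rewrite ler_pdivrMr ?mulr_gt0 //; lra.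
Qed.

Hypothesis z0 : val z = 0%N.

Lemma n_gt1 : (1 < n)%N. Proof. exact: leq_trans n5. Qed.
Let side1 : 'I_n := Ordinal n_gt1.

Lemma adj_z1 : adj z side1.
Proof. by rewrite /adj /gap /= [nat_of_ord z]z0. Qed.

(** The two images of the end are distinct boundary points, so no [y] can be close to both. The side
    condition says that the end is not on wall [z]; then the product is at least 2 sin^2 (2 pi/m)
    times a nonzero square. *)
Lemma axis_end_move (x : R) : 0 < x -> x ^+ 2 = 2 * kap * x - 1 -> x * kap != 1 ->
  0 < mink (r z *m axis_end x) (r side1 *m axis_end x).
Proof.
move=> x0 hx xk; set e := axis_end x.
have c1 : mink (s z) (s side1) = cos (2 * pi / m%:R) by rewrite mink_adj // adj_z1.
have al : mink e (s z) != 0.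
  rewrite /e /axis_end minkDl minkZl mink_side_self // (minkC (s k)) -/kap.
  by apply: contra xk => /eqP h; apply/eqP; lra.
have sn := sin_theta_gt0 R m4 m_even; have cs := cos2Dsin2 (2 * pi / m%:R : R).
have en : mink e e = 0 by exact: axis_end_null.
clearbody e.
rewrite !reflE !minkDl !minkDr !minkZl !minkZr en c1.
rewrite ![mink (s _) e]minkC; move: (mink e (s side1)) => be; set a := mink e (s z) in al *.
set c := cos _ in cs *; set S := sin _ in cs sn.
have a2 : 0 < a ^+ 2 by rewrite lt_def sqr_ge0 sqrf_eq0 al.
have -> : 0 + 2 * be * be + (2 * a * a + 2 * a * (2 * be * c)) =
  2 * ((be + c * a) ^+ 2 + S ^+ 2 * a ^+ 2).
  have -> : S ^+ 2 = 1 - c ^+ 2 by lra.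
  by ring.
have : 0 < S ^+ 2 * a ^+ 2 by rewrite mulr_gt0 // exprn_gt0.
by have := sqr_ge0 (be + c * a); lra.
Qed.

(** [mink_four] for the two images of the end, [y] and [o] makes [y] pair well with one image;
    moving that reflection to the other side of [B] gives the claim. *)
Lemma axis_end_push (x : R) : 0 < x -> x ^+ 2 = 2 * kap * x - 1 -> x * kap != 1 ->
  exists2 c : R, 0 < c & forall y, inH2 y ->
    exists i, c * (r i *m y) it 0 <= mink (r i *m y) (axis_end x).
Proof.
move=> x0 hx xk; have F0 := axis_end_move x0 hx xk.
set e := axis_end x in F0 *; set F := mink _ _ in F0.
have ec : causal e by exact: axis_end_causal.
have roH i : inH2 (r i *m o) by apply: refl_H2 => //; exact: org_H2.
have rc i : causal (r i *m e).
  split; first by rewrite refl_isom //; case: ec.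
  by rewrite -mink_orgl -refl_mink_sym mink_causal_ge0 //; apply: H2_causal.
pose K := 1 + (r z *m e) it 0 + (r side1 *m e) it 0.
have t1 := (rc z).2; have t2 := (rc side1).2.
have K0 : 0 < K by rewrite /K; lra.
pose K2 := (r z *m o) it 0 + (r side1 *m o) it 0.
have t3 := H2_t_ge1 (roH z); have t4 := H2_t_ge1 (roH side1).
have K20 : 0 < K2 by rewrite /K2; lra.
exists (F / (4 * K * (2 * K2))); first by rewrite divr_gt0 // !mulr_gt0.
move=> y hy; have y1 := H2_t_ge1 hy.
have h := mink_four (rc z) (rc side1) (H2_causal hy) (H2_causal (org_H2 R)).
rewrite -/F !mink_orgr in h.
have g1 := mink_causal_ge0 (rc z) (H2_causal hy).
have g2 := mink_causal_ge0 (rc side1) (H2_causal hy).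
have h2 : F * y it 0 <= 2 * K * (mink (r z *m e) y + mink (r side1 *m e) y).
  apply: le_trans h _; rewrite -mulrA ler_pM2l // mulrDr lerD //.
    by rewrite mulrC ler_wpM2r // /K; lra.
  by rewrite ler_wpM2r // /K; lra.
have conc i : (r i *m o) it 0 <= K2 -> F * y it 0 <= 4 * K * mink (r i *m e) y ->
   F / (4 * K * (2 * K2)) * (r i *m y) it 0 <= mink (r i *m y) e.
  move=> hi hF; have -> : mink (r i *m y) e = mink (r i *m e) y.
    by rewrite refl_mink_sym // minkC.
  have ty : (r i *m y) it 0 <= 2 * K2 * y it 0.
    rewrite -[leLHS]mink_orgl -refl_mink_sym //.
    apply: le_trans (mink_le_t (H2_causal (roH i)) (H2_causal hy)) _.
    by rewrite mulrA ler_pM2r //; lra.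
  apply: (@le_trans _ _ (F / (4 * K * (2 * K2)) * (2 * K2 * y it 0))).
    by rewrite ler_pM2l // divr_gt0 // !mulr_gt0.
  have -> : F / (4 * K * (2 * K2)) * (2 * K2 * y it 0) = F * y it 0 / (4 * K).
    by field; rewrite !gt_eqF.
  by rewrite ler_pdivrMr ?mulr_gt0 // [leRHS]mulrC.
have [hle|hlt] := leP (mink (r z *m e) y) (mink (r side1 *m e) y).
  exists side1; apply: conc; first by rewrite /K2; lra.
  apply: le_trans h2 _; have : 0 <= 2 * K * (mink (r side1 *m e) y - mink (r z *m e) y).
    by rewrite mulr_ge0 ?mulr_ge0 ?subr_ge0 // ltW.
  by lra.
exists z; apply: conc; first by rewrite /K2; lra.
apply: le_trans h2 _; have : 0 <= 2 * K * (mink (r z *m e) y - mink (r side1 *m e) y).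
  by rewrite mulr_ge0 ?mulr_ge0 ?subr_ge0 // ltW.
by lra.
Qed.

(** Whatever the later letters are, at least one of the n choices for the first letter pushes the
    point away from the end. *)
Lemma EE_push (x c : R) : (forall y, inH2 y ->
    exists i, c * (r i *m y) it 0 <= mink (r i *m y) (axis_end x)) ->
  forall l, n%:R^-1 <= EE l.+1 (fun w => (c * bt (wm w) <= mink (wm w *m o) (axis_end x))%R%:R).
Proof.
move=> hc l; have n0 := n_gt0 n5; rewrite EE_S // -[leLHS](EE_const n0 l).
apply: EE_le => // w _; rewrite ler_peMr ?invr_ge0 //.
have [i hi] := hc _ (Gam_orbit_H2 n5 m4 (Gam_wm R m w)).
rewrite (bigD1 i) //= btE -!mulmxA hi lerDl.
by apply: sumr_ge0.
Qed.

Lemma ep_push : exists2 c : R, 0 < c & forall y, inH2 y ->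
  exists i, c * (r i *m y) it 0 <= mink (r i *m y) ep.
Proof.
apply: axis_end_push; rewrite ?invr_gt0 ?mu_gt0 ?muV_root //.
have m1 := mu_gt1; have mr := mu_root; rewrite -(inj_eq (mulfI mu_neq0)) mulrA divff ?mu_neq0 //.
by rewrite mul1r mulr1 lt_eqF //; nra.
Qed.

Lemma em_push : exists2 c : R, 0 < c & forall y, inH2 y ->
  exists i, c * (r i *m y) it 0 <= mink (r i *m y) em.
Proof.
apply: axis_end_push; rewrite ?mu_gt0 ?mu_root //.
by rewrite gt_eqF //; apply: (lt_trans mu_gt1); rewrite ltr_pMr ?mu_gt0.
Qed.

End Axis.

(** * Factorisations along a geodesic *)

Section Chain.
Variables (R : realType) (n m : nat).
Hypotheses (n5 : (5 <= n)%N) (m4 : (4 <= m)%N) (m_even : ~~ odd m).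
Local Notation Gam := (@Gamma R n m).
Local Notation o := (org R).
Local Notation bt := (@bt R).

Variables (G0 : 'M[R]_3) (L c1 Cg : R).
Hypotheses (hG0 : Gam G0) (L0 : 0 < L) (c10 : 0 < c1) (Cg1 : 1 <= Cg)
  (btG0 : bt G0 <= Cg * L).

(* [g o] and [g G0 o] both lie near the geodesic from [o] to [Z o]. *)
Definition on_geodesic (Z g : 'M[R]_3) :=
  Gam g /\ c1 * L * (bt g * bt (invmx G0 *m invmx g *m Z)) <= bt Z.

Lemma Cg_gt0 : 0 < Cg. Proof. exact: lt_le_trans Cg1. Qed.

(** The separation needed in [good_sep], and in [step_const] the loss per piece in [good_step]. Both
    come from [bt_four] combined with [good_tail]; only the first grows with [L]. *)
Definition sep_const : R := 8 * Cg / c1 * L.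
Definition step_const : R := (8 * Cg ^+ 2 + 2) / c1.

Variable Z : 'M[R]_3.
Hypothesis hZ : Gam Z.

Lemma Gam_rest g : Gam g -> Gam (invmx G0 *m invmx g *m Z).
Proof. by move=> hg; apply: GamM => //; apply: GamM; apply: GamV. Qed.

Lemma bt_four a b c d : Gam a -> Gam b -> Gam c -> Gam d ->
  bt (invmx a *m b) * bt (invmx c *m d) <=
  2 * (bt (invmx a *m c) * bt (invmx b *m d) + bt (invmx a *m d) * bt (invmx b *m c)).
Proof.
move=> ha hb hc hd; rewrite -!(bt_orbit n5 m4) //.
by apply: mink_four; apply: H2_causal; apply: (Gam_orbit_H2 n5 m4).
Qed.

Lemma bt_swap a b : Gam a -> Gam b -> bt (invmx a *m b) = bt (invmx b *m a).
Proof. by move=> ha hb; rewrite -!(bt_orbit n5 m4) // minkC. Qed.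

Lemma invmx1 : invmx (1%:M : 'M[R]_3) = 1%:M.
Proof. by rewrite -[LHS]mulmx1 mulVmx // unitmx1. Qed.

Lemma good_rest g : on_geodesic Z g ->
  bt (invmx G0 *m invmx g *m Z) <= bt Z / (c1 * L * bt g).
Proof.
move=> [hg h]; have b0 := bt_gt0 n5 m4 hg.
rewrite ler_pdivlMr; last by rewrite !mulr_gt0.
by apply: le_trans h; rewrite le_eqVlt; apply/orP; left; apply/eqP; ring.
Qed.

Lemma good_tail g : on_geodesic Z g -> bt (invmx g *m Z) <= 2 * Cg / c1 * (bt Z / bt g).
Proof.
move=> hg; have h := good_rest hg; case: hg => hg _.
have b0 := bt_gt0 n5 m4 hg; have hr := Gam_rest hg.
have -> : invmx g *m Z = G0 *m (invmx G0 *m invmx g *m Z).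
  by rewrite !mulmxA mulmxV ?mul1mx // (Gam_unit n5 m4 hG0).
apply: le_trans (btM n5 m4 hG0 hr) _.
have -> : 2 * Cg / c1 * (bt Z / bt g) = 2 * (Cg * L * (bt Z / (c1 * L * bt g))).
  by field; rewrite !gt_eqF.
rewrite ler_pM2l //; apply: ler_pM => //; apply: ltW; exact: (bt_gt0 n5 m4).
Qed.

(** The four-point inequality for g, g', 1, Z bounds beta(g^-1 g') by a constant times beta(g') /
    beta(g): near a geodesic the separation is the difference of the distances to [o]. *)
Lemma good_sep g g' : on_geodesic Z g -> on_geodesic Z g' -> bt g <= bt g' ->
  sep_const < bt (invmx g *m g') -> L * bt g <= bt g'.
Proof.
move=> gd gd' le_gg' hs; have t := good_tail gd; have t' := good_tail gd'.
case: gd gd' => hg _ [hg' _]; have b0 := bt_gt0 n5 m4 hg; have b0' := bt_gt0 n5 m4 hg'.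
have h := bt_four hg hg' (Gam1 R n m) hZ.
rewrite invmx1 !mulmx1 mul1mx !(btV n5 m4) // in h.
have z0 := bt_gt0 n5 m4 hZ.
have h2 : bt (invmx g *m g') * bt Z <= 8 * Cg / c1 * (bt g' / bt g) * bt Z.
  apply: le_trans h _.
  have e1 : bt g * bt (invmx g' *m Z) <= bt g' * (2 * Cg / c1 * (bt Z / bt g)).
    apply: ler_pM => //; first exact: ltW.
      by apply/ltW/(bt_gt0 n5 m4)/GamM => //; exact: GamV.
    apply: le_trans t' _; rewrite ler_pM2l; last by rewrite divr_gt0 // mulr_gt0 // Cg_gt0.
    by rewrite ler_pM2l // lef_pV2.
  have e2 : bt (invmx g *m Z) * bt g' <= bt g' * (2 * Cg / c1 * (bt Z / bt g)).
    by rewrite mulrC ler_pM2l.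
  have -> : 8 * Cg / c1 * (bt g' / bt g) * bt Z = 4 * (bt g' * (2 * Cg / c1 * (bt Z / bt g))) by ring.
  by lra.
rewrite ler_pM2r // in h2; have := lt_le_trans hs h2.
rewrite /sep_const ltr_pM2l; last by rewrite divr_gt0 // mulr_gt0 // Cg_gt0.
by rewrite ltr_pdivlMr // => /ltW.
Qed.

(** The four-point inequality for g G0, g', 1, Z. The ratios beta(g') / beta(g) telescope along a
    chain, and each gap saves a factor [L]. *)
Lemma good_step g g' : on_geodesic Z g -> on_geodesic Z g' -> L * bt g <= bt g' ->
  bt (invmx G0 *m invmx g *m g') <= step_const * (bt g' / (L * bt g)).
Proof.
move=> gd gd' le_gg'; have t' := good_tail gd'; have u := good_rest gd.
case: gd gd' => hg _ [hg' _]; have b0 := bt_gt0 n5 m4 hg; have b0' := bt_gt0 n5 m4 hg'.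
have hgG : Gam (g *m G0) by exact: GamM.
have iG : invmx (g *m G0) = invmx G0 *m invmx g.
  have hu := Gam_unit n5 m4 hg; have hu0 := Gam_unit n5 m4 hG0.
  rewrite -[RHS](mulKmx (Gam_unit n5 m4 hgG)) -mulmxA (mulKVmx hu0) mulmxV //.
  by rewrite mulmx1.
have h := bt_four hgG hg' (Gam1 R n m) hZ.
rewrite invmx1 !mulmx1 mul1mx (btV n5 m4 hgG) (btV n5 m4 hg') iG in h.
have z0 := bt_gt0 n5 m4 hZ.
have gG : bt (g *m G0) <= 2 * Cg * (L * bt g).
  apply: le_trans (btM n5 m4 hg hG0) _.
  have -> : 2 * Cg * (L * bt g) = 2 * (bt g * (Cg * L)) by ring.
  by rewrite ler_pM2l // ler_pM2l.
have Lg0 : 0 < L * bt g by rewrite mulr_gt0.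
have q1 : 1 <= bt g' / (L * bt g) by rewrite ler_pdivlMr ?mul1r.
have e1 : bt (g *m G0) * bt (invmx g' *m Z) <= 4 * Cg ^+ 2 / c1 * (bt g' / (L * bt g)) * bt Z.
  apply: (@le_trans _ _ (2 * Cg * (L * bt g) * (2 * Cg / c1 * (bt Z / bt g')))).
    apply: ler_pM => //; apply/ltW/(bt_gt0 n5 m4) => //.
    by apply: GamM => //; exact: GamV.
  have -> : 2 * Cg * (L * bt g) * (2 * Cg / c1 * (bt Z / bt g')) =
    4 * Cg ^+ 2 / c1 * (bt g' / (L * bt g))^-1 * bt Z by field; rewrite !gt_eqF.
  rewrite ler_pM2r // ler_pM2l; last by rewrite divr_gt0 // mulr_gt0 // exprn_gt0 // Cg_gt0.
  by apply: (le_trans _ q1); rewrite invf_le1 ?divr_gt0.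
have e2 : bt (invmx G0 *m invmx g *m Z) * bt g' <= c1^-1 * (bt g' / (L * bt g)) * bt Z.
  have -> : c1^-1 * (bt g' / (L * bt g)) * bt Z = bt Z / (c1 * L * bt g) * bt g'.
    by field; rewrite !gt_eqF.
  by rewrite ler_pM2r.
rewrite -(ler_pM2r z0); apply: le_trans h _.
have -> : step_const * (bt g' / (L * bt g)) * bt Z =
  2 * (4 * Cg ^+ 2 / c1 * (bt g' / (L * bt g)) * bt Z + c1^-1 * (bt g' / (L * bt g)) * bt Z).
  by rewrite /step_const; ring.
by rewrite ler_pM2l // lerD.
Qed.

End Chain.

(** * Weights of factorisations *)

Section Weights.
Variables (R : realType) (n m : nat).
Hypotheses (n5 : (5 <= n)%N) (m4 : (4 <= m)%N) (m_even : ~~ odd m).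
Local Notation Gam := (@Gamma R n m).
Local Notation bt := (@bt R).

Variables (G0 : 'M[R]_3) (K : 'M[R]_3 -> R) (tau M : R) (S : seq 'M[R]_3).
Hypotheses (hG0 : Gam G0) (K0 : forall g, 0 < K g) (tau0 : 0 < tau) (M0 : 0 < M).
Hypotheses (uS : uniq S) (SG : forall g, g \in S -> Gam g).
Hypothesis massK : forall F, uniq F -> (forall g, g \in F -> Gam g) -> \sum_(g <- F) K g <= M.

(* Total weight of the factorisations [g = a_1 G0 a_2 G0 ... G0 a_(r+1)]. *)
Fixpoint Qw (r : nat) (g : 'M[R]_3) : R :=
  if r is r'.+1 then tau * \sum_(a <- S) K a * Qw r' (invmx G0 *m invmx a *m g) else K g.

Lemma Qw_ge0 r g : 0 <= Qw r g.
Proof.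
elim: r g => [|r IH] g /=; first exact: ltW.
by rewrite mulr_ge0 ?(ltW tau0) // sumr_ge0 // => a _; rewrite mulr_ge0 // ltW.
Qed.

(** For fixed [a] the map g -> (a G0)^-1 g is injective, so every layer multiplies the mass by at
    most tau M. *)
Lemma Qw_mass r F : uniq F -> (forall g, g \in F -> Gam g) ->
  \sum_(g <- F) Qw r g <= M * (tau * M) ^+ r.
Proof.
elim: r F => [|r IH] F uF FG; first by rewrite expr0 mulr1 massK.
rewrite /= -mulr_sumr exchange_big /= [_ ^+ r.+1]exprS.
have -> : M * (tau * M * (tau * M) ^+ r) = tau * (M * (M * (tau * M) ^+ r)) by ring.
rewrite ler_pM2l //; set B := M * (tau * M) ^+ r.
have B0 : 0 <= B by rewrite mulr_ge0 ?exprn_ge0 ?mulr_ge0 ?(ltW M0) ?(ltW tau0).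
apply: (@le_trans _ _ (\sum_(a <- S) K a * B)); last first.
  by rewrite -mulr_suml ler_wpM2r // massK.
rewrite big_seq [leRHS]big_seq; apply: ler_sum => a aS.
have hGa : invmx G0 *m invmx a \in unitmx.
  by apply: (Gam_unit n5 m4 (_ : Gam _)); apply: GamM; apply: GamV => //; exact: SG.
rewrite -mulr_sumr ler_pM2l // -(big_map (fun g => invmx G0 *m invmx a *m g) xpredT (Qw r)).
apply: IH; first by rewrite map_inj_uniq //; exact: (can_inj (mulKmx hGa)).
move=> _ /mapP[g gF ->]; apply: GamM; last exact: FG.
by apply: GamM; apply: GamV => //; exact: SG.
Qed.

Lemma Qw_step r a g : a \in S ->
  tau * (K a * Qw r (invmx G0 *m invmx a *m g)) <= Qw r.+1 g.
Proof.
move=> aS; rewrite /= ler_pM2l // (bigD1_seq a) //= lerDl.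
by apply: sumr_ge0 => b _; rewrite mulr_ge0 ?Qw_ge0 // ltW.
Qed.

Definition Qsum (N : nat) (g : 'M[R]_3) : R := \sum_(r < N.+1) Qw r g.

(** The number of gaps varies with the path, so all numbers are added up; tau M = 1/2 makes the
    series geometric with total at most 2 M. *)
Lemma Qsum_mass N F : tau * M = 1 / 2 -> uniq F -> (forall g, g \in F -> Gam g) ->
  \sum_(g <- F) Qsum N g <= 2 * M.
Proof.
move=> tM uF FG; rewrite exchange_big /=.
apply: (@le_trans _ _ (\sum_(r < N.+1) M * (1 / 2) ^+ r)).
  by apply: ler_sum => r _; rewrite -tM; exact: Qw_mass.
rewrite -mulr_sumr mulrC ler_pM2r //.
have h : 0 <= (1 / 2 : R) < 1 by lra.
apply: le_trans (sum_geo_le N.+1 h) _.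
by rewrite le_eqVlt; apply/orP; left; apply/eqP; field.
Qed.

Lemma Qsum_ge N r g : (r <= N)%N -> Qw r g <= Qsum N g.
Proof.
move=> rN; have rN' : (r < N.+1)%N by [].
rewrite /Qsum (bigD1 (Ordinal rN')) //= lerDl.
by apply: sumr_ge0 => j _; exact: Qw_ge0.
Qed.

End Weights.

Section ChainWeight.
Variables (R : realType) (n m : nat).
Hypotheses (n5 : (5 <= n)%N) (m4 : (4 <= m)%N) (m_even : ~~ odd m).
Local Notation Gam := (@Gamma R n m).
Local Notation bt := (@bt R).

Variables (G0 : 'M[R]_3) (L c1 Cg sx tau : R) (S : seq 'M[R]_3).
Hypotheses (hG0 : Gam G0) (L0 : 0 < L) (c10 : 0 < c1) (Cg1 : 1 <= Cg)
  (btG0 : bt G0 <= Cg * L) (sx0 : 0 < sx) (tau0 : 0 < tau) (uS : uniq S).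

Definition Kw (g : 'M[R]_3) : R := expR (- sx * ln (bt g)).
Local Notation Q := (Qw G0 Kw tau S).
Local Notation C3 := (step_const c1 Cg).

Variable Z : 'M[R]_3.
Hypothesis hZ : Gam Z.

Lemma C3_ge : c1^-1 <= C3.
Proof.
rewrite /step_const -[leLHS]mul1r ler_pM2r ?invr_gt0 //.
by have := sqr_ge0 Cg; lra.
Qed.

Lemma C3_gt0 : 0 < C3.
Proof. by apply: lt_le_trans C3_ge; rewrite invr_gt0. Qed.

Lemma Kw_gt0 g : 0 < Kw g. Proof. exact: expR_gt0. Qed.

Lemma Kw_ge g B : Gam g -> bt g <= B -> expR (- sx * ln B) <= Kw g.
Proof.
move=> hg hB; have b0 := bt_gt0 n5 m4 hg.
have B0 : 0 < B by apply: lt_le_trans hB.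
by rewrite ler_expR !mulNr lerN2 ler_pM2l // ler_ln.
Qed.

(** One term of the sum defining [Qw] is kept at each layer. The exponents telescope: there are
    (size l) + 1 pieces after [g], the last one ending at [Z], each with the constant ln C3 - ln
    L. *)
Lemma chain_weight_from g l :
  on_geodesic n m G0 L c1 Z g -> (forall h, h \in l -> on_geodesic n m G0 L c1 Z h) ->
  path (fun a b => L * bt a <= bt b) g l ->
  (forall a b, a \in g :: l -> b \in l -> invmx G0 *m invmx a *m b \in S) ->
  tau ^+ size l * expR (- sx * (ln (bt Z) - ln (bt g) + (size l).+1%:R * (ln C3 - ln L)))
  <= Q (size l) (invmx G0 *m invmx g *m Z).
Proof.
elim: l g => [|g' l IH] g gd gdl /= pl hS.
  have [hg _] := gd; have b0 := bt_gt0 n5 m4 hg; have bZ := bt_gt0 n5 m4 hZ.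
  rewrite expr0 !mul1r; apply: le_trans (Kw_ge (Gam_rest n5 m4 hG0 hZ hg) (good_rest n5 m4 L0 c10 gd)).
  have e : ln (bt Z / (c1 * L * bt g)) = ln (bt Z) - (ln c1 + ln L + ln (bt g)).
    by rewrite ln_div ?posrE ?mulr_gt0 // !lnM ?posrE ?mulr_gt0.
  rewrite ler_expR !mulNr lerN2 ler_pM2l // e.
  have : ln c1^-1 <= ln C3 by rewrite ler_ln ?posrE ?invr_gt0 ?C3_gt0 ?C3_ge.
  by rewrite lnV ?posrE //; lra.
case/andP: pl => hl pl.
have gd' : on_geodesic n m G0 L c1 Z g' by apply: gdl; rewrite mem_head.
have [hg _] := gd; have [hg' _] := gd'.
have b0 := bt_gt0 n5 m4 hg; have b0' := bt_gt0 n5 m4 hg'.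
have IH' := IH g' gd' _ pl _.
have {}IH' : tau ^+ size l * expR (- sx * (ln (bt Z) - ln (bt g') + (size l).+1%:R * (ln C3 - ln L)))
  <= Q (size l) (invmx G0 *m invmx g' *m Z).
  apply: IH' => [h hh|a b ha hb]; first by apply: gdl; rewrite inE hh orbT.
  by apply: hS; rewrite inE ?ha ?hb orbT.
set a := invmx G0 *m invmx g *m g'.
have aS : a \in S by apply: hS; rewrite mem_head.
have ha : Gam a by apply: GamM => //; apply: GamM; apply: GamV.
have st := @Qw_step R G0 Kw tau S Kw_gt0 tau0 uS (size l) a (invmx G0 *m invmx g *m Z) aS.
apply: le_trans st; rewrite exprS -mulrA ler_pM2l //.
have -> : invmx G0 *m invmx a *m (invmx G0 *m invmx g *m Z) = invmx G0 *m invmx g' *m Z.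
  have hB : invmx G0 *m invmx g \in unitmx.
    by apply: (Gam_unit n5 m4 (_ : Gam _)); apply: GamM; apply: GamV.
  have ea : invmx a *m (invmx G0 *m invmx g) = invmx g'.
    have au := Gam_unit n5 m4 ha; have gu := Gam_unit n5 m4 hg'.
    have e2 : invmx a *m (invmx G0 *m invmx g) *m g' = 1%:M by rewrite -mulmxA mulVmx.
    by rewrite -[LHS](mulmxK gu) e2 mul1mx.
  by rewrite mulmxA -[invmx G0 *m invmx a *m _]mulmxA ea.
have KA := Kw_ge ha (good_step n5 m4 hG0 L0 c10 Cg1 btG0 hZ gd gd' hl).
apply: le_trans (ler_pM _ _ KA IH'); [|exact: expR_ge0|]; last first.
  by rewrite mulr_ge0 ?exprn_ge0 ?expR_ge0 // ltW.
rewrite mulrCA ler_pM2l ?exprn_gt0 // -expRD ler_expR.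
have e : ln (C3 * (bt g' / (L * bt g))) = ln C3 + (ln (bt g') - (ln L + ln (bt g))).
  rewrite (lnM C3_gt0) ?posrE ?divr_gt0 ?mulr_gt0 //; congr (_ + _).
  by rewrite ln_div ?posrE ?mulr_gt0 // lnM ?posrE.
rewrite e le_eqVlt; apply/orP; left; apply/eqP.
have -> : (size l).+2%:R = (size l).+1%:R + 1 :> R by rewrite natr1.
by ring.
Qed.

Lemma chain_weight l :
  (forall h, h \in l -> on_geodesic n m G0 L c1 Z h) ->
  sorted (fun a b => L * bt a <= bt b) l ->
  (forall b, b \in l -> b \in S) ->
  (forall a b, a \in l -> b \in l -> invmx G0 *m invmx a *m b \in S) ->
  tau ^+ size l * expR (- sx * (ln (bt Z) + (size l)%:R * (ln C3 - ln L)))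
  <= Q (size l) Z.
Proof.
case: l => [|g l] gd sl lS pS.
  by rewrite expr0 mul1r mul0r addr0 /=; exact: Kw_ge.
have gd0 : on_geodesic n m G0 L c1 Z g by apply: gd; rewrite mem_head.
have [hg _] := gd0.
have h := @chain_weight_from g l gd0 _ sl _.
have {}h : tau ^+ size l * expR (- sx * (ln (bt Z) - ln (bt g) + (size l).+1%:R * (ln C3 - ln L)))
  <= Q (size l) (invmx G0 *m invmx g *m Z).
  apply: h => [b bl|a b al bl]; first by apply: gd; rewrite inE bl orbT.
  by apply: pS => //; rewrite inE bl orbT.
have st := @Qw_step R G0 Kw tau S Kw_gt0 tau0 uS (size l) g Z (lS g (mem_head _ _)).
apply: le_trans st; rewrite /= exprS -mulrA ler_pM2l //.
have KA := Kw_ge hg (lexx (bt g)).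
apply: le_trans (ler_pM _ _ KA h); [|exact: expR_ge0|]; last first.
  by rewrite mulr_ge0 ?exprn_ge0 ?expR_ge0 // ltW.
rewrite mulrCA ler_pM2l ?exprn_gt0 // -expRD ler_expR.
by rewrite le_eqVlt; apply/orP; left; apply/eqP; ring.
Qed.

End ChainWeight.

Lemma block_fits (M N i l : nat) : (M * i <= l - (2 * N).+1)%N -> (0 < M * i)%N ->
  (M * i + 2 * N < l)%N.
Proof. lia. Qed.

(** Three blocks absorb the rounding of the division, the final block and the truncated
    subtraction. *)
Lemma block_count (M N l : nat) : (2 * N < M)%N ->
  (l <= (l - (2 * N).+1) %/ M * M + 3 * M)%N.
Proof.
move=> MN; have M0 : (0 < M)%N by rewrite (leq_ltn_trans _ MN).
have := ltn_ceil (l - (2 * N).+1) M0; rewrite (mulSn (_ %/ _)).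
by move: (_ %/ _ * M)%N => X; lia.
Qed.

(** * Places where the walk follows the axis *)

Section GoodTimes.
Variables (R : realType) (n m : nat).
Hypotheses (n5 : (5 <= n)%N) (m4 : (4 <= m)%N) (m_even : ~~ odd m).
Local Notation s := (@side_normal R n m).
Local Notation wm := (@word_mat R n m).
Local Notation Gam := (@Gamma R n m).
Local Notation o := (org R).
Local Notation len := (@len R n m).
Local Notation EE := (@EE R n).
Local Notation bt := (@bt R).

Variables (z k : 'I_n).
Hypothesis kap1 : 1 < mink (s z) (s k).
Local Notation mu := (@emu R n m z k).
Local Notation lam := (@lam R n m z k).
Local Notation ep := (@axis_end R n m z k mu^-1).
Local Notation em := (@axis_end R n m z k mu).
Local Notation gam := (@gam R n m z k).
Local Notation seg := (@seg n z k).

Variables (c c1 Cg : R) (N M A : nat).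
Hypotheses (c0 : 0 < c) (c10 : 0 < c1) (Cg1 : 1 <= Cg)
  (M_gt : (2 * N < M)%N) (A_ge : (2 * N <= A)%N).
Hypothesis lowerN : forall x y : 'cV[R]_3, inH2 x -> inH2 y ->
  c * y it 0 <= mink y ep -> c * x it 0 <= mink x em ->
  c1 * lam ^+ N * (y it 0 * x it 0) <= mink y (gam N *m x).
Hypothesis pushP : forall l,
  n%:R^-1 <= EE l.+1 (fun w => (c * bt (wm w) <= mink (wm w *m o) ep)%R%:R).
Hypothesis pushM : forall l,
  n%:R^-1 <= EE l.+1 (fun w => (c * bt (wm w) <= mink (wm w *m o) em)%R%:R).

(** [rev u] gives the inverse: seen from the current position, the starting point is not near the
    attracting end. *)
Definition past (u : seq 'I_n) := c * bt (wm (rev u)) <= mink (wm (rev u) *m o) ep.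

(** The future [v] starts 2 N letters after a multiple of [M]; index [i] thus looks at the i-th
    later multiple of [M] in the full word. *)
Definition returns (v : seq 'I_n) (i : nat) :=
  (M * i - 2 * N <= size v)%N && (len (wm (take (M * i - 2 * N) v)) <= A)%N.

(** The index range is long enough: beyond it M i - 2 N exceeds the size of [v]. *)
Definition future (v : seq 'I_n) :=
  (c * bt (wm v) <= mink (wm v *m o) em) && ~~ has (returns v) (iota 1 (size v + 2 * N)).

(** Only multiples of [M] > 2 N are tested, so blocks do not overlap. The two strict inequalities
    keep past and future nonempty, as [EE_push] requires a letter. *)
Definition good (a : nat) (w : seq 'I_n) :=
  [&& (0 < a)%N, (M * a + 2 * N < size w)%N, past (take (M * a) w),
      take (2 * N) (drop (M * a) w) == seg N & future (drop (M * a + 2 * N) w)].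

Lemma good_split a w : good a w ->
  w = take (M * a) w ++ seg N ++ drop (M * a + 2 * N) w.
Proof.
case/and5P => _ sz _ /eqP <- _.
by rewrite addnC -drop_drop cat_take_drop cat_take_drop.
Qed.

Lemma good_geodesic a w : good a w ->
  on_geodesic n m (gam N) (lam ^+ N) c1 (wm w) (wm (take (M * a) w)).
Proof.
move=> ga; have ew := good_split ga; case/and5P: ga => _ _ hp _ /andP[hf _].
set u := take _ w in ew hp *; set v := drop _ w in ew hf; split; first exact: Gam_wm.
have gu := Gam_unit n5 m4 (Gam_wm R m u); have gg := Gam_unit n5 m4 (Gam_gam R m z k N).
have -> : invmx (gam N) *m invmx (wm u) *m wm w = wm v.
  by rewrite ew !wm_cat -mulmxA (mulKmx gu) (mulKmx gg).
have hbt : bt (wm (rev u)) = bt (wm u).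
  by rewrite -(invmx_wm R n5 m4) (btV n5 m4 (Gam_wm R m u)).
have := lowerN (Gam_orbit_H2 n5 m4 (Gam_wm R m v)) (Gam_orbit_H2 n5 m4 (Gam_wm R m (rev u))).
rewrite -!btE => /(_ hp hf); rewrite hbt => /le_trans; apply.
rewrite (Gam_mink_adj n5 m4 _ _ (Gam_wm R m (rev u))) (invmx_wm R n5 m4) revK.
by rewrite /bt ew !wm_cat -!mulmxA.
Qed.

(** The element between the two places is gamma^N y with [y] a prefix of the future of [a]. As that
    future does not return, len y > A, and gamma^N cancels at most 2 N letters. *)
Lemma good_apart a b w : good a w -> good b w -> (a < b)%N ->
  (A < 2 * N + len (invmx (wm (take (M * a) w)) *m wm (take (M * b) w)))%N.
Proof.
move=> ga gb ab; have ew := good_split ga.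
case/and5P: ga => a0 sza _ _ /andP[_ /hasPn nr]; case/and5P: gb => _ szb _ _ _.
have hM : (M * a + 2 * N < M * b)%N.
  by apply: (@leq_trans (M * a + M)); rewrite ?ltn_add2l // -mulnSr leq_mul2l ab orbT.
set v := drop _ w in ew nr.
have sv : size v = (size w - (M * a + 2 * N))%N by rewrite size_drop.
have eb : take (M * b) w = take (M * a) w ++ seg N ++ take (M * (b - a) - 2 * N) v.
  rewrite {1}ew take_cat size_takel; last by rewrite ltnW // (leq_trans _ sza) // ltnS leq_addr.
  rewrite ifF; last by apply/negbTE; rewrite -leqNgt leq_mul2l ltnW // orbT.
  rewrite take_cat size_seg ifF; last first.
    by apply/negbTE; rewrite -leqNgt; lia.
  by congr (_ ++ (_ ++ take _ _)); rewrite mulnBr.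
have gu := Gam_unit n5 m4 (Gam_wm R m (take (M * a) w)).
rewrite eb wm_cat (mulKmx gu) wm_cat -/(gam N); set y := wm (take _ v).
have hy : Gam y by exact: Gam_wm.
have hg : Gam (gam N) by exact: Gam_gam.
have ly : (A < len y)%N.
  have := nr (b - a)%N; rewrite mem_iota subn_gt0 ab /= /returns negb_and => h.
  have {}h : ~~ (M * (b - a) - 2 * N <= size v)%N || ~~ (len y <= A)%N.
    apply: h; rewrite add1n ltnS sv.
    have : (b - a <= M * (b - a))%N by rewrite leq_pmull // (leq_ltn_trans _ M_gt).
    by rewrite mulnBr; lia.
  move: h; rewrite -ltnNge -ltnNge => /orP[|//]; rewrite sv mulnBr; lia.
apply: leq_trans ly _.
have -> : y = invmx (gam N) *m (gam N *m y) by rewrite (mulKmx (Gam_unit n5 m4 hg)).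
apply: leq_trans (lenM (GamV n5 m4 hg) (GamM hg hy)) _.
rewrite (mulKmx (Gam_unit n5 m4 hg)) (lenV n5 m4 hg) leq_add2r.
by apply: leq_trans (len_wm _ _ _) _; rewrite size_seg.
Qed.

Definition escape_small : Prop :=
  2 * ((5 / 4) ^+ A * (49 / 50) ^+ (M - 2 * N)) <= (2 * n%:R)^-1 :> R.

Hypothesis hescape : escape_small.

Let n0 := n_gt0 n5.

(** Union bound. Since M i - 2 N >= (M - 2 N) i, the i-th return has probability at most (5/4)^A
    q^i; with q <= 1/2 the sum is at most twice its first term. This is half of the 1/n guaranteed
    by [pushM]. *)
Lemma EE_returns l : EE l (fun v => (has (returns v) (iota 1 (l + 2 * N)))%:R) <= (2 * n%:R)^-1.
Proof.
set q : R := (49 / 50) ^+ (M - 2 * N).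
have q0 : 0 <= q by rewrite exprn_ge0.
have A0 : 1 <= (5 / 4) ^+ A :> R by apply: exprn_ege1; lra.
have nR : 5 <= n%:R :> R := n_ge5 R n5.
have ni : (2 * n%:R)^-1 <= 1 / 2 :> R.
  by rewrite div1r lef_pV2 ?posrE; lra.
have hq : 2 * ((5 / 4) ^+ A * q) <= (2 * n%:R)^-1 by exact: hescape.
have q4 : q <= 1 / 2.
  have : q <= (5 / 4) ^+ A * q by rewrite ler_peMl.
  lra.
apply: le_trans hq.
apply: (@le_trans _ _ (\sum_(i <- iota 1 (l + 2 * N)) (5 / 4) ^+ A * q ^+ i)); last first.
  rewrite -mulr_sumr mulrCA ler_wpM2l ?exprn_ge0 //.
  have -> : \sum_(i <- iota 1 (l + 2 * N)) q ^+ i = q * \sum_(i < l + 2 * N) q ^+ i.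
    rewrite (iotaDl 1 0) big_map mulr_sumr -[RHS](big_mkord xpredT (fun i => q * q ^+ i)) /index_iota subn0.
    by apply: eq_bigr => i _; rewrite add1n exprS.
  have hs : \sum_(i < l + 2 * N) q ^+ i <= (1 - q)^-1 by apply: sum_geo_le; lra.
  have : (1 - q)^-1 <= 2 by rewrite -[leRHS]invrK lef_pV2 ?posrE; lra.
  by nra.
apply: (@le_trans _ _ (\sum_(i <- iota 1 (l + 2 * N)) EE l (fun v => (returns v i)%:R))).
  rewrite -EE_sum //; apply: EE_le => // v _.
  elim: (iota _ _) => [|i r IH]; first by rewrite big_nil.
  rewrite big_cons /=; case: (returns v i) => /=; last by rewrite add0r.
  by rewrite lerDl sumr_ge0.
rewrite big_seq [leRHS]big_seq; apply: ler_sum => i; rewrite mem_iota => /andP[i1 _].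
set j := (M * i - 2 * N)%N.
have le_j : (49 / 50) ^+ j <= q ^+ i :> R.
  rewrite /q -exprM; apply: ler_wiXn2l; [lra|lra|].
  rewrite /j mulnBl leq_sub2l // leq_pmulr //.
have [lj|lj] := leqP j l; last first.
  apply: (@le_trans _ _ (EE l (fun=> 0))); last by rewrite EE_const // mulr_ge0 ?exprn_ge0.
  by apply: EE_le => // v sv; rewrite /returns sv leqNgt lj.
apply: (@le_trans _ _ (EE l (fun v => (len (wm (take j v)) <= A)%N%:R))).
  by apply: EE_le => // v sv; rewrite /returns -/j; case: (_ <= size v)%N.
rewrite (EE_take n0 (fun v => (len (wm v) <= A)%N%:R) lj).
apply: le_trans (escape R n5 m4 m_even j A) _.
by rewrite ler_wpM2l // exprn_ge0.
Qed.

Lemma EE_future l : (2 * n%:R)^-1 <= EE l.+1 (fun v => (future v)%:R).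
Proof.
have nR : 5 <= n%:R :> R := n_ge5 R n5.
have h1 := pushM l; have h2 := EE_returns l.+1.
have e : n%:R^-1 - (2 * n%:R)^-1 = (2 * n%:R)^-1 :> R by field; lra.
rewrite -[leLHS]e; apply: le_trans (lerB h1 h2) _; rewrite -EE_B //; apply: EE_le => // v sv.
rewrite /future sv; case: (c * _ <= _); case: (has _ _) => /=; lra.
Qed.

Lemma EE_past j : n%:R^-1 <= EE j.+1 (fun u => (past u)%:R).
Proof.
rewrite (EE_rev n0 j.+1 (fun w => (c * bt (wm w) <= mink (wm w *m o) ep)%R%:R)).
exact: pushP.
Qed.

(** Past, block and future read disjoint letters, hence are independent: 1/n, n^(-2N) and 1/(2n)
    multiply. *)
Lemma EE_good a l : (0 < a)%N -> (M * a + 2 * N < l)%N ->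
  n%:R^-1 ^+ (2 * N) / (2 * n%:R ^+ 2) <= EE l (fun w => (good a w)%:R).
Proof.
move=> a0 al; have nR : 5 <= n%:R :> R := n_ge5 R n5.
have [j Ej] : exists j, (M * a = j.+1)%N.
  by exists (M * a).-1; rewrite prednK // muln_gt0 a0 andbT (leq_ltn_trans _ M_gt).
have [i Ei] : exists i, (l - (M * a + 2 * N) = i.+1)%N.
  by exists (l - (M * a + 2 * N)).-1; rewrite prednK // subn_gt0.
have -> : l = (M * a + (2 * N + i.+1))%N by rewrite -Ei; lia.
rewrite EE_cat; have h1 := EE_past j; have h2 := EE_future i.
have h3 := @EE_word R n n5 (seg N); rewrite size_seg in h3.
have -> : n%:R^-1 ^+ (2 * N) / (2 * n%:R ^+ 2) = n%:R^-1 * (n%:R^-1 ^+ (2 * N) * (2 * n%:R)^-1) :> R.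
  by field; lra.
have e : EE (M * a) (fun u => EE (2 * N + i.+1) (fun w => (good a (u ++ w))%:R)) =
  EE j.+1 (fun u => (past u)%:R) * (EE (2 * N) (fun w => (w == seg N)%:R) * EE i.+1 (fun v => (future v)%:R)).
  rewrite Ej -EE_Zr //; apply: EE_ext => // u su; rewrite EE_cat -EE_Zr // -EE_Z //.
  apply: EE_ext => // w sw; rewrite -!EE_Z //; apply: EE_ext => // v sv.
  rewrite /good a0 !size_cat su sw sv Ej /=.
  rewrite take_size_cat // drop_size_cat // take_size_cat // catA drop_size_cat ?size_cat ?su ?sw //.
  rewrite ltn_add2l addnS ltnS leq_addr /=.
  by case: (past u); case: (w == _); case: (future v); rewrite ?mul1r ?mul0r.
rewrite e h3; have p1 : 0 <= n%:R^-1 ^+ (2 * N) :> R by rewrite exprn_ge0 // invr_ge0.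
have p2 : 0 <= n%:R^-1 :> R by rewrite invr_ge0.
have p3 : 0 <= (2 * n%:R)^-1 :> R by rewrite invr_ge0 mulr_ge0.
by apply: ler_pM => //; rewrite ler_wpM2l.
Qed.

Definition ngood (w : seq 'I_n) : nat := count (fun a => good a w) (iota 1 (size w)).

Lemma EE_ngood l : n%:R^-1 ^+ (2 * N) / (2 * n%:R ^+ 2) * (l%:R / M%:R - 3)
  <= EE l (fun w => (ngood w)%:R).
Proof.
set p := _ / _ : R; have nR : 5 <= n%:R :> R := n_ge5 R n5.
have p0 : 0 <= p by rewrite /p divr_ge0 ?mulr_ge0 ?exprn_ge0 ?invr_ge0.
have M0 : (0 < M)%N by rewrite (leq_ltn_trans _ M_gt).
have MR : 0 < M%:R :> R by rewrite ltr0n.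
pose K := ((l - (2 * N).+1) %/ M)%N.
have Kl : (K <= l)%N by apply: leq_trans (leq_div _ _) (leq_subr _ _).
have -> : EE l (fun w => (ngood w)%:R) = \sum_(a <- iota 1 l) EE l (fun w => (good a w)%:R).
  rewrite -EE_sum //; apply: EE_ext => // w sw.
  by rewrite /ngood sw -sum1_count natr_sum big_mkcond /=; apply: eq_bigr => a _; case: ifP.
rewrite -(subnKC Kl) iotaD big_cat /=.
have tail : 0 <= \sum_(i <- iota (1 + K) (l - K)) EE l (fun w => (good i w)%:R).
  by apply: sumr_ge0 => i _; apply: EE_ge0.
apply: (@le_trans _ _ (\sum_(i <- iota 1 K) EE (K + (l - K)) (fun w => (good i w)%:R))); last first.
  by rewrite lerDl subnKC.
rewrite subnKC //; apply: (@le_trans _ _ (\sum_(i <- iota 1 K) p)); last first.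
  rewrite big_seq [leRHS]big_seq; apply: ler_sum => i; rewrite mem_iota add1n ltnS => /andP[i1 iK].
  apply: EE_good => //.
  apply: block_fits; last by rewrite muln_gt0 M0.
  by apply: leq_trans (leq_trunc_div _ M); rewrite mulnC leq_mul2r iK orbT.
rewrite big_const_seq count_predT size_iota iter_addr_0 -[leRHS]mulr_natr ler_wpM2l //.
rewrite lerBlDr ler_pdivrMr //.
have := block_count l M_gt; rewrite -/K.
rewrite -(ler_nat R) natrD !natrM => /le_trans; apply.
by rewrite [leRHS]mulrDl.
Qed.

Hypothesis btG0 : bt (gam N) <= Cg * lam ^+ N.
Local Notation L := (lam ^+ N).
Hypothesis far : forall g, Gam g -> (A < 2 * N + len g)%N -> sep_const L c1 Cg < bt g.

(** Sorted by distance from [o], that is by position along the geodesic, which need not be the order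
    in time. *)
Definition good_points (w : seq 'I_n) : seq 'M[R]_3 :=
  sort (fun a b => bt a <= bt b)
    [seq wm (take (M * a) w) | a <- iota 1 (size w) & good a w].

Lemma size_good_points w : size (good_points w) = ngood w.
Proof. by rewrite size_sort size_map size_filter. Qed.

Lemma good_pointsP w g : g \in good_points w ->
  on_geodesic n m (gam N) L c1 (wm w) g /\ exists j, g = wm (take j w).
Proof.
rewrite mem_sort => /mapP[a]; rewrite mem_filter => /andP[ga _] ->.
by split; [exact: good_geodesic | exists (M * a)%N].
Qed.

Lemma far_pair a b w : good a w -> good b w -> a != b ->
  sep_const L c1 Cg < bt (invmx (wm (take (M * a) w)) *m wm (take (M * b) w)).
Proof.
move=> ga gb; case: ltngtP => // h _.
  by apply: far; [exact: (GamM (GamV n5 m4 (Gam_wm R m _)) (Gam_wm R m _)) | exact: good_apart].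
rewrite (bt_swap n5 m4 (Gam_wm R m _) (Gam_wm R m _)).
by apply: far; [exact: (GamM (GamV n5 m4 (Gam_wm R m _)) (Gam_wm R m _)) | exact: good_apart].
Qed.

Lemma good_points_uniq w : uniq (good_points w).
Proof.
rewrite sort_uniq map_inj_in_uniq ?filter_uniq ?iota_uniq // => a b.
rewrite !mem_filter => /andP[ga _] /andP[gb _] e; apply/eqP/negPn/negP => ab.
have /orP[h|h] : (a < b)%N || (b < a)%N by rewrite -neq_ltn.
  have := good_apart ga gb h; rewrite e (mulVmx (Gam_unit n5 m4 (Gam_wm R m _))).
  by rewrite len1 addn0 ltnNge A_ge.
have := good_apart gb ga h; rewrite e (mulVmx (Gam_unit n5 m4 (Gam_wm R m _))).
by rewrite len1 addn0 ltnNge A_ge.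
Qed.

Lemma good_points_sorted w : sorted (fun a b => L * bt a <= bt b) (good_points w).
Proof.
have lt0 : 0 < L by rewrite exprn_gt0 // lam_gt0.
have pw1 : pairwise (fun a b => bt a <= bt b) (good_points w).
  rewrite -sorted_pairwise; last by move=> b a d; exact: le_trans.
  by apply: sort_sorted => a b; exact: le_total.
have pw2 : pairwise (fun a b => a != b) (good_points w).
  by rewrite -uniq_pairwise good_points_uniq.
apply: pairwise_sorted.
have : pairwise [rel a b | (bt a <= bt b) && (a != b)] (good_points w).
  by rewrite pairwise_relI pw1 pw2.
apply: sub_in_pairwise (allss _) => a b aw bw /= /andP[ab nab].
have [gda _] := good_pointsP aw; have [gdb _] := good_pointsP bw.
apply: (good_sep n5 m4 (Gam_gam R m z k N) lt0 c10 Cg1 btG0 (Gam_wm R m w) gda gdb ab).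
move: aw bw; rewrite !mem_sort => /mapP[i]; rewrite mem_filter => /andP[gi _] ea.
move=> /mapP[j]; rewrite mem_filter => /andP[gj _] eb.
rewrite ea eb; apply: far_pair => //.
by apply: contraNneq nab => ij; rewrite ea eb ij.
Qed.

Definition prefixes (l : nat) : seq 'M[R]_3 :=
  [seq wm (take j (tval w)) | w <- enum {: l.-tuple 'I_n}, j <- iota 0 l.+1].

(** A finite list containing every factor but the last that can occur in the factorisation of a word
    of length [l]. *)
Definition support (l : nat) : seq 'M[R]_3 :=
  undup (prefixes l ++ [seq invmx (gam N) *m invmx a *m b | a <- prefixes l, b <- prefixes l]).

Lemma mem_prefixes w j : wm (take j w) \in prefixes (size w).
Proof.
have -> : take j w = take (minn j (size w)) w.
  by case: (leqP j (size w)) => // h; rewrite take_size take_oversize // ltnW.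
apply/allpairsP; exists (in_tuple w, minn j (size w)); split; rewrite ?mem_enum //.
by rewrite mem_iota [X in (_ <= X)%N && _]/= leq0n add0n ltnS geq_minr.
Qed.

Lemma prefixes_Gam l g : g \in prefixes l -> Gam g.
Proof. by move=> /allpairsP[[w j] [_ _ ->]]; exact: Gam_wm. Qed.

Lemma support_Gam l g : g \in support l -> Gam g.
Proof.
rewrite mem_undup mem_cat => /orP[/prefixes_Gam //|/allpairsP[[a b] /= [ha hb ->]]].
apply: GamM; last exact: prefixes_Gam hb.
exact: (GamM (GamV n5 m4 (Gam_gam R m z k N)) (GamV n5 m4 (prefixes_Gam ha))).
Qed.

Lemma good_points_weight (sx tau : R) w : 0 < sx -> 0 < tau ->
  tau ^+ ngood w * expR (- sx * (ln (bt (wm w)) + (ngood w)%:R * (ln (step_const c1 Cg) - ln L)))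
  <= Qw (gam N) (Kw sx) tau (support (size w)) (ngood w) (wm w).
Proof.
move=> sx0 tau0; rewrite -size_good_points.
have lt0 : 0 < L by rewrite exprn_gt0 // lam_gt0.
apply: (chain_weight n5 m4 (Gam_gam R m z k N) lt0 c10 Cg1 btG0 sx0 tau0 (undup_uniq _) (Gam_wm R m w)).
- by move=> h /good_pointsP[].
- exact: good_points_sorted.
- move=> b /good_pointsP[_ [j ->]].
  by rewrite mem_undup mem_cat mem_prefixes.
- move=> a b /good_pointsP[_ [i ->]] /good_pointsP[_ [j ->]].
  rewrite mem_undup mem_cat; apply/orP; right.
  by apply/allpairsP; exists (wm (take i w), wm (take j w)); rewrite !mem_prefixes.
Qed.

Variable Cm : R.
Hypotheses (Cm0 : 0 < Cm) (mass : forall (p : R) (F : seq 'M[R]_3),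
  0 < p <= 1 -> uniq F -> (forall g, g \in F -> Gam g) ->
  \sum_(g <- F) expR (- (1 + p) * ln (bt g)) <= Cm / p).
Local Notation C3 := (step_const c1 Cg).

(** [gibbs] with the weight [Qsum]: every gap gains ln L - ln C3 and pays ln (2 Cm / p), the
    logarithm of 1 / tau. *)
Lemma entropy_bound (p : R) l : 0 < p <= 1 -> ln C3 <= ln L ->
  entropy_k R n m l <= ln (2 * (Cm / p)) + (1 + p) * drift0 R n m l
    - EE l (fun w => (ngood w)%:R) * (ln L - ln C3 - ln (2 * (Cm / p))).
Proof.
move=> /andP[p0 p1] hL; set Mm := Cm / p.
have Mm0 : 0 < Mm by rewrite divr_gt0.
(* Chosen so that tau times the mass is 1/2, the ratio required by [Qsum_mass]. *)
pose tau : R := (2 * Mm)^-1; have tau0 : 0 < tau by rewrite invr_gt0 mulr_gt0.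
have sx0 : 0 < 1 + p by rewrite addr_gt0.
have tM : tau * Mm = 1 / 2 by rewrite /tau; field; rewrite gt_eqF.
pose Q := Qsum (gam N) (Kw (1 + p)) tau (support l) l.
have hm F : uniq F -> (forall g, g \in F -> Gam g) -> \sum_(g <- F) Kw (1 + p) g <= Mm.
  by move=> uF hF; apply: mass => //; rewrite p0.
have mQ F : uniq F -> (forall g, g \in F -> Gam g) -> \sum_(g <- F) Q g <= 2 * Mm.
  move=> uF hF; apply: (Qsum_mass n5 m4 (Gam_gam R m z k N) _ tau0 Mm0 (undup_uniq _) (@support_Gam l) hm l tM uF hF).
  by move=> g; exact: Kw_gt0.
have ng w : size w = l -> (ngood w <= l)%N.
  by move=> <-; rewrite /ngood -{2}(size_iota 1 (size w)) count_size.
have lowQ w : size w = l -> tau ^+ ngood w *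
    expR (- (1 + p) * (ln (bt (wm w)) + (ngood w)%:R * (ln C3 - ln L))) <= Q (wm w).
  move=> sw; have h := good_points_weight w sx0 tau0; rewrite sw in h.
  apply: le_trans h _; apply: Qsum_ge => //; [by move=> g; exact: Kw_gt0 | exact: ng].
have lo0 w : 0 < tau ^+ ngood w *
    expR (- (1 + p) * (ln (bt (wm w)) + (ngood w)%:R * (ln C3 - ln L))).
  by rewrite mulr_gt0 ?exprn_gt0 ?expR_gt0.
have Mm20 : 0 < 2 * Mm by rewrite mulr_gt0.
apply: le_trans (gibbs n5 Mm20 mQ (fun w sw => lt_le_trans (lo0 w) (lowQ w sw))) _.
rewrite -addrA lerD2l lerNl opprB.
have -> : EE l (fun w => (ngood w)%:R) * (ln L - ln C3 - ln (2 * Mm)) - (1 + p) * drift0 R n m l =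
  EE l (fun w => (ngood w)%:R * (ln L - ln C3 - ln (2 * Mm)) - (1 + p) * ln (2 * bt (wm w))).
  by rewrite EE_B // EE_Zr // EE_Z.
apply: EE_le => // w sw.
have hb := bt_wm_ge1 R n5 m4 w.
have h1 : ln (tau ^+ ngood w *
    expR (- (1 + p) * (ln (bt (wm w)) + (ngood w)%:R * (ln C3 - ln L)))) <= ln (Q (wm w)).
  by rewrite ler_ln ?posrE ?lo0 ?lowQ //; apply: lt_le_trans (lo0 w) (lowQ w sw).
apply: le_trans h1.
have lnt : ln tau = - ln (2 * Mm) by rewrite /tau lnV ?posrE.
have lnE (E : R) : ln (tau ^+ ngood w * expR E) = - ((ngood w)%:R * ln (2 * Mm)) + E.
  rewrite lnM ?posrE ?exprn_gt0 ?expR_gt0 // expRK lnXn // lnt.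
  by rewrite mulNrn -[ln (2 * Mm) *+ _]mulr_natl.
rewrite lnE.
have l2 : ln (bt (wm w)) <= ln (2 * bt (wm w)) by rewrite ler_ln ?posrE; lra.
have nn : 0 <= (ngood w)%:R :> R by [].
move: (ln (2 * bt (wm w))) (ln (bt (wm w))) l2 (ngood w)%:R nn (ln (2 * Mm)) (ln L) (ln C3) hL.
move=> X Y XY r r0 Z l1 l3 l13.
have : (1 + p) * Y <= (1 + p) * X by rewrite ler_pM2l.
(* The exponent 1 + p yields slightly more than r (ln L - ln C3); the surplus is nonnegative by [hL]
   and is dropped. *)
have : 0 <= p * (r * (l1 - l3)) by rewrite !mulr_ge0 ?subr_ge0 // ltW.
lra.
Qed.

End GoodTimes.

(** * The entropy gap *)

Section Gap.
Variables (R : realType) (n m : nat).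
Hypotheses (n5 : (5 <= n)%N) (m4 : (4 <= m)%N) (m_even : ~~ odd m).
Local Notation s := (@side_normal R n m).
Local Notation r := (@refl R n m).
Local Notation Gam := (@Gamma R n m).

Lemma ln_le_self (x : R) : 0 < x -> ln x <= x.
Proof. by move=> x0; rewrite -ler_expR lnK ?posrE //; have := expR_ge1Dx x; lra. Qed.

Lemma geo_small (a q e : R) : 0 < q < 1 -> 0 < a -> 0 < e -> exists k : nat, (0 < k)%N /\ a * q ^+ k <= e.
Proof.
move=> /andP[q0 q1] a0 e0; have qi : 0 < q^-1 - 1 by rewrite subr_gt0 invf_gt1.
have bern k : 1 + k%:R * (q^-1 - 1) <= q ^- k.
  elim: k => [|k IH]; first by rewrite mul0r addr0 expr0 invr1.
  rewrite -exprVn exprS exprVn -natr1.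
  have : 0 <= k%:R * (q^-1 - 1) * (q^-1 - 1) by rewrite !mulr_ge0 // ltW.
  have : 0 < q^-1 by rewrite invr_gt0.
  move: (q^-1) (q ^- k) qi IH => t u t1 IH t0 h.
  have : t * (1 + k%:R * (t - 1)) <= t * u by rewrite ler_pM2l.
  lra.
pose k := (Num.truncn (a / e / (q^-1 - 1))).+1.
exists k; split => //; have qk : 0 < q ^+ k by rewrite exprn_gt0.
rewrite -ler_pdivlMr // mulrC -ler_pdivrMr //; apply: le_trans (bern k).
have : a / e / (q^-1 - 1) < k%:R by apply: truncnS_gt.
by rewrite ltr_pdivrMr //; lra.
Qed.

Lemma linear_beats_ln (d B : R) : 0 < d -> exists N0 : nat, forall N, (N0 <= N)%N ->
  B <= N%:R * d - ln N.+1%:R.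
Proof.
move=> d0; pose X := (B + d / 2 + ln (2 / d)) / (d / 2).
exists (Num.truncn X).+1 => N hN.
have d2 : 0 < d / 2 by rewrite divr_gt0.
have XN : X <= N%:R by apply: ltW; apply: lt_le_trans (truncnS_gt _) _; rewrite ler_nat.
rewrite ler_pdivrMr // in XN.
have NS : N.+1%:R = N%:R + 1 :> R by rewrite natr1.
have N1 : 0 < N%:R + 1 :> R by rewrite -NS.
have e : ln N.+1%:R = ln ((N%:R + 1) * (d / 2)) + ln (2 / d).
  have q1 : 0 < (N%:R + 1) * (d / 2) by exact: mulr_gt0.
  have q2 : 0 < 2 / d by exact: divr_gt0.
  by rewrite NS -lnM ?posrE //; congr ln; field; rewrite gt_eqF.
have : ln ((N%:R + 1) * (d / 2)) <= (N%:R + 1) * (d / 2) by apply: ln_le_self; rewrite mulr_gt0.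
rewrite e; lra.
Qed.

Variables (z k : 'I_n).
Hypothesis z0 : val z = 0%N.
Hypothesis kap_gt : cosh (ln n%:R) < mink (s z) (s k).
Local Notation kap := (mink (s z) (s k)).
Local Notation mu := (@emu R n m z k).
Local Notation lam := (@lam R n m z k).

Lemma cosh_ln_n : cosh (ln n%:R) = (n%:R + n%:R^-1) / 2 :> R.
Proof.
have nR := n_ge5 R n5; rewrite /cosh expRN lnK // posrE; lra.
Qed.

Lemma kap_gt1 : 1 < kap.
Proof.
apply: le_lt_trans kap_gt; rewrite cosh_ln_n; have nR := n_ge5 R n5.
have : n%:R^-1 <= 5^-1 :> R by rewrite lef_pV2 ?posrE //; lra.
have : 0 < n%:R^-1 :> R by rewrite invr_gt0; lra.
lra.
Qed.

(** mu + 1/mu = 2 kap > n + 1/n, and t + 1/t is increasing for t >= 1. *)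
Lemma mu_gt_n : n%:R < mu.
Proof.
have nR := n_ge5 R n5; have k1 := kap_gt1; have hm := mu_gt1 k1.
have hi := mu_inv k1; have := kap_gt; rewrite cosh_ln_n => h.
rewrite ltNge; apply/negP => le_mn.
have mi : n%:R^-1 <= mu^-1 by rewrite lef_pV2 ?posrE //; lra.
have n0 : 0 < n%:R^-1 :> R by rewrite invr_gt0; lra.
have m0 : 0 < mu by lra.
have : (n%:R - mu) * (1 - n%:R^-1 * mu^-1) < 0.
  have e1 : n%:R * n%:R^-1 = 1 :> R by rewrite divff // gt_eqF //; lra.
  have e2 : mu * mu^-1 = 1 by rewrite divff // gt_eqF.
  have -> : (n%:R - mu) * (1 - n%:R^-1 * mu^-1) =
    n%:R - mu - (n%:R * n%:R^-1) * mu^-1 + n%:R^-1 * (mu * mu^-1) by ring.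
  by rewrite e1 e2; lra.
rewrite ltNge => /negP; apply; apply: mulr_ge0; first by rewrite subr_ge0.
rewrite subr_ge0 -invfM invf_le1; last by apply: mulr_gt0; lra.
by rewrite -[leLHS]mulr1; apply: ler_pM; lra.
Qed.

Lemma lam_gt_n2 : 2 * ln n%:R < ln lam.
Proof.
have nR := n_ge5 R n5; have h := mu_gt_n.
have m0 : 0 < mu by lra.
rewrite /lam lnXn // [ltRHS]mulr2n mulrDl !mul1r.
have : ln n%:R < ln mu by rewrite ltr_ln ?posrE //; lra.
by lra.
Qed.

(** [entropy_bound] loses p times the drift, at most p (l d1 + d0), and gains [Dl] for each of at
    least p l - 3 p0 good places on average. Once Dl >= d1 + 1, a surplus p l remains. All other
    constants are fixed before N, which is then taken large. *)
Lemma entropy_gap : exists p K : R, 0 < p /\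
  forall l, entropy_k R n m l <= drift0 R n m l - p * l%:R + K.
Proof.
have nR := n_ge5 R n5; have k1 := kap_gt1.
have [cp cp0 hcp] := ep_push n5 m4 m_even k1 z0.
have [cm cm0 hcm] := em_push n5 m4 m_even k1 z0.
pose c := Num.min cp cm; have c0 : 0 < c by rewrite lt_min cp0 cm0.
have tpos i y : inH2 y -> 0 <= (r i *m y) it 0.
  by move=> /(refl_H2 n5 m4 i) [_ /ltW].
have push x c' : c <= c' ->
    (forall y, inH2 y -> exists i, c' * (r i *m y) it 0 <= mink (r i *m y) (axis_end m z k x)) ->
    forall y, inH2 y -> exists i, c * (r i *m y) it 0 <= mink (r i *m y) (axis_end m z k x).
  move=> cc' h y hy; have [i hi] := h y hy; exists i; apply: le_trans hi.
  by apply: ler_wpM2r => //; exact: tpos.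
have ccp : c <= cp by rewrite ge_min lexx.
have pushP := EE_push n5 m4 (push _ _ ccp hcp).
have ccm : c <= cm by rewrite ge_min lexx orbT.
have pushM := EE_push n5 m4 (push _ _ ccm hcm).
have [c1 [N0 [c10 lower]]] := gam_lower n5 m4 k1 c0.
have [Cg [Cg1 btG]] := gam_upper n5 m4 k1.
have [A0 [A00 hA0]] := len_le_log R n5 m4 m_even.
have [Cm Cm0 mass] := orbit_mass R n5 m4 m_even.
have l1 := lam_gt1 k1; have lam0 := lam_gt0 k1.
have lnl : 0 < ln lam by rewrite ln_gt0.
have Cgp : 0 < Cg by lra.
have sc0 : 0 < 8 * Cg / c1 by rewrite divr_gt0 // mulr_gt0.
pose b := ln (8 * Cg / c1); pose e := ln lam.
(* ln [sep_const] is linear in N, so one slope [al] makes A = al (N + 1) large enough for every N;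
   two of its three extra units cover the 2 N letters of the block. *)
pose t := Num.truncn (A0 * (1 + `|b| + e)); pose al := t.+3.
have ht : A0 * (1 + `|b| + e) < t.+1%:R by exact: truncnS_gt.
have alP N : (2 * N)%:R + A0 * (1 + ln (sep_const (lam ^+ N) c1 Cg)) <= (al * N.+1)%:R :> R.
  have lX0 : 0 < lam ^+ N by exact: exprn_gt0.
  have -> : ln (sep_const (lam ^+ N) c1 Cg) = b + N%:R * e.
    by rewrite /sep_const (lnM sc0 lX0) (lnXn _ lam0) -[_ *+ N]mulr_natl.
  have tS : al%:R = t.+1%:R + 2 :> R by rewrite -natrD addn2.
  have NS : N.+1%:R = N%:R + 1 :> R by rewrite natr1.
  have e0 : 0 < e by exact: lnl.
  rewrite !natrM tS NS.
  have := ler_norm b; have := normr_ge0 b; have := ler0n R N.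
  move: (t.+1%:R) (`|b|) ht (N%:R) => T B hT X X0 B0 hb; clearbody b e.
  have : X * (A0 * (1 + B + e)) <= X * T by rewrite ler_wpM2l // ltW.
  have : A0 * b <= A0 * B by rewrite ler_pM2l.
  have : 0 <= X * (A0 * (1 + B)) by rewrite !mulr_ge0 ?addr_ge0 // ltW.
  have : 0 <= A0 * e by rewrite mulr_ge0 // ltW.
  by lra.
have al2 : (2 <= al)%N by [].
clearbody al.
have q01 : 0 < (49 / 50 : R) < 1 by lra.
have a54 : 0 < (5 / 4) ^+ al :> R by rewrite exprn_gt0 //; lra.
have e4 : 0 < (4 * n%:R)^-1 :> R by rewrite invr_gt0; lra.
(* With A = al (N + 1) and M - 2 N = M0 (N + 1), [escape_small] reduces to this bound, raised to the
   power N + 1. *)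
have [M0 [M00 hM0]] := geo_small q01 a54 e4.
pose C3 := step_const c1 Cg.
pose d1 := drift0 R n m 1; pose d0 := drift0 R n m 0.
have dlin l : drift0 R n m l <= l%:R * d1 + d0 by exact: drift0_linear.
have del : 0 < ln lam - 2 * ln n%:R by rewrite subr_gt0 lam_gt_n2.
(* All terms of the target d1 + 1 <= Dl that do not depend on N; they are beaten by N (ln lam - 2 ln
   n) - ln (N + 1). *)
pose B := d1 + 1 + `|ln C3| + ln (2 * Cm) + ln (2 * n%:R ^+ 2) + ln (2 + M0)%:R : R.
have [N1 hN1] := linear_beats_ln B del.
have [N2 hN2] := linear_beats_ln `|ln C3| lnl.
pose N := maxn N0 (maxn N1 N2).
have NN0 : (N0 <= N)%N by rewrite leq_maxl.
have NN1 : (N1 <= N)%N by rewrite leq_max leq_maxl orbT.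
have NN2 : (N2 <= N)%N by rewrite leq_max leq_maxr orbT.
clearbody N; have {hN1} gap1 := hN1 N NN1; have {hN2} gap2 := hN2 N NN2.
pose M := (2 * N + M0 * N.+1)%N; pose A := (al * N.+1)%N.
have M_gt : (2 * N < M)%N by rewrite /M -[ltnLHS]addn0 ltn_add2l muln_gt0 M00.
have A_ge : (2 * N <= A)%N by rewrite /A leq_mul.
have hesc : escape_small R n N M A.
  rewrite /escape_small /M /A addKn !exprM -exprMn.
  set x : R := _ * _ in hM0; have x0 : 0 <= x by rewrite mulr_ge0 ?exprn_ge0 //; lra.
  have x1 : x <= 1 by apply: le_trans hM0 _; rewrite invf_le1; lra.
  have xN : x ^+ N.+1 <= x by rewrite exprS ler_piMr // exprn_ile1.
  have -> : (2 * n%:R)^-1 = 2 * (4 * n%:R)^-1 :> R by field; lra.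
  by rewrite ler_pM2l //; apply: le_trans xN hM0.
have far g : Gam g -> (A < 2 * N + len n m g)%N -> sep_const (lam ^+ N) c1 Cg < bt g.
  move=> hg h; rewrite ltNge; apply/negP => hle; move: h; rewrite ltnNge => /negP; apply.
  have b0 := bt_gt0 n5 m4 hg; rewrite -(ler_nat R) natrD.
  apply: le_trans (alP N); rewrite lerD2l; apply: le_trans (hA0 g hg) _.
  by rewrite ler_pM2l // lerD2l ler_ln ?posrE //; apply: lt_le_trans hle.
have M0R : 0 < M%:R :> R by rewrite ltr0n (leq_ltn_trans _ M_gt).
pose p0 : R := n%:R^-1 ^+ (2 * N) / (2 * n%:R ^+ 2).
have ni0 : 0 < n%:R^-1 :> R by rewrite invr_gt0; lra.
have n20 : 0 < 2 * n%:R ^+ 2 :> R by rewrite mulr_gt0 // exprn_gt0 //; lra.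
have p00 : 0 < p0 by rewrite divr_gt0 // exprn_gt0.
(* The frequency of good places per letter, used also as the excess of the exponent over 1. *)
pose p := p0 / M%:R; have p_gt0 : 0 < p by rewrite divr_gt0.
have p1 : p <= 1.
  rewrite /p ler_pdivrMr // mul1r; apply: (@le_trans _ _ 1); last by rewrite ler1n (leq_ltn_trans _ M_gt).
  rewrite /p0 ler_pdivrMr // mul1r; apply: (@le_trans _ _ 1).
    by apply: exprn_ile1; [exact: ltW | rewrite invf_le1; lra].
  nra.
have p01 : 0 < p <= 1 by rewrite p_gt0.
have lnL : ln (lam ^+ N) = N%:R * ln lam by rewrite (lnXn _ lam0) -[_ *+ N]mulr_natl.
have lnN0 : 0 <= ln N.+1%:R :> R by rewrite ln_ge0 // ler1n.
have hL : ln C3 <= ln (lam ^+ N).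
  by rewrite lnL; apply: le_trans (ler_norm _) _; lra.
have hent l := entropy_bound n5 m4 m_even k1 c0 c10 Cg1 M_gt A_ge
  (fun x y => lower N x y NN0) (btG N) far Cm0 mass l p01 hL.
pose Dl := ln (lam ^+ N) - ln C3 - ln (2 * (Cm / p)).
have Dl1 : d1 + 1 <= Dl.
  have e1 : ln (2 * (Cm / p)) = ln (2 * Cm) - ln p.
    by rewrite mulrA ln_div ?posrE // mulr_gt0.
  have e2 : ln p = ln p0 - ln M%:R by rewrite /p ln_div ?posrE.
  have e3 : ln p0 = - (2 * N)%:R * ln n%:R - ln (2 * n%:R ^+ 2).
    rewrite /p0 ln_div ?posrE ?exprn_gt0 // lnXn // lnV ?posrE; last by lra.
    by rewrite mulNrn -[ln n%:R *+ _]mulr_natl mulNr.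
  have e4' : ln M%:R <= ln (2 + M0)%:R + ln N.+1%:R :> R.
    have s1 : 0 < (2 + M0)%:R :> R by rewrite ltr0n.
    have s2 : 0 < N.+1%:R :> R by rewrite ltr0n.
    rewrite -lnM ?posrE // ler_ln ?posrE ?mulr_gt0 // -natrM ler_nat /M mulnDl leq_add2r.
    by rewrite leq_mul2l leqnSn.
  rewrite /Dl lnL e1 e2 e3; have := ler_norm (ln C3); rewrite natrM.
  by move: gap1; rewrite /B; lra.
exists p, (ln (2 * (Cm / p)) + p * d0 + 3 * p0 * Dl); split => // l.
have hE := EE_ngood n5 m4 m_even k1 c0 c10 Cg1 M_gt A_ge pushP pushM hesc l.
rewrite -/p0 in hE; apply: le_trans (hent l) _; rewrite -/Dl.
set X := EE _ _ in hE *; set D := drift0 _ _ _ _.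
have hD : D <= l%:R * d1 + d0 by exact: dlin.
have d10 : 0 <= d1 by apply: drift0_ge0.
have Dl0 : 0 <= Dl by lra.
have e1 : p0 * (l%:R / M%:R - 3) = p * l%:R - 3 * p0 by rewrite /p; ring.
rewrite e1 in hE.
have h1 : (p * l%:R - 3 * p0) * Dl <= X * Dl by rewrite ler_wpM2r.
have h2 : p * l%:R * (d1 + 1) <= p * l%:R * Dl by rewrite ler_wpM2l // mulr_ge0 // ltW.
have h3 : p * D <= p * (l%:R * d1 + d0) by rewrite ler_pM2l.
by lra.
Qed.

End Gap.

Unset Implicit Arguments.

Theorem theorem6 (R : realType) (n m : nat) :
  (5 <= n)%N -> odd n -> (4 <= m)%N -> ~~ odd m ->
  sin (pi / m%:R) *
    cosh (arccosh (cos (pi / m%:R) / sin (pi / n%:R))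
          + arccosh (cot (pi / m%:R) * cot (pi / n%:R)))
    > cosh (ln (n%:R : R)) ->
  forall x0 : 'cV[R]_3, inH2 x0 -> trivial_stab n m x0 ->
  exists h l v : R,
    (fun k : nat => entropy_k R n m k / k%:R) @ \oo --> h /\
    (fun k : nat => drift_k n m x0 k / k%:R) @ \oo --> l /\
    (fun k : nat => ln ((ball_card n m x0 k)%:R : R) / k%:R) @ \oo --> v /\
    h < l * v.
Proof.
move=> n5 n_odd m4 m_even hyp x0 hx0 _.
have n0 : (0 < n)%N by apply: leq_trans n5.
have nh : (n./2 < n)%N by rewrite -divn2 ltn_Pdiv.
(* For odd n the vertex opposite side 0 is shared by the sides (n - 1)/2 and (n + 1)/2; [n./2] is
   the first of them. *)
pose z : 'I_n := Ordinal n0; pose k : 'I_n := Ordinal nh.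
have gap : cosh (ln n%:R) < mink (side_normal R m z) (side_normal R m k).
  by rewrite -(far_side_mink R n5 m4 (k := k) (z := z) n_odd).
have [p [K [p0 hpK]]] := entropy_gap n5 m4 m_even (z := z) erefl gap.
have [h hh] := fekete (entropy_ge0 R m n5) (entropy_subadd R m n5).
have [l hl] := fekete (drift0_ge0 R n5 m4) (drift0_subadd R n5 m4).
exists h, l, 1; split => //; split; first exact: drift_limit hl.
split; first exact: ball_limit.
rewrite mulr1; suff : h <= l - p by lra.
apply: (cvg_le_limits (C := K) hh hl) => j j0.
have jR : 0 < j%:R :> R by rewrite ltr0n.
rewrite ler_pdivrMr // !mulrDl mulNr !divfK ?gt_eqF //; exact: hpK.
Qed.
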